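(* The functor $\mathrm{TAG}$, from the category of $\mathfrak{J}$-ternary superalgebras to the category of short $\mathfrak{sl}_2$-Lie superalgebras, is left adjoint to the functor $\hat{\mathrm T}$ from the category of short $\mathfrak{sl}_2$-Lie superalgebras to the category of $\mathfrak{J}$-ternary superalgebras: for any $\mathfrak{J}$-ternary superalgebra $(\mathfrak{J},\mathfrak{M})$ and any short $\mathfrak{sl}_2$-Lie superalgebra $\mathfrak{g}$ there is a natural bijection $$\mathrm{Hom}\big(\mathrm{TAG}(\mathfrak{J},\mathfrak{M}),\mathfrak{g}\big)\cong\mathrm{Hom}\big((\mathfrak{J},\mathfrak{M}),\hat{\mathrm T}(\mathfrak{g})\big),$$ with Hom-sets taken in the respective categories.
   Context: Everything is over $\mathbb{C}$; superspaces are $\mathbb{Z}_2$-graded. $\mathfrak{sl}_2=\mathfrak{sl}_2(\mathbb{C})$ has standard basis $e,f,h$ with $[e,f]=h$, $[h,e]=2e$, $[h,f]=-2f$; $V=\mathbb{C}e_1\oplus\mathbb{C}e_2$ is its natural representation; both have even degree. $\kappa(x,y)=4\,\mathrm{tr}(xy)$; $\det:V\otimes V\to\mathbb{C}$ is the determinant form; $\odot:V\otimes V\to\mathfrak{sl}_2$ is bilinear with $e_1\odot e_1=e$, $e_1\odot e_2=e_2\odot e_1=-\tfrac12h$, $e_2\odot e_2=-f$. A short $\mathfrak{sl}_2$-Lie superalgebra is a Lie superalgebra on which $\mathfrak{sl}_2$ acts by even derivations and which as $\mathfrak{sl}_2$-module is of the form $\mathfrak{sl}_2\otimes\mathfrak{J}\oplus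 V\otimes\mathfrak{M}\oplus\mathfrak{D}$ with $\mathfrak{J},\mathfrak{M},\mathfrak{D}$ superspaces with trivial $\mathfrak{sl}_2$-action; morphisms are even $\mathfrak{sl}_2$-linear morphisms of Lie superalgebras. A Jordan superalgebra is a superspace $\mathfrak{J}$ with an even product satisfying $a\cdot b=(-1)^{|a||b|}b\cdot a$ and $(a\cdot b)\cdot(c\cdot d)+(-1)^{|b||c|}(a\cdot c)\cdot(b\cdot d)+(-1)^{|b||d|+|c||d|}(a\cdot d)\cdot(b\cdot c)=((a\cdot b)\cdot c)\cdot d+(-1)^{|b||c|+|b||d|+|c||d|}((a\cdot d)\cdot c)\cdot b+(-1)^{|a||b|+|a||c|+|a||d|+|c||d|}((b\cdot d)\cdot c)\cdot a$. A special $\mathfrak{J}$-supermodule is a superspace $\mathfrak{M}$ with an even bilinear $\bullet:\mathfrak{J}\otimes\mathfrak{M}\to\mathfrak{M}$ such that $(a\cdot b)\bullet m=\tfrac12(a\bullet(b\bullet m)+(-1)^{|a||b|}b\bullet(a\bullet m))$. A $\mathfrak{J}$-ternary superalgebra $(\mathfrak{J},\mathfrak{M})$ consists of a Jordan superalgebra $(\mathfrak{J},\cdot)$, a special $\mathfrak{J}$-supermodule $(\mathfrak{M},\bullet)$, an even super-anticommutative bilinear map $\star:\mathfrak{M}\otimes\mathfrak{M}\to\mathfrak{J}$ ($m\star n=-(-1)^{|m||n|}n\star m$) and an even trilinear product $(-,-,-):\mathfrak{M}^{\otimes3}\to\mathfrak{M}$ such that for all homogeneous $a\in\mathfrak{J}$,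 $m,n,r,s,t\in\mathfrak{M}$: (SJT1) $a\cdot(m\star n)=\tfrac12((a\bullet m)\star n+(-1)^{|a||m|}m\star(a\bullet n))$; (SJT2) $a\bullet(m,n,s)=(a\bullet m,n,s)-(-1)^{|a||m|}(m,a\bullet n,s)+(-1)^{|a|(|m|+|n|)}(m,n,a\bullet s)$; (SJT3) $(m,n,s)=(-1)^{|m|(|n|+|s|)+|n||s|}(s,n,m)-(-1)^{|n||s|}(m\star s)\bullet n$; (SJT4) $(m,n,s)=(-1)^{|m||n|}(n,m,s)+(m\star n)\bullet s$; (SJT5) $(m,n,r)\star s+(-1)^{|r|(|m|+|n|)}r\star(m,n,s)=(-1)^{|n|(|r|+|s|)}m\star((r\star s)\bullet n)$; (SJT6) $(m,n,(r,s,t))=((m,n,r),s,t)+(-1)^{|r|(|m|+|n|)+|m||n|}(r,(n,m,s),t)+(-1)^{(|m|+|n|)(|r|+|s|)}(r,s,(m,n,t))$. A morphism $(\mathfrak{J},\mathfrak{M})\to(\mathfrak{J}',\mathfrak{M}')$ of ternary superalgebras is a pair $(\eta_1,\eta_2)$ of even linear maps $\eta_1:\mathfrak{J}\to\mathfrak{J}'$, $\eta_2:\mathfrak{M}\to\mathfrak{M}'$ with $\eta_1(a\cdot b)=\eta_1(a)\cdot\eta_1(b)$, $\eta_2(a\bullet m)=\eta_1(a)\bullet\eta_2(m)$, $\eta_1(m\star n)=\eta_2(m)\star\eta_2(n)$, $\eta_2(m,n,r)=(\eta_2(m),\eta_2(n),\eta_2(r))$. The functor $\hat{\mathrm T}$: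 for a short $\mathfrak{sl}_2$-Lie superalgebra $\mathfrak{g}$, $\hat{\mathrm T}(\mathfrak{g})=(\mathfrak{J}(\mathfrak{g}),\mathfrak{M}(\mathfrak{g}))$ with $\mathfrak{J}(\mathfrak{g})=\{a\in\mathfrak{g}:ha=2a\}$, $\mathfrak{M}(\mathfrak{g})=\{m\in\mathfrak{g}:hm=m\}$ and operations $2a\cdot b=[a,fb]=-[fa,b]$, $a\bullet m=[a,fm]=-[fa,m]$, $m\star n=[m,n]$, $(m,n,r)=-[[m,fn],r]$ (where $f\alpha$ is the action of $f\in\mathfrak{sl}_2$ on $\alpha\in\mathfrak{g}$); this is a $\mathfrak{J}$-ternary superalgebra, and morphisms are sent to their restrictions. For a $\mathfrak{J}$-ternary superalgebra and homogeneous $a,b,c\in\mathfrak{J}$, $m,n,r\in\mathfrak{M}$, the endomorphisms $\langle a,b\rangle,\partial_{m,n}\in\mathrm{End}(\mathfrak{J}\oplus\mathfrak{M})$ are defined by $\langle a,b\rangle(c)=a\cdot(b\cdot c)-(-1)^{|a||b|}b\cdot(a\cdot c)$, $\langle a,b\rangle(m)=\tfrac14(a\bullet(b\bullet m)-(-1)^{|a||b|}b\bullet(a\bullet m))$, $\partial_{m,n}(a)=\tfrac12((-1)^{|a|(|m|+|n|)}(a\bullet m)\star n-(-1)^{|a||n|}m\star(a\bullet n))$, $\partial_{m,n}(r)=\tfrac12(m\star n)\bullet r-(m,n,r)$. $\mathfrak{B}^s(\mathfrak{J},\mathfrak{M})=(\mathfrak{J}\otimes\mathfrak{J}\oplus\mathfrak{M}\otimes\mathfrak{M})/R^s(\mathfrak{J},\mathfrak{M})$,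 where $R^s(\mathfrak{J},\mathfrak{M})$ is spanned by the following elements, for homogeneous $a,b,c\in\mathfrak{J}$, $m,n,r,s\in\mathfrak{M}$: $I_{a,b}=a\otimes b+(-1)^{|a||b|}b\otimes a$; $I_{m,n}=m\otimes n-(-1)^{|m||n|}n\otimes m$; $I_{a,b,c}=(-1)^{|a||c|}(a\cdot b)\otimes c+(-1)^{|a||b|}(b\cdot c)\otimes a+(-1)^{|b||c|}(c\cdot a)\otimes b$; $I_{a,m,n}=(a\bullet m)\otimes n-(-1)^{|a||m|}m\otimes(a\bullet n)-(-1)^{|a|(|m|+|n|)}2(m\star n)\otimes a$; $I_{m,n,r,s}=\partial_{m,n}(r)\otimes s+(-1)^{(|m|+|n|)|r|}r\otimes\partial_{m,n}(s)+(-1)^{(|m|+|n|)(|r|+|s|)}\partial_{r,s}(m)\otimes n+(-1)^{(|r|+|s|)|n|}m\otimes\partial_{r,s}(n)$. Classes are denoted $\{a\otimes b\}$, $\{m\otimes n\}$. Put $D(\{z_1\otimes z_2\})=\{D(z_1)\otimes z_2\}+(-1)^{|D||z_1|}\{z_1\otimes D(z_2)\}$ for $D=\langle a,b\rangle$ or $\partial_{m,n}$. The functor TAG: $\mathrm{TAG}(\mathfrak{J},\mathfrak{M})=\mathfrak{sl}_2\otimes\mathfrak{J}\oplus V\otimes\mathfrak{M}\oplus\mathfrak{B}^s(\mathfrak{J},\mathfrak{M})$ is the short $\mathfrak{sl}_2$-Lie superalgebra with $\mathfrak{sl}_2$ acting on the first tensor factors (trivially on $\mathfrak{B}^s$) and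 super-anticommutative bracket: an element $\{a\otimes b\}$ (resp. $\{m\otimes n\}$) of $\mathfrak{B}^s$ acts as $D=\langle a,b\rangle$ (resp. $D=\partial_{m,n}$) by $[D,x\otimes c]=x\otimes D(c)$, $[D,v\otimes r]=v\otimes D(r)$, $[D,\{z_1\otimes z_2\}]=D(\{z_1\otimes z_2\})$; and $[x\otimes a,y\otimes b]=[x,y]\otimes a\cdot b+\tfrac12\kappa(x,y)\{a\otimes b\}$, $[x\otimes a,v\otimes m]=x(v)\otimes a\bullet m$, $[v\otimes m,w\otimes n]=(v\odot w)\otimes m\star n+\det(v,w)\{m\otimes n\}$. On morphisms it is induced by $x\otimes a\mapsto x\otimes\eta_1(a)$, $v\otimes m\mapsto v\otimes\eta_2(m)$, $\{a\otimes b\}\mapsto\{\eta_1(a)\otimes\eta_1(b)\}$, $\{m\otimes n\}\mapsto\{\eta_2(m)\otimes\eta_2(n)\}$. *)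

(* Defs.v *)
From HB Require Import structures.
From mathcomp Require Import all_boot all_order all_algebra generic_quotient.
From mathcomp Require Import ring_quotient freeg boolp.

Set Implicit Arguments.
Unset Strict Implicit.
Unset Printing Implicit Defensive.

Import GRing.Theory.
Local Open Scope ring_scope.
Local Open Scope quotient_scope.

Definition bilin (K : fieldType) (U V W : lmodType K) (f : U -> V -> W) : Prop :=
  (forall v, linear (f^~ v)) /\ (forall u, linear (f u)).

Section QuotientModule.
Variables (K : fieldType) (V : lmodType K) (P : V -> Prop).

Inductive span : V -> Prop :=
| span_gen x : P x -> span x
| span0 : span 0
| span_lin (k : K) x y : span x -> span y -> span (k *: x + y).

Lemma spanZ k x : span x -> span (k *: x).
Proof. by move=> sx; rewrite -[_ *: x]addr0; apply: span_lin => //; apply: span0. Qed.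

Lemma spanD x y : span x -> span y -> span (x + y).
Proof. by move=> sx sy; rewrite -[x]scale1r; apply: span_lin. Qed.

Lemma spanN x : span x -> span (- x).
Proof. by move=> sx; rewrite -scaleN1r; apply: spanZ. Qed.

Lemma spanB x y : span x -> span y -> span (x - y).
Proof. by move=> sx sy; apply: spanD => //; apply: spanN. Qed.

Definition span_pred : {pred V} := fun x => `[< span x >].

Lemma span_zmod_closed : zmod_closed span_pred.
Proof.
split=> [|x y]; rewrite !unfold_in; first exact/asboolP/span0.
by move=> /asboolP sx /asboolP sy; apply/asboolP/spanB.
Qed.

HB.instance Definition _ := GRing.isZmodClosed.Build V span_pred span_zmod_closed.

Definition quotmod : Type := Quotient.quot span_pred.

HB.instance Definition _ := GRing.Zmodule.on quotmod.

Definition qclass (x : V) : quotmod := \pi_(Quotient.quot span_pred) x.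

Lemma qclassP x y : qclass x = qclass y <-> span (x - y).
Proof.
split=> [/eqmodP|sxy]; last apply/eqmodP.
  by rewrite /= -[X in _ -> X]/(span (x - y)) => /asboolP.
exact/asboolP.
Qed.

Lemma qclass_surj (q : quotmod) : exists x, q = qclass x.
Proof. by exists (repr q); rewrite /qclass reprK. Qed.

Definition qscale (k : K) (q : quotmod) : quotmod := qclass (k *: repr q).

Lemma qclassD x y : qclass (x + y) = qclass x + qclass y.
Proof. by rewrite /qclass piE. Qed.

Lemma qscaleE k x : qscale k (qclass x) = qclass (k *: x).
Proof.
apply/qclassP; rewrite -scalerBr; apply: spanZ; apply/qclassP.
by rewrite /qclass reprK.
Qed.

Fact qscaleA a b q : qscale a (qscale b q) = qscale (a * b) q.
Proof. by have [x ->] := qclass_surj q; rewrite !qscaleE scalerA. Qed.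
Fact qscale1 : left_id 1 qscale.
Proof. by move=> q; have [x ->] := qclass_surj q; rewrite !qscaleE scale1r. Qed.
Fact qscaleDr : right_distributive qscale +%R.
Proof.
move=> a q r; have [x ->] := qclass_surj q; have [y ->] := qclass_surj r.
by rewrite -qclassD !qscaleE -qclassD scalerDr.
Qed.
Fact qscaleDl q : {morph qscale^~ q : a b / a + b}.
Proof.
by move=> a b; have [x ->] := qclass_surj q; rewrite !qscaleE -qclassD scalerDl.
Qed.

HB.instance Definition _ := GRing.Zmodule_isLmodule.Build K quotmod
  qscaleA qscale1 qscaleDr qscaleDl.

Lemma qclass_linear : linear qclass.
Proof. by move=> k x y; rewrite qclassD -qscaleE. Qed.

HB.instance Definition _ := GRing.isLinear.Build K V quotmod _ qclass qclass_linear.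

Lemma quotmod_lift (W : lmodType K) (f : V -> W) :
  linear f -> (forall x, P x -> f x = 0) ->
  exists2 g : quotmod -> W, linear g & forall x, g (qclass x) = f x.
Proof.
move=> lf fP.
pose fL : {linear V -> W} := HB.pack f (GRing.isLinear.Build K V W _ f lf).
have fs x : span x -> fL x = 0.
  elim=> {x} [x /fP //||k x y _ hx _ hy]; first by rewrite linear0.
  by rewrite linearP hx hy scaler0 addr0.
have gE x : fL (repr (qclass x)) = fL x.
  by apply/subr0_eq; rewrite -linearB; apply/fs/qclassP; rewrite /qclass reprK.
exists (fun q => fL (repr q)) => [k q r|x]; last exact: gE.
have [x ->] := qclass_surj q; have [y ->] := qclass_surj r.
by rewrite -linearP !gE linearP.
Qed.

End QuotientModule.

Section Tensor.
Variables (K : fieldType) (U V : lmodType K).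

Local Notation free := {freeg (U * V)%type / K}.
Local Notation gen u v := (<< (u, v) >> : free).

Inductive tensor_rel : free -> Prop :=
| tensor_rell k u u' v :
    tensor_rel (gen (k *: u + u') v - (k *: gen u v + gen u' v))
| tensor_relr k u v v' :
    tensor_rel (gen u (k *: v + v') - (k *: gen u v + gen u v')).

Definition tensor : lmodType K := quotmod tensor_rel.

Definition tens (u : U) (v : V) : tensor := qclass tensor_rel (gen u v).

Lemma tens_bilin : bilin tens.
Proof.
split=> [v k u u'|u k v v']; rewrite /tens -linearP; apply/qclassP/span_gen.
- exact: tensor_rell.
- exact: tensor_relr.
Qed.

Definition pure (t : tensor) : Prop := exists u v, t = tens u v.

Lemma tensor_span t : span pure t.
Proof.
have [x ->] := qclass_surj t; rewrite -[x]freeg_sumE linear_sum /=.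
elim/big_ind: _ => [||[u v] _]; [exact: span0|exact: spanD|].
have -> : << coeff (u, v) x *g (u, v) >> = coeff (u, v) x *: gen u v.
  by apply/eqP/freeg_eqP => z; rewrite coeffZ !coeffU mul1r.
by rewrite linearZ; apply/spanZ/span_gen; exists u, v.
Qed.

Lemma tensor_lift (W : lmodType K) (f : U -> V -> W) : bilin f ->
  exists2 g : tensor -> W, linear g & forall u v, g (tens u v) = f u v.
Proof.
move=> [fl fr]; pose F : free -> W := fglift (fun p => f p.1 p.2).
have FB x y : F (x - y) = F x - F y by exact: lift_is_additive.
have F0 : F 0 = 0 by rewrite -[X in F X](subrr 0) FB subrr.
have FN z : F (- z) = - F z by rewrite -sub0r FB F0 sub0r.
have FD x y : F (x + y) = F x + F y by rewrite -[y in LHS]opprK FB FN opprK.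
have FZ k x : F (k *: x) = k *: F x.
  rewrite -[x]freeg_sumE scaler_sumr.
  apply: (big_ind2 (fun a b => F a = k *: F b)) => [|a a' b b' ha hb|z _].
  - by rewrite F0 scaler0.
  - by rewrite !FD scalerDr ha hb.
  have -> : k *: << coeff z x *g z >> = << k * coeff z x *g z >> :> free.
    by apply/eqP/freeg_eqP => y; rewrite coeffZ !coeffU mulrA.
  by rewrite /F !liftU scalerA.
have FP : linear F by move=> k x y; rewrite FD FZ.
have Fg u v : F (gen u v) = f u v by rewrite /F liftU scale1r.
have [|g gl gE] := quotmod_lift FP (P := tensor_rel).
  by move=> x [k u u' v|k u v v']; rewrite FD FN FD FZ !Fg ?fl ?fr subrr.
by exists g => // u v; rewrite gE Fg.
Qed.

End Tensor.

(* [deg i x]: x is homogeneous of parity i (false = even, true = odd); the zero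
   vector is homogeneous of both parities. *)
Record superspace (K : fieldType) := Superspace {
  sspace :> lmodType K;
  deg : bool -> sspace -> Prop;
  deg0 : forall i, deg i 0;
  deg_lin : forall i (k : K) x y, deg i x -> deg i y -> deg i (k *: x + y);
  deg_split : forall x, exists x0 x1, [/\ deg false x0, deg true x1 & x = x0 + x1];
  deg_inter : forall x, deg false x -> deg true x -> x = 0
}.

Arguments deg {K s}.

Section Parity.
Variables (K : fieldType) (U : superspace K).
Implicit Types (x y : U) (i : bool).

Lemma degZ i (k : K) x : deg i x -> deg i (k *: x).
Proof. by move=> dx; rewrite -[_ *: x]addr0; apply: deg_lin => //; apply: deg0. Qed.

Lemma degD i x y : deg i x -> deg i y -> deg i (x + y).
Proof. by move=> dx dy; rewrite -[x]scale1r; apply: deg_lin. Qed.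

Lemma degN i x : deg i x -> deg i (- x).
Proof. by move=> dx; rewrite -scaleN1r; apply: degZ. Qed.

Lemma degB i x y : deg i x -> deg i y -> deg i (x - y).
Proof. by move=> dx dy; apply: degD => //; apply: degN. Qed.

Lemma deg_uniq x0 x1 y0 y1 : deg false x0 -> deg true x1 -> deg false y0 ->
  deg true y1 -> x0 + x1 = y0 + y1 -> x0 = y0 /\ x1 = y1.
Proof.
move=> dx0 dx1 dy0 dy1 e.
have e' : x0 - y0 = y1 - x1.
  by apply/eqP; rewrite subr_eq addrAC eq_sym subr_eq e addrC.
have z : x0 - y0 = 0 by apply: deg_inter; [exact: degB|rewrite e'; exact: degB].
by split; apply/eqP; [rewrite -subr_eq0 z|rewrite eq_sym -subr_eq0 -e' z].
Qed.

Lemma prj_exists x : exists p : bool -> U,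
  [/\ deg false (p false), deg true (p true) & x = p false + p true].
Proof.
by have [x0 [x1 [d0 d1 e]]] := deg_split x; exists (fun i => if i then x1 else x0).
Qed.

Definition prj i x : U := projT1 (cid (prj_exists x)) i.

Lemma deg_prj i x : deg i (prj i x).
Proof. by rewrite /prj; case: cid => p /= [? ? _]; case: i. Qed.

Lemma prjD x : x = prj false x + prj true x.
Proof. by rewrite /prj; case: cid => p /= []. Qed.

Lemma prj_eq x x0 x1 : deg false x0 -> deg true x1 -> x = x0 + x1 ->
  prj false x = x0 /\ prj true x = x1.
Proof. by move=> d0 d1 e; apply: deg_uniq => //; rewrite ?deg_prj -?prjD //; exact: deg_prj. Qed.

Lemma prj_id i j x : deg j x -> prj i x = if i == j then x else 0.
Proof.
case: j => dx.
  by have [] := @prj_eq x 0 x (deg0 _ _) dx (esym (add0r x)); case: i.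
by have [] := @prj_eq x x 0 dx (deg0 _ _) (esym (addr0 x)); case: i.
Qed.

Lemma prj_linear i : linear (prj i).
Proof.
move=> k x y; have [] := @prj_eq (k *: x + y)
  (k *: prj false x + prj false y) (k *: prj true x + prj true y).
- by apply: deg_lin; exact: deg_prj.
- by apply: deg_lin; exact: deg_prj.
- by rewrite {1}[x]prjD {1}[y]prjD scalerDr addrACA.
by case: i.
Qed.

End Parity.

Definition even_map (K : fieldType) (U V : superspace K) (f : U -> V) : Prop :=
  forall i x, deg i x -> deg i (f x).

Definition even_map2 (K : fieldType) (U V W : superspace K) (f : U -> V -> W) : Prop :=
  forall i j x y, deg i x -> deg j y -> deg (i (+) j) (f x y).

Section SuperspaceConstructions.
Variable K : fieldType.

Program Definition even_space (V : lmodType K) : superspace K :=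
  @Superspace K V (fun i x => if i then x = 0 else True) _ _ _ _.
Next Obligation. by case: i. Qed.
Next Obligation. by case: i H H0 => //= -> ->; rewrite scaler0 addr0. Qed.
Next Obligation. by exists x, 0; rewrite addr0. Qed.

Section DirectSum.
Variables U V : superspace K.

Program Definition dsum : superspace K :=
  @Superspace K (U * V)%type (fun i x => deg i x.1 /\ deg i x.2) _ _ _ _.
Next Obligation. by split; apply: deg0. Qed.
Next Obligation. by split; apply: deg_lin. Qed.
Next Obligation.
exists (prj false s, prj false s0), (prj true s, prj true s0).
by split; [split; exact: deg_prj..|congr (_, _); exact: prjD].
Qed.
Next Obligation. by congr (_, _); apply: deg_inter. Qed.

End DirectSum.

Section TensorProduct.
Variables U V : superspace K.

Definition pure_deg (i : bool) (t : tensor U V) : Prop :=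
  exists j k u v, [/\ deg j u, deg k v, i = j (+) k & t = tens u v].

Lemma stens_split t : exists t0 t1,
  [/\ span (pure_deg false) t0, span (pure_deg true) t1 & t = t0 + t1].
Proof.
elim: (tensor_span t) => {t} [t [u [v ->]]||k x y _ [x0 [x1 [a b ->]]] _ [y0 [y1 [c d ->]]]].
- have [Dl Dr] := @tens_bilin K U V.
  have tDl (u1 u2 : U) (w : V) : tens (u1 + u2) w = tens u1 w + tens u2 w.
    by have := Dl w 1 u1 u2; rewrite !scale1r.
  have tDr (u1 : U) (w1 w2 : V) : tens u1 (w1 + w2) = tens u1 w1 + tens u1 w2.
    by have := Dr u1 1 w1 w2; rewrite !scale1r.
  exists (tens (prj false u) (prj false v) + tens (prj true u) (prj true v)).
  exists (tens (prj false u) (prj true v) + tens (prj true u) (prj false v)).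
  split.
  + apply: spanD; apply: span_gen.
      by exists false, false, (prj false u), (prj false v); split=> //; exact: deg_prj.
    by exists true, true, (prj true u), (prj true v); split=> //; exact: deg_prj.
  + apply: spanD; apply: span_gen.
      by exists false, true, (prj false u), (prj true v); split=> //; exact: deg_prj.
    by exists true, false, (prj true u), (prj false v); split=> //; exact: deg_prj.
  by rewrite {1}[u]prjD {1}[v]prjD tDl !tDr addrACA [X in _ + X]addrC addrACA [X in _ + X]addrC -!addrA.
- by exists 0, 0; rewrite addr0; split=> //; exact: span0.
exists (k *: x0 + y0), (k *: x1 + y1).
by split; [exact: span_lin..|rewrite scalerDr addrACA].
Qed.

Lemma stens_inter t : span (pure_deg false) t -> span (pure_deg true) t -> t = 0.
Proof.
have [Dl Dr] := @tens_bilin K U V.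
have [|g gl gE] := @tensor_lift K U V (tensor U V)
    (fun u v => tens (prj false u) (prj false v) + tens (prj true u) (prj true v)).
  split=> [v k u u'|u k v v'] /=; rewrite !prj_linear.
    by rewrite !Dl scalerDr addrACA.
  by rewrite !Dr scalerDr addrACA.
pose gL : {linear tensor U V -> tensor U V} := HB.pack g (GRing.isLinear.Build K _ _ _ g gl).
have gLE u v : gL (tens u v) = tens (prj false u) (prj false v) + tens (prj true u) (prj true v).
  exact: gE.
have t0l (v : V) : tens (0 : U) v = 0 by have := Dl v (-1) 0 0; rewrite scaleN1r oppr0 addr0 scaleN1r addNr.
have t0r (u : U) : tens u (0 : V) = 0 by have := Dr u (-1) 0 0; rewrite scaleN1r oppr0 addr0 scaleN1r addNr.
move=> s0 s1.
have g0 : gL t = t.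
  elim: s0 => {t s1} [t [j [k [u [v [du dv e ->]]]]]||k x y _ hx _ hy].
  - rewrite gLE (prj_id false du) (prj_id true du) (prj_id false dv) (prj_id true dv).
    by case: j k e {du dv} => [] [] //= _; rewrite ?t0l ?t0r ?addr0 ?add0r.
  - by rewrite linear0.
  by rewrite linearP hx hy.
rewrite -g0; elim: s1 => {t s0 g0} [t [j [k [u [v [du dv e ->]]]]]||k x y _ hx _ hy].
- rewrite gLE (prj_id false du) (prj_id true du) (prj_id false dv) (prj_id true dv).
  by case: j k e {du dv} => [] [] //= _; rewrite ?t0l ?t0r ?addr0 ?add0r.
- by rewrite linear0.
by rewrite linearP hx hy scaler0 addr0.
Qed.

Definition stens : superspace K :=
  @Superspace K (tensor U V) (fun i => span (pure_deg i))
    (fun i => span0 _) (fun i => @span_lin _ _ _) stens_split stens_inter.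

Lemma deg_tens i j (u : U) (v : V) :
  deg i u -> deg j v -> deg (i (+) j) (tens u v : stens).
Proof. by move=> du dv; apply: span_gen; exists i, j, u, v. Qed.

End TensorProduct.

Section Quotient.
Variables (U : superspace K) (P : U -> Prop).
Hypothesis P_hom : forall x, P x -> exists i, deg i x.

Definition qdeg i (q : quotmod P) : Prop := exists2 x, deg i x & q = qclass P x.

Lemma span_split x : span P x -> exists x0 x1,
  [/\ deg false x0 /\ span P x0, deg true x1 /\ span P x1 & x = x0 + x1].
Proof.
elim=> {x} [x Px||k x y _ [x0 [x1 [[a a'] [b b'] ->]]] _ [y0 [y1 [[c c'] [d d'] ->]]]].
- case: (P_hom Px) => -[] dx.
    by exists 0, x; rewrite add0r; do !split=> //; [exact: deg0|exact: span0|exact: span_gen].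
  by exists x, 0; rewrite addr0; do !split=> //; [exact: span_gen|exact: deg0|exact: span0].
- by exists 0, 0; rewrite addr0; do !split=> //; [exact: deg0|exact: span0|exact: deg0|exact: span0].
exists (k *: x0 + y0), (k *: x1 + y1).
by do !split; [exact: deg_lin|exact: span_lin|exact: deg_lin|exact: span_lin|rewrite scalerDr addrACA].
Qed.

Program Definition squot : superspace K :=
  @Superspace K (quotmod P) qdeg _ _ _ _.
Next Obligation. by exists 0; [exact: deg0|rewrite linear0]. Qed.
Next Obligation.
case: H => [x' dx ->]; case: H0 => [y' dy ->].
by exists (k *: x' + y'); [exact: deg_lin|rewrite linearP].
Qed.
Next Obligation.
have [x' ->] := qclass_surj x; exists (qclass P (prj false x')), (qclass P (prj true x')).
split; [by exists (prj false x') => //; exact: deg_prj| |].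
  by exists (prj true x') => //; exact: deg_prj.
by rewrite -linearD -prjD.
Qed.
Next Obligation.
case: H => [x0 d0 e]; case: H0 => [x1 d1]; rewrite e => /qclassP s.
have [y0 [y1 [[c0 s0] [c1 s1] e']]] := span_split s.
have [|-> _] := @deg_uniq K U x0 (- x1) y0 y1 d0 (degN d1) c0 c1; first by [].
by rewrite -(linear0 (qclass P)); apply/qclassP; rewrite subr0.
Qed.

End Quotient.

End SuperspaceConstructions.

Section SL2.
Variable K : fieldType.

Definition traceless : {pred 'M[K]_2} := fun x => \tr x == 0.

Lemma traceless_submod : submod_closed traceless.
Proof.
split=> [|k x y]; rewrite !unfold_in; first by rewrite linear0.
by move=> /eqP hx /eqP hy; rewrite linearP /= hx hy mulr0 addr0.
Qed.

HB.instance Definition _ :=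
  GRing.isSubmodClosed.Build K 'M[K]_2 traceless traceless_submod.

Record sl2 := Sl2 { sl2_mx :> 'M[K]_2; sl2_traceless : sl2_mx \in traceless }.

HB.instance Definition _ := [isSub for sl2_mx].
HB.instance Definition _ := [Choice of sl2 by <:].
HB.instance Definition _ := [SubChoice_isSubLmodule of sl2 by <:].

Fact sl2_br_subproof (x y : sl2) : (x : 'M_2) *m y - (y : 'M_2) *m x \in traceless.
Proof. by rewrite unfold_in linearB /= mxtrace_mulC subrr. Qed.

Definition sl2_br (x y : sl2) : sl2 := Sl2 (sl2_br_subproof x y).

Fact sl2_e_subproof : delta_mx 0 1 \in traceless.
Proof. by rewrite unfold_in /mxtrace !big_ord_recl big_ord0 !mxE /= !addr0. Qed.
Fact sl2_f_subproof : delta_mx 1 0 \in traceless.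
Proof. by rewrite unfold_in /mxtrace !big_ord_recl big_ord0 !mxE /= !addr0. Qed.
Fact sl2_h_subproof : delta_mx 0 0 - delta_mx 1 1 \in traceless.
Proof. by rewrite unfold_in /mxtrace !big_ord_recl big_ord0 !mxE /= subr0 addr0 sub0r subrr. Qed.

Definition sl2_e : sl2 := Sl2 sl2_e_subproof.
Definition sl2_f : sl2 := Sl2 sl2_f_subproof.
Definition sl2_h : sl2 := Sl2 sl2_h_subproof.

Definition kappa (x y : sl2) : K := 4%:R * \tr ((x : 'M_2) *m y).

Definition Vdet (v w : 'cV[K]_2) : K := \det (row_mx v w : 'M_2).

Definition odot (v w : 'cV[K]_2) : sl2 :=
  (v 0 0 * w 0 0) *: sl2_e - (2%:R^-1 * (v 0 0 * w 1 0 + v 1 0 * w 0 0)) *: sl2_h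
  - (v 1 0 * w 1 0) *: sl2_f.

Definition short_space (J M D : superspace K) : superspace K :=
  dsum (dsum (stens (even_space sl2) J) (stens (even_space 'cV[K]_2) M)) D.

Section Injections.
Variables J M D : superspace K.

Definition inJ (x : sl2) (a : J) : short_space J M D :=
  ((@tens K sl2 J x a, 0), 0).
Definition inM (v : 'cV[K]_2) (m : M) : short_space J M D :=
  ((0, @tens K 'cV[K]_2 M v m), 0).
Definition inD (d : D) : short_space J M D := (0, d).

End Injections.

Record lie_ops (g : superspace K) := LieOps {
  lbr : g -> g -> g;
  lact : sl2 -> g -> g
}.

Record is_lie_superalgebra (g : superspace K) (br : g -> g -> g) : Prop := {
  lie_bilin : bilin br;
  lie_even : even_map2 br;
  lie_anti : forall i j x y, deg i x -> deg j y ->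
    br x y = - ((-1) ^+ (i * j) *: br y x);
  lie_jacobi : forall i j x y z, deg i x -> deg j y ->
    br x (br y z) = br (br x y) z + (-1) ^+ (i * j) *: br y (br x z)
}.

Record is_sl2_derivation_action (g : superspace K) (L : lie_ops g) : Prop := {
  act_bilin : @bilin K sl2 g g (lact L);
  act_rep : forall x y u,
    lact L (sl2_br x y) u = lact L x (lact L y u) - lact L y (lact L x u);
  act_even : forall x, even_map (lact L x);
  act_der : forall x u v,
    lact L x (lbr L u v) = lbr L (lact L x u) v + lbr L u (lact L x v)
}.

Definition is_short_module (g : superspace K) (act : sl2 -> g -> g) : Prop :=
  exists (J M D : superspace K) (phi : short_space J M D -> g),
    [/\ linear phi, bijective phi & even_map phi] /\
    [/\ forall x y a, act x (phi (inJ M D y a)) = phi (inJ M D (sl2_br x y) a),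
        forall x v m, act x (phi (inM J D v m)) = phi (inM J D (x *m v) m)
      & forall x d, act x (phi (inD J M d)) = 0].

Record is_short (g : superspace K) (L : lie_ops g) : Prop := {
  short_lie : is_lie_superalgebra (lbr L);
  short_act : is_sl2_derivation_action L;
  short_module : is_short_module (lact L)
}.

Record short_lie_superalgebra := ShortLie {
  sh_space :> superspace K;
  sh_ops : lie_ops sh_space;
  sh_ax : is_short sh_ops
}.

Record is_short_hom (g g' : short_lie_superalgebra) (phi : g -> g') : Prop := {
  shom_linear : linear phi;
  shom_even : even_map phi;
  shom_br : forall x y, phi (lbr (sh_ops g) x y) = lbr (sh_ops g') (phi x) (phi y);
  shom_act : forall x u, phi (lact (sh_ops g) x u) = lact (sh_ops g') x (phi u)
}.

End SL2.

Section Ternary.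
Variable K : fieldType.

Record ternary_ops (J M : superspace K) := TernaryOps {
  jmul : J -> J -> J;
  jact : J -> M -> M;
  star : M -> M -> J;
  tri : M -> M -> M -> M
}.

Section Identities.
Variables (J M : superspace K) (T : ternary_ops J M).

Local Notation "a ** b" := (jmul T a b) (at level 40, left associativity).
Local Notation "a @@ m" := (jact T a m) (at level 38, right associativity).
Local Notation "m \star n" := (star T m n) (at level 40, left associativity).
Local Notation "<| m , n , r |>" := (tri T m n r).

Record is_jordan : Prop := {
  jmul_bilin : bilin (jmul T);
  jmul_even : even_map2 (jmul T);
  jmul_comm : forall i j a b, deg i a -> deg j b ->
    a ** b = (-1) ^+ (i * j) *: (b ** a);
  jmul_jordan : forall (i j k l : bool) a b c d,
    deg i a -> deg j b -> deg k c -> deg l d ->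
    (a ** b) ** (c ** d) + (-1) ^+ (j * k) *: ((a ** c) ** (b ** d))
      + (-1) ^+ (j * l + k * l) *: ((a ** d) ** (b ** c))
    = ((a ** b) ** c) ** d
      + (-1) ^+ (j * k + j * l + k * l) *: (((a ** d) ** c) ** b)
      + (-1) ^+ (i * j + i * k + i * l + k * l) *: (((b ** d) ** c) ** a)
}.

Record is_special_module : Prop := {
  jact_bilin : bilin (jact T);
  jact_even : even_map2 (jact T);
  jact_special : forall (i j : bool) a b m, deg i a -> deg j b ->
    (a ** b) @@ m = 2%:R^-1 *: (a @@ b @@ m + (-1) ^+ (i * j) *: (b @@ a @@ m))
}.

Record is_ternary : Prop := {
  ternary_jordan : is_jordan;
  ternary_special : is_special_module;
  star_bilin : bilin (star T);
  star_even : even_map2 (star T);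
  star_anti : forall (i j : bool) m n, deg i m -> deg j n ->
    m \star n = - ((-1) ^+ (i * j) *: (n \star m));
  tri_linear1 : forall n r, linear (fun m => <| m, n, r |>);
  tri_linear2 : forall m r, linear (fun n => <| m, n, r |>);
  tri_linear3 : forall m n, linear (fun r => <| m, n, r |>);
  tri_even : forall i j k m n r, deg i m -> deg j n -> deg k r ->
    deg (i (+) j (+) k) <| m, n, r |>;
  SJT1 : forall (p i j : bool) a m n, deg p a -> deg i m -> deg j n ->
    a ** (m \star n)
    = 2%:R^-1 *: ((a @@ m) \star n + (-1) ^+ (p * i) *: (m \star (a @@ n)));
  SJT2 : forall (p i j k : bool) a m n s,
    deg p a -> deg i m -> deg j n -> deg k s ->
    a @@ <| m, n, s |>
    = <| a @@ m, n, s |> - (-1) ^+ (p * i) *: <| m, a @@ n, s |>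
      + (-1) ^+ (p * (i + j)) *: <| m, n, a @@ s |>;
  SJT3 : forall (i j k : bool) m n s, deg i m -> deg j n -> deg k s ->
    <| m, n, s |> = (-1) ^+ (i * (j + k) + j * k) *: <| s, n, m |>
      - (-1) ^+ (j * k) *: ((m \star s) @@ n);
  SJT4 : forall (i j k : bool) m n s, deg i m -> deg j n -> deg k s ->
    <| m, n, s |> = (-1) ^+ (i * j) *: <| n, m, s |> + (m \star n) @@ s;
  SJT5 : forall (i j k l : bool) m n r s,
    deg i m -> deg j n -> deg k r -> deg l s ->
    <| m, n, r |> \star s + (-1) ^+ (k * (i + j)) *: (r \star <| m, n, s |>)
    = (-1) ^+ (j * (k + l)) *: (m \star ((r \star s) @@ n));
  SJT6 : forall (i j k l q : bool) m n r s t,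
    deg i m -> deg j n -> deg k r -> deg l s -> deg q t ->
    <| m, n, <| r, s, t |> |>
    = <| <| m, n, r |>, s, t |>
      + (-1) ^+ (k * (i + j) + i * j) *: <| r, <| n, m, s |>, t |>
      + (-1) ^+ ((i + j) * (k + l)) *: <| r, s, <| m, n, t |> |>
}.

(* <a,b> and partial_{m,n} on J and on M; p, q, i, j are the parities of
   a, b, m, n respectively, and k in [parJ] is the parity of the argument. *)
Definition angJ (p q : bool) (a b c : J) : J :=
  a ** (b ** c) - (-1) ^+ (p * q) *: (b ** (a ** c)).

Definition angM (p q : bool) (a b : J) (m : M) : M :=
  4%:R^-1 *: (a @@ b @@ m - (-1) ^+ (p * q) *: (b @@ a @@ m)).

Definition parJ (i j k : bool) (m n : M) (a : J) : J :=
  2%:R^-1 *: ((-1) ^+ (k * (i + j)) *: ((a @@ m) \star n)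
              - (-1) ^+ (k * j) *: (m \star (a @@ n))).

Definition parM (m n r : M) : M := 2%:R^-1 *: ((m \star n) @@ r) - <| m, n, r |>.

Definition Bs_pre : superspace K := dsum (stens J J) (stens M M).

Definition tJ (a b : J) : Bs_pre := (tens a b, 0).
Definition tM (m n : M) : Bs_pre := (0, tens m n).

Inductive Rs : Bs_pre -> Prop :=
| Rs_JJ (i j : bool) a b : deg i a -> deg j b ->
    Rs (tJ a b + (-1) ^+ (i * j) *: tJ b a)
| Rs_MM (i j : bool) m n : deg i m -> deg j n ->
    Rs (tM m n - (-1) ^+ (i * j) *: tM n m)
| Rs_JJJ (i j k : bool) a b c : deg i a -> deg j b -> deg k c ->
    Rs ((-1) ^+ (i * k) *: tJ (a ** b) c + (-1) ^+ (i * j) *: tJ (b ** c) a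
        + (-1) ^+ (j * k) *: tJ (c ** a) b)
| Rs_JMM (p i j : bool) a m n : deg p a -> deg i m -> deg j n ->
    Rs (tM (a @@ m) n - (-1) ^+ (p * i) *: tM m (a @@ n)
        - (-1) ^+ (p * (i + j)) *: (2%:R *: tJ (m \star n) a))
| Rs_MMMM (i j k l : bool) m n r s :
    deg i m -> deg j n -> deg k r -> deg l s ->
    Rs (tM (parM m n r) s + (-1) ^+ ((i + j) * k) *: tM r (parM m n s)
        + (-1) ^+ ((i + j) * (k + l)) *: tM (parM r s m) n
        + (-1) ^+ ((k + l) * j) *: tM m (parM r s n)).

Lemma deg_tJ i j a b : deg i a -> deg j b -> deg (i (+) j) (tJ a b).
Proof. by move=> da db; split; [exact: deg_tens|exact: deg0]. Qed.

Lemma deg_tM i j m n : deg i m -> deg j n -> deg (i (+) j) (tM m n).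
Proof. by move=> dm dn; split; [exact: deg0|exact: deg_tens]. Qed.

Hypothesis T_ternary : is_ternary.

Lemma deg_parM i j k m n r : deg i m -> deg j n -> deg k r ->
  deg (i (+) j (+) k) (parM m n r).
Proof.
move=> dm dn dr; apply: degB; last exact: (tri_even T_ternary).
apply: degZ; apply: (jact_even (ternary_special T_ternary)) => //.
exact: (star_even T_ternary).
Qed.

Lemma Rs_homogeneous x : Rs x -> exists i, deg i x.
Proof.
have jE := jmul_even (ternary_jordan T_ternary).
have aE := jact_even (ternary_special T_ternary).
have sE := star_even T_ternary.
case=> {x}.
- move=> i j a b da db; exists (i (+) j); apply: degD; first exact: deg_tJ.
  by apply: degZ; rewrite addbC; exact: deg_tJ.
- move=> i j m n dm dn; exists (i (+) j); apply: degB; first exact: deg_tM.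
  by apply: degZ; rewrite addbC; exact: deg_tM.
- move=> i j k a b c da db dc; exists (i (+) j (+) k).
  apply: degD; first apply: degD; apply: degZ.
  + by apply: deg_tJ => //; apply: jE.
  + by rewrite -addbA addbC; apply: deg_tJ => //; apply: jE.
  by rewrite addbC addbA; apply: deg_tJ => //; apply: jE.
- move=> p i j a m n da dm dn; exists (p (+) i (+) j).
  apply: degB; first apply: degB.
  + by apply: deg_tM => //; apply: aE.
  + by apply: degZ; rewrite addbAC addbC; apply: deg_tM => //; apply: aE.
  by do 2!apply: degZ; rewrite -addbA addbC; apply: deg_tJ => //; apply: sE.
move=> i j k l m n r s dm dn dr ds; exists (i (+) j (+) k (+) l).
apply: degD; first apply: degD; first apply: degD; try apply: degZ.
- by apply: deg_tM => //; apply: deg_parM.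
- by rewrite [_ (+) k]addbC -addbA; apply: deg_tM => //; apply: deg_parM.
- have -> : i (+) j (+) k (+) l = k (+) l (+) i (+) j by case: i j k l {dm dn dr ds} => [] [] [] [].
  by apply: deg_tM => //; apply: deg_parM.
have -> : i (+) j (+) k (+) l = i (+) (k (+) l (+) j) by case: i j k l {dm dn dr ds} => [] [] [] [].
by apply: deg_tM => //; apply: deg_parM.
Qed.

Definition Bs : superspace K := squot Rs_homogeneous.

End Identities.

Record ternary_superalgebra := Ternary {
  tJs : superspace K;
  tMs : superspace K;
  tops :> ternary_ops tJs tMs;
  tax : is_ternary tops
}.

Record is_ternary_hom (X Y : ternary_superalgebra)
    (eta : (tJs X -> tJs Y) * (tMs X -> tMs Y)) : Prop := {
  thom_linear1 : linear eta.1;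
  thom_linear2 : linear eta.2;
  thom_even1 : even_map eta.1;
  thom_even2 : even_map eta.2;
  thom_jmul : forall a b, eta.1 (jmul X a b) = jmul Y (eta.1 a) (eta.1 b);
  thom_jact : forall a m, eta.2 (jact X a m) = jact Y (eta.1 a) (eta.2 m);
  thom_star : forall m n, eta.1 (star X m n) = star Y (eta.2 m) (eta.2 n);
  thom_tri : forall m n r,
    eta.2 (tri X m n r) = tri Y (eta.2 m) (eta.2 n) (eta.2 r)
}.

End Ternary.

Record category := Category {
  ob :> Type;
  hom : ob -> ob -> Type;
  idc : forall X, hom X X;
  compc : forall X Y Z, hom Y Z -> hom X Y -> hom X Z;
  compc_id : forall X Y (u : hom X Y), compc u (idc X) = u;
  id_compc : forall X Y (u : hom X Y), compc (idc Y) u = u;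
  compcA : forall X Y Z W (w : hom Z W) (v : hom Y Z) (u : hom X Y),
    compc w (compc v u) = compc (compc w v) u
}.

Arguments hom {c}.
Arguments idc {c}.
Arguments compc {c X Y Z}.

Record functor (C D : category) (F : C -> D) := Functor {
  fmap : forall X Y, hom X Y -> hom (F X) (F Y);
  fmap_id : forall X, fmap (idc X) = idc (F X);
  fmap_compc : forall X Y Z (v : hom Y Z) (u : hom X Y),
    fmap (compc v u) = compc (fmap v) (fmap u)
}.

Arguments fmap {C D F} f {X Y}.

Definition left_adjoint (C D : category) (F : C -> D) (G : D -> C)
    (FF : functor F) (GG : functor G) : Prop :=
  exists Phi : forall X Y, hom (F X) Y -> hom X (G Y),
    (forall X Y, bijective (Phi X Y)) /\
    (forall X X' Y Y' (u : hom X' X) (k : hom (F X) Y) (w : hom Y Y'),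
      Phi X' Y' (compc w (compc k (fmap FF u)))
      = compc (fmap GG w) (compc (Phi X Y k) u)).

Lemma sig_eq (T : Type) (P : T -> Prop) (x y : {t | P t}) : sval x = sval y -> x = y.
Proof.
case: x y => [x px] [y py] /= e; subst y.
by rewrite (Prop_irrelevance px py).
Qed.

Section Categories.
Variable K : fieldType.

Definition short_hom (g g' : short_lie_superalgebra K) := {phi : g -> g' | is_short_hom phi}.

Program Definition short_cat : category :=
  @Category (short_lie_superalgebra K) short_hom
    (fun g => exist _ (fun x => x) _)
    (fun g1 g2 g3 psi phi => exist _ (fun x => sval psi (sval phi x)) _) _ _ _.
Next Obligation. by split. Qed.
Next Obligation.
case: psi phi => [psi [a b c d]] [phi [a' b' c' d']]; split=> /=.
- by move=> k x y; rewrite a' a.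
- by move=> i x dx; apply/b/b'.
- by move=> x y; rewrite c' c.
- by move=> x u; rewrite d' d.
Qed.
Next Obligation. exact: sig_eq. Qed.
Next Obligation. exact: sig_eq. Qed.
Next Obligation. exact: sig_eq. Qed.

Definition ternary_hom (X Y : ternary_superalgebra K) :=
  {eta : (tJs X -> tJs Y) * (tMs X -> tMs Y) | is_ternary_hom eta}.

Program Definition ternary_cat : category :=
  @Category (ternary_superalgebra K) ternary_hom
    (fun X => exist _ (fun a => a, fun m => m) _)
    (fun X Y Z zeta eta => exist _
       (fun a => (sval zeta).1 ((sval eta).1 a), fun m => (sval zeta).2 ((sval eta).2 m)) _)
    _ _ _.
Next Obligation. by split. Qed.
Next Obligation.
case: zeta eta => [[z1 z2] [a b c d e f g h]] [[e1 e2] [a' b' c' d' e' f' g' h']].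
rewrite /= in a b c d e f g h a' b' c' d' e' f' g' h' *; split=> /=.
- by move=> k x y; rewrite a' a.
- by move=> k x y; rewrite b' b.
- by move=> i x dx; apply/c/c'.
- by move=> i x dx; apply/d/d'.
- by move=> x y; rewrite e' e.
- by move=> x y; rewrite f' f.
- by move=> x y; rewrite g' g.
- by move=> x y z; rewrite h' h.
Qed.
Next Obligation. by apply: sig_eq; case: u => -[]. Qed.
Next Obligation. by apply: sig_eq; case: u => -[]. Qed.
Next Obligation. exact: sig_eq. Qed.

End Categories.

Section Weight.
Variables (K : fieldType) (V : lmodType K) (f : V -> V) (k : K).
Hypothesis f_linear : linear f.

Definition eigen_pred of linear f : {pred V} := fun x => f x == k *: x.

Lemma eigen_submod : submod_closed (eigen_pred f_linear).
Proof.
split=> [|c x y]; rewrite !unfold_in.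
  by have := f_linear (-1) 0 0; rewrite !scaleN1r !addNr => ->; rewrite scaler0.
by move=> /eqP hx /eqP hy; rewrite f_linear hx hy scalerDr !scalerA mulrC.
Qed.

HB.instance Definition _ :=
  GRing.isSubmodClosed.Build K V (eigen_pred f_linear) eigen_submod.

Record eigen := Eigen { eigen_val :> V; eigenP : eigen_val \in eigen_pred f_linear }.

HB.instance Definition _ := [isSub for eigen_val].
HB.instance Definition _ := [Choice of eigen by <:].
HB.instance Definition _ := [SubChoice_isSubLmodule of eigen by <:].

End Weight.

Section That.
Variable K : fieldType.

Section WeightSpace.
Variables (g : short_lie_superalgebra K) (k : K).

Local Notation hact := (lact (sh_ops g) (sl2_h K)).

Lemma hact_linear : linear hact.
Proof. exact: (act_bilin (short_act (sh_ax g))).2. Qed.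

Lemma hact_even : even_map hact.
Proof. exact: (act_even (short_act (sh_ax g))). Qed.

Lemma hact_prj i (x : g) : hact x = k *: x -> hact (prj i x) = k *: prj i x.
Proof.
have hD (y z : g) : hact (y + z) = hact y + hact z.
  by have := hact_linear 1 y z; rewrite !scale1r.
move=> hx; have e : hact (prj false x) + hact (prj true x)
    = k *: prj false x + k *: prj true x by rewrite -hD -scalerDr -prjD.
have [||||e0 e1] := deg_uniq _ _ _ _ e.
- exact/hact_even/deg_prj.
- exact/hact_even/deg_prj.
- exact/degZ/deg_prj.
- exact/degZ/deg_prj.
by case: i.
Qed.

Program Definition weight : superspace K :=
  @Superspace K (eigen k hact_linear) (fun i x => deg i (x : g)) _ _ _ _.
Next Obligation. exact: deg0. Qed.
Next Obligation. exact: deg_lin. Qed.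
Next Obligation.
have hx : hact x = k *: (x : g) by apply/eqP; exact: (eigenP x).
have hp i : prj i (x : g) \in eigen_pred k hact_linear by apply/eqP/hact_prj.
exists (Eigen (hp false)), (Eigen (hp true)).
by split; [exact: deg_prj|exact: deg_prj|apply: val_inj; exact: prjD].
Qed.
Next Obligation. by apply: val_inj; exact: deg_inter. Qed.

End WeightSpace.

Section ThatObject.
Variable g : short_lie_superalgebra K.

Local Notation "[[ x , y ]]" := (lbr (sh_ops g) x y).
Local Notation "'f' x" := (lact (sh_ops g) (sl2_f K) x) (at level 9, x at level 8).

Record That_object := ThatObject {
  That_ops : ternary_ops (weight g 2%:R) (weight g 1);
  That_ternary : is_ternary That_ops;
  (* [a, f b] = - [f a, b] because [a, b] has weight 4, so it vanishes; likewise
     for the next formula *)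
  That_jmul : forall a b, 2%:R *: (jmul That_ops a b : g) = [[a : g, f (b : g)]];
  That_jact : forall a m, (jact That_ops a m : g) = [[a : g, f (m : g)]];
  That_star : forall m n, (star That_ops m n : g) = [[m : g, n : g]];
  That_tri : forall m n r,
    (tri That_ops m n r : g) = - [[ [[m : g, f (n : g)]], r : g ]]
}.

End ThatObject.

Definition That_ob g (L : That_object g) : ternary_superalgebra K :=
  Ternary (That_ternary L).

Record That_functor := ThatFunctor {
  That_on : forall g, That_object g;
  That_map : @functor (short_cat K) (ternary_cat K) (fun g => That_ob (That_on g));
  That_mapE : forall (g g' : short_lie_superalgebra K) (phi : short_hom g g'),
    let eta := sval (fmap That_map phi : ternary_hom _ _) in
    (forall a : weight g 2%:R, (eta.1 a : g') = sval phi a) /\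
    (forall m : weight g 1, (eta.2 m : g') = sval phi m)
}.

End That.

Section TAG.
Variable K : fieldType.

Section TAGObject.
Variable X : ternary_superalgebra K.

Local Notation J := (tJs X).
Local Notation M := (tMs X).

Definition TAG_Bs : superspace K := Bs (tax X).

Definition TAG_space : superspace K := short_space J M TAG_Bs.

Definition TAG_J (x : sl2 K) (a : J) : TAG_space := inJ M TAG_Bs x a.
Definition TAG_M (v : 'cV[K]_2) (m : M) : TAG_space := inM J TAG_Bs v m.

Definition TAG_B (t : Bs_pre J M) : TAG_space := inD J M (qclass (Rs X) t : TAG_Bs).

Local Notation "x *J* a" := (TAG_J x a) (at level 40).
Local Notation "v *M* m" := (TAG_M v m) (at level 40).
Local Notation "{JJ a , b }" := (TAG_B (@tJ K J M a b)) (a at level 30, b at level 30).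
Local Notation "{MM m , n }" := (TAG_B (@tM K J M m n)) (m at level 30, n at level 30).

(* Generators span TAG_space and the operations are bilinear, so the formulas
   below (with super-anticommutativity) leave no freedom in [TAG_ops]. *)
Record TAG_object := TAGObject {
  TAG_ops : lie_ops TAG_space;
  TAG_short : is_short TAG_ops;
  TAG_actJ : forall x y a, lact TAG_ops x (y *J* a) = sl2_br x y *J* a;
  TAG_actM : forall x v m, lact TAG_ops x (v *M* m) = (x *m v) *M* m;
  TAG_actB : forall x t, lact TAG_ops x (TAG_B t) = 0;
  TAG_brJJ : forall x y a b,
    lbr TAG_ops (x *J* a) (y *J* b)
    = sl2_br x y *J* jmul X a b + (2%:R^-1 * kappa x y) *: {JJ a, b};
  TAG_brJM : forall x v a m,
    lbr TAG_ops (x *J* a) (v *M* m) = (x *m v) *M* jact X a m;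
  TAG_brMM : forall v w m n,
    lbr TAG_ops (v *M* m) (w *M* n)
    = odot v w *J* star X m n + Vdet v w *: {MM m, n};
  TAG_ang_J : forall (p q : bool) a b x c, deg p a -> deg q b ->
    lbr TAG_ops {JJ a, b} (x *J* c) = x *J* angJ X p q a b c;
  TAG_ang_M : forall (p q : bool) a b v r, deg p a -> deg q b ->
    lbr TAG_ops {JJ a, b} (v *M* r) = v *M* angM X p q a b r;
  TAG_par_J : forall (i j k : bool) m n x c, deg i m -> deg j n -> deg k c ->
    lbr TAG_ops {MM m, n} (x *J* c) = x *J* parJ X i j k m n c;
  TAG_par_M : forall m n v r,
    lbr TAG_ops {MM m, n} (v *M* r) = v *M* parM X m n r;
  TAG_ang_JJ : forall (p q i : bool) a b c d, deg p a -> deg q b -> deg i c ->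
    lbr TAG_ops {JJ a, b} {JJ c, d}
    = {JJ angJ X p q a b c, d}
      + (-1) ^+ ((p + q) * i) *: {JJ c, angJ X p q a b d};
  TAG_ang_MM : forall (p q i : bool) a b r s, deg p a -> deg q b -> deg i r ->
    lbr TAG_ops {JJ a, b} {MM r, s}
    = {MM angM X p q a b r, s}
      + (-1) ^+ ((p + q) * i) *: {MM r, angM X p q a b s};
  TAG_par_JJ : forall (i j p q : bool) m n c d,
    deg i m -> deg j n -> deg p c -> deg q d ->
    lbr TAG_ops {MM m, n} {JJ c, d}
    = {JJ parJ X i j p m n c, d}
      + (-1) ^+ ((i + j) * p) *: {JJ c, parJ X i j q m n d};
  TAG_par_MM : forall (i j k : bool) m n r s, deg i m -> deg j n -> deg k r ->
    lbr TAG_ops {MM m, n} {MM r, s}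
    = {MM parM X m n r, s}
      + (-1) ^+ ((i + j) * k) *: {MM r, parM X m n s}
}.

Definition TAG_ob (L : TAG_object) : short_lie_superalgebra K :=
  ShortLie (TAG_short L).

End TAGObject.

Record TAG_functor := TAGFunctor {
  TAG_on : forall X, TAG_object X;
  TAG_map : @functor (ternary_cat K) (short_cat K) (fun X => TAG_ob (TAG_on X));
  TAG_mapE : forall (X Y : ternary_superalgebra K) (eta : ternary_hom X Y),
    let eta1 := (sval eta).1 in
    let eta2 := (sval eta).2 in
    let phi : TAG_space X -> TAG_space Y :=
      sval (fmap TAG_map eta : short_hom (TAG_ob _) (TAG_ob _)) in
    [/\ forall x a, phi (TAG_J x a) = TAG_J x (eta1 a),
        forall v m, phi (TAG_M v m) = TAG_M v (eta2 m),
        forall a b, phi (TAG_B (tJ _ a b)) = TAG_B (tJ _ (eta1 a) (eta1 b))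
      & forall m n, phi (TAG_B (tM _ m n)) = TAG_B (tM _ (eta2 m) (eta2 n))]
}.

End TAG.

(* Main.v *)
Require Import Defs.
From mathcomp Require Import all_boot all_order all_algebra.
From mathcomp Require Import complex reals boolp ring.
Set Implicit Arguments. Unset Strict Implicit. Unset Printing Implicit Defensive.
Import GRing.Theory.
Local Open Scope ring_scope.

(** A short algebra g decomposes under h into the weights 0, 1, -1, 2, -2. Its
    ternary superalgebra consists of the vectors of weight 2 and 1, i.e. of the
    highest weight vectors of the adjoint and the natural components of g. Since
    g has no weight beyond 2, the brackets of weight 3 and 4 vanish; applying f to
    these equations and using the Jacobi identity yields the axioms of a ternary
    superalgebra ([that_object]).

    In the other direction, the operators <a,b> and par_{m,n} are superderivations
    of a ternary superalgebra ([ang_der], [par_der]). Whatever is built from the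
    structure maps is equivariant under superderivations; therefore they act on
    the space B^s of classes of pairs, and B^s becomes a Lie superalgebra that
    acts on J and M ([Bs_inner_algebra]). The relations defining B^s are those that
    make its bracket antisymmetric and the bracket of TAG satisfy the Jacobi
    identity, which is verified on the three kinds of generators ([Jac_hom]).

    For the adjunction, TAG is generated by the vectors e (x) a and e1 (x) m: the
    other basis vectors of sl2 and V are reached with f, and up to a factor the
    classes are the invariants [f (e (x) a), f (e (x) b)] and
    [e1 (x) m, f (e1 (x) n)] - [f (e1 (x) m), e1 (x) n] ([TAG_J_gen] to
    [TAG_BM_gen]). So a morphism from TAG to g is determined by its values on the
    generating vectors ([hom_ext]), and these values form a ternary morphism to
    the highest weight vectors of g. Conversely, given a ternary morphism, the
    same invariants can be formed in g; there they satisfy all relations of B^s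
    ([q_cyc], [dM_act], [dM_par]) and act on the images of J and M through <a,b>
    and par_{m,n}. So they define a map on B^s ([inner_rep_exists]), which extends
    to a morphism on TAG ([lift_br], [lift_act]). Evaluation on the generators is
    thus a bijection, and it is natural because morphisms are composed pointwise. *)

(** * Deciding linear identities in vector spaces *)

Section LinearExpressions.
Variable K : fieldType.
Hypothesis two_neq0 : 2%:R != 0 :> K.

Inductive sexp := SAtom of K | SMul of sexp & sexp | SOpp of sexp | SHalf | SQuarter.
Inductive rexp :=
| RVar of nat | RZero | RAdd of rexp & rexp | ROpp of rexp | RScale of sexp & rexp.
(** Normal form of [rexp]: halves are isolated so that they can be cancelled
    against a power of two instead of being inverted. *)
Inductive lexp :=
| LVar of nat | LZero | LAdd of lexp & lexp | LOpp of lexp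
| LScale of K & lexp | LHalf of lexp.

Fixpoint seval k : K := match k with
| SAtom x => x | SMul a b => seval a * seval b | SOpp a => - seval a
| SHalf => 2%:R^-1 | SQuarter => 4%:R^-1 end.
Fixpoint lpush k e := match k with
| SAtom x => LScale x e | SMul a b => lpush a (lpush b e) | SOpp a => LOpp (lpush a e)
| SHalf => LHalf e | SQuarter => LHalf (LHalf e) end.
Fixpoint lnorm e := match e with
| RVar i => LVar i | RZero => LZero | RAdd a b => LAdd (lnorm a) (lnorm b)
| ROpp a => LOpp (lnorm a) | RScale k a => lpush k (lnorm a) end.

(** The coefficient of atom [i] in [2 ^+ d *: e]. The answer [None] stands for
    zero; keeping it symbolic spares [ring] the atoms that do not occur. *)
Fixpoint lcoef d i e : option K := match e with
| LVar j => if eqn i j then Some (2%:R ^+ d) else None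
| LZero => None
| LAdd a b => match lcoef d i a, lcoef d i b with
    | None, y => y | x, None => x | Some x, Some y => Some (x + y) end
| LOpp a => match lcoef d i a with Some x => Some (- x) | None => None end
| LScale k a => match lcoef d i a with Some x => Some (k * x) | None => None end
| LHalf a => match d with
    | d'.+1 => lcoef d' i a
    | 0%N => match lcoef 0 i a with Some x => Some (2%:R^-1 * x) | None => None end
    end end.
Definition oval (o : option K) : K := if o is Some x then x else 0.

Fixpoint same_coefs n d e e' : Prop :=
  if n is n'.+1 then oval (lcoef d n' e) = oval (lcoef d n' e') /\ same_coefs n' d e e'
  else True.

Section Eval.
Variables (V : lmodType K) (env : seq V).
Fixpoint leval e : V := match e with
| LVar i => env`_i | LZero => 0
| LAdd a b => leval a + leval b | LOpp a => - leval a
| LScale k a => k *: leval a | LHalf a => 2%:R^-1 *: leval a end.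
Fixpoint reval e : V := match e with
| RVar i => env`_i | RZero => 0
| RAdd a b => reval a + reval b | ROpp a => - reval a
| RScale k a => seval k *: reval a end.

Lemma lpushE k e : leval (lpush k e) = seval k *: leval e.
Proof.
elim: k e => [x|a IHa b IHb|a IHa||] e //=; first by rewrite IHa IHb scalerA.
  by rewrite IHa scaleNr.
by rewrite scalerA -invfM -natrM.
Qed.

Lemma lnormE e : leval (lnorm e) = reval e.
Proof. by elim: e => [||a IHa b IHb|a IHa|k a IHa] //=; rewrite ?lpushE ?IHa ?IHb. Qed.

Lemma leval_coef d e :
  2%:R ^+ d *: leval e = \sum_(i < size env) oval (lcoef d i e) *: env`_i.
Proof.
elim: e d => [i||a IHa b IHb|a IHa|k a IHa|a IHa] d /=.
- have E j : oval (if eqn j i then Some (2%:R ^+ d) else None) = (j == i)%:R * 2%:R ^+ d :> K.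
    by rewrite eqE /=; case: eqn; rewrite ?mul1r ?mul0r.
  case: (ltnP i (size env)) => hi; last first.
    rewrite nth_default // scaler0 big1 // => j _.
    by rewrite E (ltn_eqF (leq_trans (ltn_ord j) hi)) mul0r scale0r.
  rewrite (bigD1 (Ordinal hi)) //= E eqxx mul1r big1 ?addr0 // => j.
  by rewrite E -val_eqE => /= /negbTE ->; rewrite mul0r scale0r.
- by rewrite scaler0 big1 // => i _; rewrite scale0r.
- rewrite scalerDr IHa IHb -big_split; apply: eq_bigr => i _ /=.
  by rewrite -scalerDl; case: lcoef => [x|]; case: lcoef => [y|] /=; rewrite ?addr0 ?add0r.
- rewrite scalerN IHa -sumrN; apply: eq_bigr => i _.
  by rewrite -scaleNr; case: lcoef => //=; rewrite oppr0.
- rewrite scalerA mulrC -scalerA IHa scaler_sumr; apply: eq_bigr => i _.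
  by rewrite scalerA; case: lcoef => //=; rewrite mulr0.
case: d => [|d].
  rewrite scale1r -[leval _]scale1r -[1](expr0 2%:R) IHa scaler_sumr.
  by apply: eq_bigr => i _; rewrite scalerA; case: lcoef => //=; rewrite mulr0.
by rewrite exprSr scalerA mulfK // IHa.
Qed.

(** Atom by atom this reduces an identity between vectors to ring identities;
    the scalar [2 ^+ d] clears the denominators, so that no inverse is left as
    long as at most [d] halvings are nested. *)
Lemma reval_eq d e e' :
  same_coefs (size env) d (lnorm e) (lnorm e') -> reval e = reval e'.
Proof.
rewrite -!lnormE; move: (lnorm e) (lnorm e') => {}e {}e' h.
have /scalerI : 2%:R ^+ d *: leval e = 2%:R ^+ d *: leval e'; last by apply; rewrite expf_neq0.
rewrite !leval_coef; apply: eq_bigr => i _; congr (_ *: _).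
have : (i < size env)%N by []; move: (nat_of_ord i) => {}i.
elim: (size env) h => //= n IH [e1 h]; rewrite ltnS leq_eqVlt => /orP[/eqP->//|]; exact: IH.
Qed.
End Eval.
End LinearExpressions.

Ltac ladd_atom x l :=
  lazymatch l with
  | nil => constr:([:: x])
  | cons ?y ?l' => 
     lazymatch x with y => constr:(l) | _ => let l'' := ladd_atom x l' in constr:(cons y l'') end
  end.
Ltac lindex x l :=
  lazymatch l with
  | cons ?y ?l' => 
     lazymatch x with y => constr:(0%N) | _ => let i := lindex x l' in constr:(S i) end
  end.
Ltac latoms l t :=
  lazymatch t with
  | (?a + ?b)%R => let l := latoms l a in latoms l b
  | (- ?a)%R => latoms l a
  | (?k *: ?a)%R => latoms l a
  | GRing.zero => l
  | 0%R => l
  | _ => ladd_atom t l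
  end.
Ltac sreify K k :=
  lazymatch k with
  | (?a * ?b)%R => let a' := sreify K a in let b' := sreify K b in constr:(@SMul K a' b')
  | (- ?a)%R => let a' := sreify K a in constr:(@SOpp K a')
  | (2%:R^-1)%R => constr:(@SHalf K)
  | (4%:R^-1)%R => constr:(@SQuarter K)
  | _ => constr:(@SAtom K k)
  end.
Ltac lreify K l t :=
  lazymatch t with
  | (?a + ?b)%R => let a' := lreify K l a in let b' := lreify K l b in constr:(@RAdd K a' b')
  | (- ?a)%R => let a' := lreify K l a in constr:(@ROpp K a')
  | (?k *: ?a)%R => let k' := sreify K k in let a' := lreify K l a in constr:(@RScale K k' a')
  | 0%R => constr:(@RZero K)
  | _ => let i := lindex t l in constr:(@RVar K i)
  end.

(** ** Koszul signs *)

Section Signs.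
Variable K : fieldType.
(** The sign picked up when homogeneous elements of parities [i] and [j] are
    exchanged; multiplicative in both parities, of square one. *)
Definition sg (i j : bool) : K := (-1) ^+ (i * j).
Lemma sg_fold (i j : bool) : (-1) ^+ (i * j) = sg i j. Proof. by []. Qed.
Lemma sgg i j : sg i j * sg i j = 1.
Proof. by rewrite /sg; case: i j => [] []; rewrite /= ?mulr1 ?mulrNN ?mul1r. Qed.
Lemma sgC i j : sg i j = sg j i. Proof. by rewrite /sg mulnC. Qed.
Lemma sgDl i j k : sg (i (+) j) k = sg i k * sg j k.
Proof. by rewrite /sg; case: i j k => [] [] []; rewrite /= ?mulr1 ?mulrNN ?mul1r. Qed.
Lemma sgDr i j k : sg k (i (+) j) = sg k i * sg k j.
Proof. by rewrite sgC sgDl !(sgC k). Qed.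
Lemma sg0l i : sg false i = 1. Proof. by []. Qed.
Lemma sg0r i : sg i false = 1. Proof. by case: i. Qed.
End Signs.

Ltac sgn := rewrite ?(mulnDl, mulnDr) ?exprD ?sg_fold ?(sgDl, sgDr, sg0l, sg0r).

(** [lmod_with tac] proves an identity of linear combinations over [K] by
    comparing the coefficients of each atom with [tac]; [K] and the proof that 2
    is nonzero are found in the context. Three nested halves are cleared. *)
Ltac lmod_with tac :=
  lazymatch goal with K : fieldType, n2 : is_true (2%:R != 0) |- @eq ?T ?x ?y =>
   let l := latoms (@nil T) x in let l := latoms l y in
   let e := lreify K l x in let e' := lreify K l y in
   change (reval l e = reval l e'); apply: (@reval_eq K n2 _ l 3);
   cbv [lnorm lpush same_coefs lcoef oval eqn size]; repeat split; tac K
  end.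

(** The tactics [lmN] first bring the signs [sg] between the listed parities to
    a fixed order and then compute modulo the relations [sg i j ^+ 2 = 1]. *)
Ltac lm0 := lmod_with ltac:(fun K => ring).
Ltac lm2 p q := sgn;
  rewrite ?(sgC _ q p);
  lmod_with ltac:(fun K => ring: (sgg K p q)).
Ltac lm3 p q k := sgn;
  rewrite ?(sgC _ q p) ?(sgC _ k p) ?(sgC _ k q);
  lmod_with ltac:(fun K => ring: (sgg K p q) (sgg K p k) (sgg K q k)).
Ltac lm4 p q k l := sgn;
  rewrite ?(sgC _ q p) ?(sgC _ k p) ?(sgC _ k q) ?(sgC _ l p) ?(sgC _ l q) ?(sgC _ l k);
  lmod_with ltac:(fun K => ring: (sgg K p q) (sgg K p k) (sgg K q k) (sgg K p l) (sgg K q l)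
    (sgg K k l)).
Ltac lm5 p q k l m := sgn;
  rewrite ?(sgC _ q p) ?(sgC _ k p) ?(sgC _ k q) ?(sgC _ l p) ?(sgC _ l q) ?(sgC _ l k)
    ?(sgC _ m p) ?(sgC _ m q) ?(sgC _ m k) ?(sgC _ m l);
  lmod_with ltac:(fun K => ring: (sgg K p q) (sgg K p k) (sgg K q k) (sgg K p l) (sgg K q l)
    (sgg K k l) (sgg K p m) (sgg K q m) (sgg K k m) (sgg K l m)).
(** The variants with [field] are for coefficients in which a half occurs inside
    a sum. *)
Ltac lmf0 := sgn; lmod_with ltac:(fun K => by field).
Ltac lmf3 p q k := sgn; rewrite ?(sgC _ q p) ?(sgC _ k p) ?(sgC _ k q);
  lmod_with ltac:(fun K => by field: (sgg K p q) (sgg K p k) (sgg K q k)).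

(** Adds to an identity a multiple [c] of a known one; repeated use leaves a goal
    that holds formally, where [lmN] concludes. The multipliers [c] below are the
    coefficients of the linear combination of axioms that yields the claim. *)
Lemma lcstep (K : fieldType) (V : lmodType K) (c : K) (l r u v : V) :
  l = r -> u + c *: (l - r) = v -> u = v.
Proof. by move=> ->; rewrite subrr scaler0 addr0. Qed.

(** * Linear, bilinear and parity-dependent maps *)

Section LinearMaps.
Variables (K : fieldType) (U V : lmodType K) (f : U -> V) (lf : linear f).
Lemma linD x y : f (x + y) = f x + f y.
Proof. by have := lf 1 x y; rewrite !scale1r. Qed.
Lemma lin0 : f 0 = 0.
Proof. by have := lf (-1) 0 0; rewrite !scaleN1r !addNr. Qed.
Lemma linZ k x : f (k *: x) = k *: f x.
Proof. by have := lf k x 0; rewrite !addr0 lin0 addr0. Qed.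
Lemma linN x : f (- x) = - f x.
Proof. by rewrite -scaleN1r linZ scaleN1r. Qed.
Definition linE := (linD, linN, linZ, lin0).
End LinearMaps.

Section BilinearMaps.
Variables (K : fieldType) (U V W : lmodType K) (f : U -> V -> W) (bf : bilin f).
Lemma bilDl x y z : f (x + y) z = f x z + f y z. Proof. exact: (linD (bf.1 z)). Qed.
Lemma bilDr x y z : f x (y + z) = f x y + f x z. Proof. exact: (linD (bf.2 x)). Qed.
Lemma bilZl k x z : f (k *: x) z = k *: f x z. Proof. exact: (linZ (bf.1 z)). Qed.
Lemma bilZr k x z : f x (k *: z) = k *: f x z. Proof. exact: (linZ (bf.2 x)). Qed.
Lemma bilNl x z : f (- x) z = - f x z. Proof. exact: (linN (bf.1 z)). Qed.
Lemma bilNr x z : f x (- z) = - f x z. Proof. exact: (linN (bf.2 x)). Qed.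
Lemma bil0l z : f 0 z = 0. Proof. exact: (lin0 (bf.1 z)). Qed.
Lemma bil0r x : f x 0 = 0. Proof. exact: (lin0 (bf.2 x)). Qed.
Definition bilE := (bilDl, bilDr, bilZl, bilZr, bilNl, bilNr, bil0l, bil0r).
End BilinearMaps.

Lemma hom_ind (K : fieldType) (U : superspace K) (P : U -> Prop) :
  (forall i x, deg i x -> P x) -> (forall x y, P x -> P y -> P (x + y)) -> forall x, P x.
Proof. by move=> h hD x; rewrite [x]prjD; apply: hD; apply: h; apply: deg_prj. Qed.

Lemma degc (K : fieldType) (U : superspace K) i j (x : U) : i = j -> deg i x -> deg j x.
Proof. by move->. Qed.

Section HomogeneousExtension.
Variables (K : fieldType) (U : superspace K) (W : lmodType K).
(** Formulas with signs are stated on homogeneous elements, as a family [F]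
    indexed by the parity; this is the linear map they determine. *)
Definition hext (F : bool -> U -> W) (x : U) := F false (prj false x) + F true (prj true x).
Lemma hextE (F : bool -> U -> W) p x : (forall i, linear (F i)) -> deg p x -> hext F x = F p x.
Proof.
move=> lF dx; rewrite /hext !(prj_id _ dx); case: p {dx} => /=.
  by rewrite (lin0 (lF _)) add0r.
by rewrite (lin0 (lF true)) addr0.
Qed.
Lemma hext_linear (F : bool -> U -> W) : (forall i, linear (F i)) -> linear (hext F).
Proof. by move=> lF k x y; rewrite /hext !prj_linear !lF scalerDr addrACA. Qed.
End HomogeneousExtension.

Section HomogeneousExtension2.
Variables (K : fieldType) (U V : superspace K) (W : lmodType K).
Definition hext2 (F : bool -> bool -> U -> V -> W) (x : U) (y : V) :=
  hext (fun p x => hext (fun q y => F p q x y) y) x.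
Variable F : bool -> bool -> U -> V -> W.
Hypothesis bF : forall p q, bilin (F p q).
Lemma hext2_bilin : bilin (hext2 F).
Proof.
split=> [y|x k y y'].
  by apply: hext_linear => p k x x'; rewrite /hext !(bF _ _).1 scalerDr addrACA.
rewrite /hext2 {1 3}/hext; set a := prj false x; set b := prj true x.
rewrite /hext !prj_linear !(bF _ _).2 !scalerDr.
by rewrite [X in X + _ = _]addrACA [X in _ + X = _]addrACA [LHS]addrACA.
Qed.
Lemma hext2E p q x y : deg p x -> deg q y -> hext2 F x y = F p q x y.
Proof.
move=> dx dy; rewrite /hext2 (hextE _ dx); first by rewrite (hextE _ dy) // => i; apply: (bF _ _).2.
by move=> i k u v; rewrite /hext !(bF _ _).1 scalerDr addrACA.
Qed.
End HomogeneousExtension2.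

(** * Inner derivations of a ternary superalgebra *)

Section TernaryDerivations.
Variable K : fieldType.
Hypothesis n2 : 2%:R != 0 :> K.

Variables (J M : superspace K) (T : ternary_ops J M) (H : is_ternary T).
Local Notation "a ** b" := (jmul T a b) (at level 40, left associativity).
Local Notation "a @@ m" := (jact T a m) (at level 38, right associativity).
Local Notation "m \star n" := (star T m n) (at level 40, left associativity).
Local Notation "<| m , n , r |>" := (tri T m n r).
Local Notation s := (sg K).

Let HJ := ternary_jordan H.
Let HS := ternary_special H.
Let jE := jmul_even HJ.
Let aE := jact_even HS.
Let sE := star_even H.
Let tE := tri_even H.

Let jbE := bilE (jmul_bilin HJ).
Let abE := bilE (jact_bilin HS).
Let sbE := bilE (star_bilin H).
Definition triE := (fun n r => linD (tri_linear1 H n r), fun n r => linZ (tri_linear1 H n r),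
  fun n r => linN (tri_linear1 H n r),
  fun n r => linD (tri_linear2 H n r), fun n r => linZ (tri_linear2 H n r),
  fun n r => linN (tri_linear2 H n r),
  fun n r => linD (tri_linear3 H n r), fun n r => linZ (tri_linear3 H n r),
  fun n r => linN (tri_linear3 H n r)).

Let jC i j (a b : J) : deg i a -> deg j b -> a ** b = s i j *: (b ** a).
Proof. exact: (jmul_comm HJ). Qed.

(** ** The operators <a,b> and par_{m,n} are superderivations *)

(** The four-variable Jordan identity with [a] and [b] exchanged: the
    antisymmetrization of that identity in [a] and [b] is exactly the derivation
    property of the commutator of the two multiplications. *)
Lemma ang_jmul p q k l a b c d : deg p a -> deg q b -> deg k c -> deg l d ->
  angJ T p q a b (c ** d) = angJ T p q a b c ** d
    + s (p (+) q) k *: (c ** angJ T p q a b d).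
Proof.
move=> da db dc dd; rewrite /angJ.
apply: (lcstep (c := s q k) (jmul_jordan HJ da dc db dd)).
apply: (lcstep (c := - (s p q * s p k)) (jmul_jordan HJ db dc da dd)).
rewrite !jbE.
rewrite (jC da (jE db (jE dc dd))) (jC db (jE da (jE dc dd))).
rewrite (jC da (jE dc dd)) (jC db (jE dc dd)) (jC da (jE db dc)) (jC db (jE da dc)).
rewrite (jC dc (jE da (jE db dd))) (jC dc (jE db (jE da dd))).
rewrite (jC da (jE db dd)) (jC db (jE da dd)).
rewrite (jC (jE db dd) (jE dc da)) (jC (jE da dd) (jE dc db)) (jC dc da) (jC dc db) (jC db da).
rewrite !jbE; lm4 p q k l.
Qed.

(** A product acts on M as half an anticommutator, so <a,b> c acts as a quarter of
    the double supercommutator of the three actions; hence the factor 1/4 in the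
    definition of <a,b> on M. *)
Lemma ang_jact p q k l a b c m : deg p a -> deg q b -> deg k c -> deg l m ->
  angM T p q a b (c @@ m) = angJ T p q a b c @@ m
    + s (p (+) q) k *: (c @@ angM T p q a b m).
Proof.
move=> da db dc dm; rewrite /angJ /angM !abE.
rewrite (jact_special HS _ da (jE db dc)) (jact_special HS _ db (jE da dc)).
rewrite !(jact_special HS _ db dc) !(jact_special HS _ da dc) !abE.
lm4 p q k l.
Qed.

Lemma ang_star p q i j a b m n : deg p a -> deg q b -> deg i m -> deg j n ->
  angJ T p q a b (m \star n) = angM T p q a b m \star n
    + s (p (+) q) i *: (m \star angM T p q a b n).
Proof.
move=> da db dm dn; rewrite /angJ /angM.
rewrite (SJT1 H db dm dn) (SJT1 H da dm dn) !jbE !sbE.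
rewrite (SJT1 H da (aE db dm) dn) (SJT1 H da dm (aE db dn)).
rewrite (SJT1 H db (aE da dm) dn) (SJT1 H db dm (aE da dn)).
lm4 p q i j.
Qed.

(** By SJT2 each [a @@ -] is a derivation of the triple product up to the sign
    of the middle slot; this sign disappears in a commutator. *)
Lemma ang_tri p q i j k a b m n r : deg p a -> deg q b -> deg i m -> deg j n -> deg k r ->
  angM T p q a b <|m, n, r|> = <|angM T p q a b m, n, r|>
    + s (p (+) q) i *: <|m, angM T p q a b n, r|>
    + (s (p (+) q) i * s (p (+) q) j) *: <|m, n, angM T p q a b r|>.
Proof.
move=> da db dm dn dr; rewrite /angM !triE.
rewrite (SJT2 H db dm dn dr) (SJT2 H da dm dn dr) !abE.
rewrite (SJT2 H da (aE db dm) dn dr) (SJT2 H da dm (aE db dn) dr) (SJT2 H da dm dn (aE db dr)).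
rewrite (SJT2 H db (aE da dm) dn dr) (SJT2 H db dm (aE da dn) dr) (SJT2 H db dm dn (aE da dr)).
lm5 p q i j k.
Qed.

Lemma star_act i j k m n r : deg i m -> deg j n -> deg k r ->
  (m \star n) @@ r = <|m, n, r|> - s i j *: <|n, m, r|>.
Proof. by move=> dm dn dr; rewrite (SJT4 H dm dn dr) -/(s i j) addrAC subrr add0r. Qed.

(** A form of par_{m,n} that is visibly supersymmetric in [m] and [n]: SJT4
    expresses the product with [m \star n] through the triple product. *)
Lemma parME i j k m n r : deg i m -> deg j n -> deg k r ->
  parM T m n r = - 2%:R^-1 *: (<|m, n, r|> + s i j *: <|n, m, r|>).
Proof. move=> dm dn dr; rewrite /parM (star_act dm dn dr); lm2 i j. Qed.

Lemma par_jmul i j k l m n a b : deg i m -> deg j n -> deg k a -> deg l b ->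
  parJ T i j (k (+) l) m n (a ** b) = parJ T i j k m n a ** b
    + s (i (+) j) k *: (a ** parJ T i j l m n b).
Proof.
move=> dm dn da db; rewrite /parJ !jbE !(jact_special HS _ da db) !sbE.
rewrite (jC (sE (aE da dm) dn) db) (jC (sE dm (aE da dn)) db).
rewrite (SJT1 H db (aE da dm) dn) (SJT1 H db dm (aE da dn)).
rewrite (SJT1 H da (aE db dm) dn) (SJT1 H da dm (aE db dn)).
lm4 i j k l.
Qed.

Lemma par_jact i j k l m n a r : deg i m -> deg j n -> deg k a -> deg l r ->
  parM T m n (a @@ r) = parJ T i j k m n a @@ r
    + s (i (+) j) k *: (a @@ parM T m n r).
Proof.
move=> dm dn da dr; rewrite (parME dm dn (aE da dr)) (parME dm dn dr) /parJ !abE.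
rewrite (star_act (aE da dm) dn dr) (star_act dm (aE da dn) dr).
rewrite (SJT2 H da dm dn dr) (SJT2 H da dn dm dr).
lm4 i j k l.
Qed.

(** Symmetrization of SJT5 in [m] and [n]. *)
Lemma par_star i j k l m n r t : deg i m -> deg j n -> deg k r -> deg l t ->
  parJ T i j (k (+) l) m n (r \star t) = parM T m n r \star t
    + s (i (+) j) k *: (r \star parM T m n t).
Proof.
move=> dm dn dr dt; rewrite (parME dm dn dt) (parME dm dn dr) /parJ !sbE.
apply: (lcstep (c := - 2%:R^-1) (SJT5 H dm dn dr dt)).
apply: (lcstep (c := - (2%:R^-1 * s i j)) (SJT5 H dn dm dr dt)).
rewrite (star_anti H (aE (sE dr dt) dm) dn).
lm4 i j k l.
Qed.

(** Symmetrization of SJT6 in [m] and [n], using [parME]. *)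
Lemma par_tri i j k l q m n r t w : deg i m -> deg j n -> deg k r -> deg l t -> deg q w ->
  parM T m n <|r, t, w|> = <|parM T m n r, t, w|>
    + s (i (+) j) k *: <|r, parM T m n t, w|>
    + (s (i (+) j) k * s (i (+) j) l) *: <|r, t, parM T m n w|>.
Proof.
move=> dm dn dr dt dw; rewrite (parME dm dn (tE dr dt dw)).
rewrite (parME dm dn dr) (parME dm dn dt) (parME dm dn dw) !triE.
rewrite (SJT6 H dm dn dr dt dw) (SJT6 H dn dm dr dt dw).
lm5 i j k l q.
Qed.

(** ** The relations defining the inner superalgebra hold for the operators

    They make the assignments [a (x) b |-> <a,b>] and [m (x) n |-> par_{m,n}] descend
    to B^s. *)
Lemma angJ_anti p q a b c : angJ T p q a b c = - (s p q *: angJ T q p b a c).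
Proof. by rewrite /angJ; lm2 p q. Qed.
Lemma angM_anti p q a b c : angM T p q a b c = - (s p q *: angM T q p b a c).
Proof. rewrite /angM; lm2 p q. Qed.
Lemma parJ_sym i j k m n a : deg i m -> deg j n -> deg k a ->
  parJ T i j k m n a = s i j *: parJ T j i k n m a.
Proof.
move=> dm dn da; rewrite /parJ (star_anti H (aE da dm) dn) (star_anti H dm (aE da dn)).
lm3 i j k.
Qed.
Lemma parM_sym i j k m n r : deg i m -> deg j n -> deg k r ->
  parM T m n r = s i j *: parM T n m r.
Proof.
by move=> dm dn dr; rewrite (parME dm dn dr) (parME dn dm dr); lm3 i j k.
Qed.

(** The operators attached to the cyclic relation give the Jordan identity
    again, with one of its four variables as argument of the operator. *)
Lemma angJ_cyc p q k l a b c d : deg p a -> deg q b -> deg k c -> deg l d ->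
  s p k *: angJ T (p (+) q) k (a ** b) c d
  + s p q *: angJ T (q (+) k) p (b ** c) a d
  + s q k *: angJ T (k (+) p) q (c ** a) b d = 0.
Proof.
move=> da db dc dd; rewrite /angJ.
apply: (lcstep (c := - (s p k * s k l)) (jmul_jordan HJ da db dd dc)).
rewrite (jC dc (jE (jE da db) dd)) (jC da (jE (jE db dc) dd)) (jC db (jE (jE dc da) dd)).
rewrite (jC da dd) (jC db dd) (jC dc dd) (jC dc da) !jbE.
rewrite (jC (jE dd da) (jE db dc)).
lm4 p q k l.
Qed.

Lemma angM_cyc p q k a b c d : deg p a -> deg q b -> deg k c ->
  s p k *: angM T (p (+) q) k (a ** b) c d
  + s p q *: angM T (q (+) k) p (b ** c) a d
  + s q k *: angM T (k (+) p) q (c ** a) b d = 0.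
Proof.
move=> da db dc; rewrite /angM.
rewrite !(jact_special HS _ da db) !(jact_special HS _ db dc) !(jact_special HS _ dc da) !abE.
lm3 p q k.
Qed.

Lemma parJ_ang p i j k a m n c : deg p a -> deg i m -> deg j n -> deg k c ->
  parJ T (p (+) i) j k (a @@ m) n c - s p i *: parJ T i (p (+) j) k m (a @@ n) c
  - s p (i (+) j) *: (2%:R *: angJ T (i (+) j) p (m \star n) a c) = 0.
Proof.
move=> da dm dn dc; rewrite /parJ /angJ.
rewrite (jC (sE dm dn) (jE da dc)) (jC (sE dm dn) dc) (SJT1 H (jE da dc) dm dn) (SJT1 H dc dm dn).
rewrite !jbE !(jact_special HS _ da dc) !sbE.
rewrite (SJT1 H da (aE dc dm) dn) (SJT1 H da dm (aE dc dn)).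
lm4 p i j k.
Qed.

Lemma parM_ang p i j k a m n r : deg p a -> deg i m -> deg j n -> deg k r ->
  parM T (a @@ m) n r - s p i *: parM T m (a @@ n) r
  - s p (i (+) j) *: (2%:R *: angM T (i (+) j) p (m \star n) a r) = 0.
Proof.
move=> da dm dn dr.
rewrite (parME (aE da dm) dn dr) (parME dm (aE da dn) dr) /angM.
rewrite (star_act dm dn (aE da dr)) (star_act dm dn dr) !abE.
rewrite (SJT2 H da dm dn dr) (SJT2 H da dn dm dr).
lm4 p i j k.
Qed.
(** Superderivations of the whole ternary structure, of parity [d]. Everything
    that is built from the structure maps is equivariant under them, see
    [Equivariance] below. *)
Record superder (d : bool) (D : J -> J) (E : M -> M) : Prop := {
  sd_linJ : linear D;
  sd_linM : linear E;
  sd_degJ : forall k c, deg k c -> deg (d (+) k) (D c);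
  sd_degM : forall k r, deg k r -> deg (d (+) k) (E r);
  sd_jmul : forall k l a b, deg k a -> deg l b ->
    D (a ** b) = D a ** b + s d k *: (a ** D b);
  sd_jact : forall k l a r, deg k a -> deg l r ->
    E (a @@ r) = D a @@ r + s d k *: (a @@ E r);
  sd_star : forall k l m n, deg k m -> deg l n ->
    D (m \star n) = E m \star n + s d k *: (m \star E n);
  sd_tri : forall k l q m n r, deg k m -> deg l n -> deg q r ->
    E <|m, n, r|> = <|E m, n, r|> + s d k *: <|m, E n, r|>
      + (s d k * s d l) *: <|m, n, E r|>
}.

Lemma superder_ext d D E D' E' : D =1 D' -> E =1 E' -> superder d D E -> superder d D' E'.
Proof. by move=> /funext-> /funext->. Qed.

Lemma superder0 d : superder d (fun=> 0) (fun=> 0).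
Proof.
split.
- by move=> k x y; rewrite scaler0 addr0.
- by move=> k x y; rewrite scaler0 addr0.
- by move=> k c _; apply: deg0.
- by move=> k c _; apply: deg0.
- by move=> k l a b _ _; rewrite !jbE scaler0 addr0.
- by move=> k l a b _ _; rewrite !abE scaler0 addr0.
- by move=> k l a b _ _; rewrite !sbE scaler0 addr0.
move=> k l q m n r _ _ _; rewrite (lin0 (tri_linear1 H _ _)) (lin0 (tri_linear2 H _ _)).
by rewrite (lin0 (tri_linear3 H _ _)) !scaler0 !addr0.
Qed.

Lemma superder_lin d k D E D' E' : superder d D E -> superder d D' E' ->
  superder d (fun a => k *: D a + D' a) (fun m => k *: E m + E' m).
Proof.
move=> [l1 l2 e1 e2 f1 f2 f3 f4] [l1' l2' e1' e2' f1' f2' f3' f4']; split.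
- by move=> c x y; rewrite l1 l1'; lm0.
- by move=> c x y; rewrite l2 l2'; lm0.
- by move=> i x dx; apply: deg_lin; [exact: e1|exact: e1'].
- by move=> i x dx; apply: deg_lin; [exact: e2|exact: e2'].
- by move=> i j a b da db; rewrite (f1 _ _ _ _ da db) (f1' _ _ _ _ da db) !jbE; lm0.
- by move=> i j a b da db; rewrite (f2 _ _ _ _ da db) (f2' _ _ _ _ da db) !abE; lm0.
- by move=> i j a b da db; rewrite (f3 _ _ _ _ da db) (f3' _ _ _ _ da db) !sbE; lm0.
move=> i j l a b c da db dc.
by rewrite (f4 _ _ _ _ _ _ da db dc) (f4' _ _ _ _ _ _ da db dc) !triE; lm0.
Qed.

(** The formula for par_{m,n} on J involves the parity of the argument. *)
Definition parJh i j m n : J -> J := hext (fun k => parJ T i j k m n).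

Lemma angJ_linear p q a b : linear (angJ T p q a b).
Proof. by move=> k x y; rewrite /angJ !jbE; lm0. Qed.
Lemma angM_linear p q a b : linear (angM T p q a b).
Proof. by move=> k x y; rewrite /angM !abE; lm0. Qed.
Lemma parJ_linear i j k m n : linear (parJ T i j k m n).
Proof. by move=> c x y; rewrite /parJ !abE !sbE; lm0. Qed.
Lemma parM_linear m n : linear (parM T m n).
Proof. by move=> c x y; rewrite /parM !abE !triE; lm0. Qed.
Lemma parJhE i j k m n a : deg k a -> parJh i j m n a = parJ T i j k m n a.
Proof. by move=> da; apply: hextE => // l; apply: parJ_linear. Qed.

Lemma parJh_linear i j m n : linear (parJh i j m n).
Proof. by apply: hext_linear => k; apply: parJ_linear. Qed.

Lemma deg_angJ p q k a b c : deg p a -> deg q b -> deg k c ->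
  deg (p (+) q (+) k) (angJ T p q a b c).
Proof.
move=> da db dc; apply: degB; last apply: degZ.
- by apply: degc (jE da (jE db dc)); rewrite addbA.
- by apply: degc (jE db (jE da dc)); rewrite addbCA addbA.
Qed.
Lemma deg_angM p q k a b c : deg p a -> deg q b -> deg k c ->
  deg (p (+) q (+) k) (angM T p q a b c).
Proof.
move=> da db dc; apply: degZ; apply: degB; last apply: degZ.
- by apply: degc (aE da (aE db dc)); rewrite addbA.
- by apply: degc (aE db (aE da dc)); rewrite addbCA addbA.
Qed.
Lemma deg_parJ i j k m n a : deg i m -> deg j n -> deg k a ->
  deg (i (+) j (+) k) (parJ T i j k m n a).
Proof.
move=> dm dn da; apply: degZ; apply: degB; apply: degZ.
- by apply: degc (sE (aE da dm) dn); rewrite -addbA addbC.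
- by apply: degc (sE dm (aE da dn)); rewrite [k (+) j]addbC addbA.
Qed.

Lemma ang_der p q a b : deg p a -> deg q b -> superder (p (+) q) (angJ T p q a b) (angM T p q a b).
Proof.
move=> da db; split.
- exact: angJ_linear.
- exact: angM_linear.
- by move=> k c dc; apply: deg_angJ.
- by move=> k c dc; apply: deg_angM.
- by move=> k l c d dc dd; exact: (ang_jmul da db dc dd).
- by move=> k l c d dc dd; exact: (ang_jact da db dc dd).
- by move=> k l c d dc dd; exact: (ang_star da db dc dd).
- by move=> k l r m n t dm dn dt; exact: (ang_tri da db dm dn dt).
Qed.

Lemma par_der i j m n : deg i m -> deg j n -> superder (i (+) j) (parJh i j m n) (parM T m n).
Proof.
move=> dm dn; split.
- by apply: hext_linear => k; apply: parJ_linear.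
- exact: parM_linear.
- by move=> k c dc; rewrite (parJhE _ _ _ _ dc); apply: deg_parJ.
- by move=> k c dc; apply: (deg_parM H).
- move=> k l c d dc dd; rewrite (parJhE _ _ _ _ (jE dc dd)) (parJhE _ _ _ _ dc) (parJhE _ _ _ _ dd).
  exact: (par_jmul dm dn dc dd).
- by move=> k l c d dc dd; rewrite (parJhE _ _ _ _ dc); exact: (par_jact dm dn dc dd).
- by move=> k l c d dc dd; rewrite (parJhE _ _ _ _ (sE dc dd)); exact: (par_star dm dn dc dd).
- by move=> k l r c d t dc dd dt; exact: (par_tri dm dn dc dd dt).
Qed.

Section Equivariance.
Variables (d : bool) (D : J -> J) (E : M -> M) (HD : superder d D E).
Let dJ := sd_degJ HD.
Let dM := sd_degM HD.
Let DlE := linE (sd_linJ HD).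
Let ElE := linE (sd_linM HD).

Lemma der_angJ p q k a b c : deg p a -> deg q b -> deg k c ->
  D (angJ T p q a b c) = angJ T (d (+) p) q (D a) b c
    + s d p *: angJ T p (d (+) q) a (D b) c
    + (s d p * s d q) *: angJ T p q a b (D c).
Proof.
move=> da db dc; rewrite /angJ !DlE.
rewrite (sd_jmul HD da (jE db dc)) (sd_jmul HD db (jE da dc)).
rewrite (sd_jmul HD da dc) (sd_jmul HD db dc) !jbE.
lm4 d p q k.
Qed.

Lemma der_angM p q k a b c : deg p a -> deg q b -> deg k c ->
  E (angM T p q a b c) = angM T (d (+) p) q (D a) b c
    + s d p *: angM T p (d (+) q) a (D b) c
    + (s d p * s d q) *: angM T p q a b (E c).
Proof.
move=> da db dc; rewrite /angM !ElE.
rewrite (sd_jact HD da (aE db dc)) (sd_jact HD db (aE da dc)).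
rewrite (sd_jact HD da dc) (sd_jact HD db dc) !abE.
lm4 d p q k.
Qed.

Lemma der_parJ i j k m n a : deg i m -> deg j n -> deg k a ->
  D (parJ T i j k m n a) = parJ T (d (+) i) j k (E m) n a
    + s d i *: parJ T i (d (+) j) k m (E n) a
    + (s d i * s d j) *: parJ T i j (d (+) k) m n (D a).
Proof.
move=> dm dn da; rewrite /parJ !DlE.
rewrite (sd_star HD (aE da dm) dn) (sd_star HD dm (aE da dn)).
rewrite (sd_jact HD da dm) (sd_jact HD da dn) !sbE.
lm4 d i j k.
Qed.

Lemma der_parM i j k m n r : deg i m -> deg j n -> deg k r ->
  E (parM T m n r) = parM T (E m) n r + s d i *: parM T m (E n) r
    + (s d i * s d j) *: parM T m n (E r).
Proof.
move=> dm dn dr; rewrite /parM !ElE.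
rewrite (sd_jact HD (sE dm dn) dr) (sd_star HD dm dn) (sd_tri HD dm dn dr) !abE.
lm4 d i j k.
Qed.
End Equivariance.
End TernaryDerivations.

(** * The superalgebra of inner derivations *)

Section InnerAlgebra.
Variable K : fieldType.
Variables (J M : superspace K) (T : ternary_ops J M).
Local Notation "a ** b" := (jmul T a b) (at level 40, left associativity).
Local Notation "a @@ m" := (jact T a m) (at level 38, right associativity).
Local Notation "m \star n" := (star T m n) (at level 40, left associativity).
Local Notation s := (sg K).

(** What the construction of TAG uses of [B = B^s(J, M)]: the classes [bJ a b] and
    [bM m n] with four of the five defining relations, the actions [dlJ] and [dlM]
    of [B] on J and M by superderivations, and the Lie superbracket [dlB]. The
    fifth relation is hidden in the antisymmetry of [dlB]. *)
Record inner_algebra (B : superspace K) (bJ : J -> J -> B) (bM : M -> M -> B)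
    (dlJ : B -> J -> J) (dlM : B -> M -> M) (dlB : B -> B -> B) : Prop := {
  ia_bJ_bilin : bilin bJ;
  ia_bM_bilin : bilin bM;
  ia_dlJ_bilin : bilin dlJ;
  ia_dlM_bilin : bilin dlM;
  ia_dlB_bilin : bilin dlB;
  ia_deg_bJ : even_map2 bJ;
  ia_deg_bM : even_map2 bM;
  ia_deg_dlB : even_map2 dlB;
  ia_bJ_anti : forall i j a b, deg i a -> deg j b -> bJ a b = - (s i j *: bJ b a);
  ia_bM_sym : forall i j m n, deg i m -> deg j n -> bM m n = s i j *: bM n m;
  ia_bJ_cyc : forall i j k a b c, deg i a -> deg j b -> deg k c ->
    s i k *: bJ (a ** b) c + s i j *: bJ (b ** c) a + s j k *: bJ (c ** a) b = 0;
  ia_bM_act : forall p i j a m n, deg p a -> deg i m -> deg j n ->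
    bM (a @@ m) n - s p i *: bM m (a @@ n) - (s p i * s p j) *: (2%:R *: bJ (m \star n) a) = 0;
  ia_dlJ_bJ : forall p q a b c, deg p a -> deg q b -> dlJ (bJ a b) c = angJ T p q a b c;
  ia_dlJ_bM : forall i j m n c, deg i m -> deg j n -> dlJ (bM m n) c = parJh T i j m n c;
  ia_dlM_bJ : forall p q a b r, deg p a -> deg q b -> dlM (bJ a b) r = angM T p q a b r;
  ia_dlM_bM : forall m n r, dlM (bM m n) r = parM T m n r;
  ia_dl_der : forall i t, deg i t -> superder T i (dlJ t) (dlM t);
  ia_dlB_bJ : forall i t p q a b, deg i t -> deg p a -> deg q b ->
    dlB t (bJ a b) = bJ (dlJ t a) b + s i p *: bJ a (dlJ t b);
  ia_dlB_bM : forall i t p q a b, deg i t -> deg p a -> deg q b ->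
    dlB t (bM a b) = bM (dlM t a) b + s i p *: bM a (dlM t b);
  ia_dlJ_comm : forall i j k t u a, deg i t -> deg j u -> deg k a ->
    dlJ t (dlJ u a) = dlJ (dlB t u) a + s i j *: dlJ u (dlJ t a);
  ia_dlM_comm : forall i j k t u a, deg i t -> deg j u -> deg k a ->
    dlM t (dlM u a) = dlM (dlB t u) a + s i j *: dlM u (dlM t a);
  ia_dlB_comm : forall i j k t u v, deg i t -> deg j u -> deg k v ->
    dlB t (dlB u v) = dlB (dlB t u) v + s i j *: dlB u (dlB t v);
  ia_dlB_anti : forall i j t u, deg i t -> deg j u -> dlB t u = - (s i j *: dlB u t)
}.
End InnerAlgebra.

Section InnerSuperalgebra.
Variable K : fieldType.
Hypothesis n2 : 2%:R != 0 :> K.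

Variables (J M : superspace K) (T : ternary_ops J M) (H : is_ternary T).
Local Notation "a ** b" := (jmul T a b) (at level 40, left associativity).
Local Notation "a @@ m" := (jact T a m) (at level 38, right associativity).
Local Notation "m \star n" := (star T m n) (at level 40, left associativity).
Local Notation s := (sg K).
Let HJ := ternary_jordan H.
Let HS := ternary_special H.
Let jE := jmul_even HJ.
Let aE := jact_even HS.
Let sE := star_even H.

Let jbE := bilE (jmul_bilin HJ).
Let abE := bilE (jact_bilin HS).
Let sbE := bilE (star_bilin H).

Let jC i j (a b : J) : deg i a -> deg j b -> a ** b = s i j *: (b ** a).
Proof. exact: (jmul_comm HJ). Qed.

Local Notation B := (Bs H).
Definition bJ (a b : J) : B := qclass (Rs T) (tJ M a b).
Definition bM (m n : M) : B := qclass (Rs T) (tM J m n).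

Lemma bJ_bilin : bilin bJ.
Proof.
have [tl tr] := @tens_bilin K J J.
by split=> c k x y; rewrite /bJ -linearP; congr qclass; congr (_, _); rewrite /= ?tl ?tr // scaler0 addr0.
Qed.
Lemma bM_bilin : bilin bM.
Proof.
have [tl tr] := @tens_bilin K M M.
by split=> c k x y; rewrite /bM -linearP; congr qclass; congr (_, _); rewrite /= ?tl ?tr // scaler0 addr0.
Qed.
Let bJE := bilE bJ_bilin.
Let bME := bilE bM_bilin.
Let qZ k x : qclass (Rs T) (k *: x) = k *: qclass (Rs T) x. Proof. exact: linearZ. Qed.
Let qD x y : qclass (Rs T) (x + y) = qclass (Rs T) x + qclass (Rs T) y. Proof. exact: linearD. Qed.
Let qN x : qclass (Rs T) (- x) = - qclass (Rs T) x. Proof. exact: linearN. Qed.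
Let qE := (qZ, qD, qN).

Lemma Rs0 x : Rs T x -> qclass (Rs T) x = 0.
Proof. by move=> Rx; rewrite -(linear0 (qclass (Rs T))); apply/qclassP; rewrite subr0; apply: span_gen. Qed.

Lemma bJ_anti i j a b : deg i a -> deg j b -> bJ a b = - (s i j *: bJ b a).
Proof. by move=> da db; have := Rs0 (Rs_JJ _ da db); rewrite !qE => /eqP; rewrite addr_eq0 => /eqP. Qed.
Lemma bM_sym i j m n : deg i m -> deg j n -> bM m n = s i j *: bM n m.
Proof. by move=> da db; have := Rs0 (Rs_MM _ da db); rewrite !qE => /eqP; rewrite subr_eq0 => /eqP. Qed.
Lemma bJ_cyc i j k a b c : deg i a -> deg j b -> deg k c ->
  s i k *: bJ (a ** b) c + s i j *: bJ (b ** c) a + s j k *: bJ (c ** a) b = 0.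
Proof. by move=> da db dc; have := Rs0 (Rs_JJJ T da db dc); rewrite !qE. Qed.
Lemma bM_act p i j a m n : deg p a -> deg i m -> deg j n ->
  bM (a @@ m) n - s p i *: bM m (a @@ n) - (s p i * s p j) *: (2%:R *: bJ (m \star n) a) = 0.
Proof.
move=> da db dc; have := Rs0 (Rs_JMM T da db dc).
by rewrite !qE mulnDr exprD.
Qed.
Lemma bM_par i j k l m n r t : deg i m -> deg j n -> deg k r -> deg l t ->
  bM (parM T m n r) t + s (i (+) j) k *: bM r (parM T m n t)
  + s (i (+) j) (k (+) l) *: bM (parM T r t m) n
  + s (k (+) l) j *: bM m (parM T r t n) = 0.
Proof.
move=> dm dn dr dt; have := Rs0 (Rs_MMMM T dm dn dr dt).
by rewrite !qE; sgn.
Qed.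

Lemma deg_bJ i j a b : deg i a -> deg j b -> deg (i (+) j) (bJ a b).
Proof. by move=> da db; exists (tJ M a b) => //; apply: deg_tJ. Qed.
Lemma deg_bM i j a b : deg i a -> deg j b -> deg (i (+) j) (bM a b).
Proof. by move=> da db; exists (tM J a b) => //; apply: deg_tM. Qed.

(** A homogeneous class has a homogeneous representative, and this is a combination
    of pure tensors of homogeneous elements. *)
Lemma B_ind_deg (P : B -> Prop) i :
  (forall p q a b, deg p a -> deg q b -> p (+) q = i -> P (bJ a b)) ->
  (forall p q m n, deg p m -> deg q n -> p (+) q = i -> P (bM m n)) ->
  P 0 -> (forall k x y, P x -> P y -> P (k *: x + y)) -> forall t, deg i t -> P t.
Proof.
move=> hJ hM h0 hL t [[x y] [/= dx dy]] ->.
have -> : (x, y) = 1 *: (x, 0) + (0, y) :> Bs_pre J M.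
  by rewrite scale1r; congr (_, _); rewrite /= ?addr0 ?add0r.
rewrite linearP; apply: (hL).
- elim: dx => [z [j [k [u [v [du dv e ->]]]]]||k u v _ hu _ hv].
  + exact: (hJ) du dv (esym e).
  + by rewrite (_ : (0, 0) = 0) // linear0.
  have -> : (k *: u + v, 0) = k *: (u, 0) + (v, 0) :> Bs_pre J M.
    by congr (_, _); rewrite /= scaler0 addr0.
  by rewrite linearP; apply: (hL).
- elim: dy => [z [j [k [u [v [du dv e ->]]]]]||k u v _ hu _ hv].
  + exact: hM du dv (esym e).
  + by rewrite (_ : (0, 0) = 0) // linear0.
  have -> : (0, k *: u + v) = k *: (0, u) + (0, v) :> Bs_pre J M.
    by congr (_, _); rewrite /= scaler0 addr0.
  by rewrite linearP; apply: (hL).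
Qed.

Lemma B_ind (P : B -> Prop) :
  (forall p q a b, deg p a -> deg q b -> P (bJ a b)) ->
  (forall p q m n, deg p m -> deg q n -> P (bM m n)) ->
  P 0 -> (forall k x y, P x -> P y -> P (k *: x + y)) -> forall t, P t.
Proof.
move=> hJ hM h0 hL t; rewrite [t]prjD -[X in P (X + _)]scale1r; apply: (hL).
- by apply: B_ind_deg (deg_prj _ _) => // *; [apply: hJ|apply: hM]; eassumption.
- by apply: B_ind_deg (deg_prj _ _) => // *; [apply: hJ|apply: hM]; eassumption.
Qed.

Lemma B_ext (W : lmodType K) (f g : B -> W) : linear f -> linear g ->
  (forall p q a b, deg p a -> deg q b -> f (bJ a b) = g (bJ a b)) ->
  (forall p q m n, deg p m -> deg q n -> f (bM m n) = g (bM m n)) -> f =1 g.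
Proof.
move=> lf lg hJ hM; apply: B_ind => //; first by rewrite (lin0 lf) (lin0 lg).
by move=> k x y hx hy; rewrite lf lg hx hy.
Qed.

(** The universal property of B^s. *)
Lemma B_lift (W : lmodType K) (f : J -> J -> W) (g : M -> M -> W) :
  bilin f -> bilin g ->
  (forall i j a b, deg i a -> deg j b -> f a b = - (s i j *: f b a)) ->
  (forall i j m n, deg i m -> deg j n -> g m n = s i j *: g n m) ->
  (forall i j k a b c, deg i a -> deg j b -> deg k c ->
    s i k *: f (a ** b) c + s i j *: f (b ** c) a + s j k *: f (c ** a) b = 0) ->
  (forall p i j a m n, deg p a -> deg i m -> deg j n ->
    g (a @@ m) n - s p i *: g m (a @@ n) - (s p i * s p j) *: (2%:R *: f (m \star n) a) = 0) ->
  (forall i j k l m n r t, deg i m -> deg j n -> deg k r -> deg l t ->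
    g (parM T m n r) t + s (i (+) j) k *: g r (parM T m n t)
    + s (i (+) j) (k (+) l) *: g (parM T r t m) n
    + s (k (+) l) j *: g m (parM T r t n) = 0) ->
  exists2 h : B -> W, linear h &
    (forall a b, h (bJ a b) = f a b) /\ (forall m n, h (bM m n) = g m n).
Proof.
move=> bf bg r1 r2 r3 r4 r5.
have [F lF FE] := tensor_lift bf; have [G lG GE] := tensor_lift bg.
pose h0 (x : Bs_pre J M) := F x.1 + G x.2.
have lh0 : linear h0 by move=> k x y; rewrite /h0 /= lF lG scalerDr addrACA.
have h0J a b : h0 (tJ M a b) = f a b by rewrite /h0 /= FE (lin0 lG) addr0.
have h0M a b : h0 (tM J a b) = g a b by rewrite /h0 /= GE (lin0 lF) add0r.
have [|h lh hE] := quotmod_lift lh0 (P := Rs T).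
  move=> x [].
  - by move=> i j a b da db; rewrite !(linE lh0) !h0J (r1 _ _ _ _ da db) addNr.
  - by move=> i j a b da db; rewrite !(linE lh0) !h0M (r2 _ _ _ _ da db) subrr.
  - by move=> i j k a b c da db dc; rewrite !(linE lh0) !h0J; exact: r3.
  - move=> p i j a m n da dm dn; rewrite !(linE lh0) !h0J !h0M mulnDr exprD.
    exact: r4.
  - move=> i j k l m n r t dm dn dr dt; rewrite !(linE lh0) !h0M.
    have := r5 _ _ _ _ _ _ _ _ dm dn dr dt.
    by sgn.
by exists h => //; split=> *; rewrite hE.
Qed.

(** ** The action of B^s on J and M *)

Lemma angJ_bilin p q c : bilin (fun a b => angJ T p q a b c).
Proof. by split=> ? k x y; rewrite /angJ !jbE; lm0. Qed.
Lemma angM_bilin p q m : bilin (fun a b => angM T p q a b m).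
Proof. by split=> ? k x y; rewrite /angM !abE; lm0. Qed.
Lemma parJ_bilin i j k a : bilin (fun m n => parJ T i j k m n a).
Proof. by split=> ? c x y; rewrite /parJ !abE !sbE; lm0. Qed.
Lemma parM_bilin r : bilin (fun m n => parM T m n r).
Proof. by split=> ? k x y; rewrite /parM !sbE !abE !(triE H); lm0. Qed.

(** For a fixed argument [c] the operators depend bilinearly on the pairs and
    respect the relations. For the last relation, [par_{m,n}] and [par_{r,t}] are
    derivations, so both [par_{par_{m,n} r, t} + ...] and the term with the pairs
    exchanged are supercommutators of the two, of opposite signs. *)
Lemma deltaJ_hom k c : deg k c -> exists2 h : B -> J, linear h &
  (forall p q a b, deg p a -> deg q b -> h (bJ a b) = angJ T p q a b c) /\
  (forall i j m n, deg i m -> deg j n -> h (bM m n) = parJh T i j m n c).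
Proof.
move=> dc.
pose f := hext2 (fun p q a b => angJ T p q a b c).
pose g := hext2 (fun i j m n => parJ T i j k m n c).
have fE p q a b : deg p a -> deg q b -> f a b = angJ T p q a b c.
  by move=> da db; apply: hext2E => // *; apply: angJ_bilin.
have gE p q m n : deg p m -> deg q n -> g m n = parJ T p q k m n c.
  by move=> da db; apply: (@hext2E _ _ _ _ (fun i j m n => parJ T i j k m n c)) => // *; apply: parJ_bilin.
have [|||||||h lh [hJ hM]] := @B_lift J f g.
- by apply: hext2_bilin => *; apply: angJ_bilin.
- by apply: (@hext2_bilin _ _ _ _ (fun i j m n => parJ T i j k m n c)) => *; apply: parJ_bilin.
- by move=> i j a b da db; rewrite (fE _ _ _ _ da db) (fE _ _ _ _ db da) (angJ_anti n2).
- by move=> i j m n dm dn; rewrite (gE _ _ _ _ dm dn) (gE _ _ _ _ dn dm) (parJ_sym n2 H dm dn dc).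
- move=> p q l a b d da db dd; rewrite (fE _ _ _ _ (jE da db) dd) (fE _ _ _ _ (jE db dd) da).
  by rewrite (fE _ _ _ _ (jE dd da) db); apply: (angJ_cyc n2 H da db dd dc).
- move=> p i j a m n da dm dn.
  rewrite (gE _ _ _ _ (aE da dm) dn) (gE _ _ _ _ dm (aE da dn)) (fE _ _ _ _ (sE dm dn) da).
  by have := parJ_ang n2 H da dm dn dc; sgn.
- move=> i j l q m n r t dm dn dr dt.
  have D := par_der n2 H dm dn; have D' := par_der n2 H dr dt.
  have := der_parJ n2 H D dr dt dc; have := der_parJ n2 H D' dm dn dc.
  rewrite -!(parJhE n2 H _ _ _ _ dc) -(parJhE n2 H _ _ _ _ (sd_degJ D dc)).
  rewrite -(parJhE n2 H _ _ _ _ (sd_degJ D' dc)).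
  rewrite (gE _ _ _ _ (sd_degM D dr) dt) (gE _ _ _ _ dr (sd_degM D dt)).
  rewrite (gE _ _ _ _ (sd_degM D' dm) dn) (gE _ _ _ _ dm (sd_degM D' dn)).
  move=> e2 e1; apply: (lcstep (c := 1) e1); apply: (lcstep (c := s (i (+) j) (l (+) q)) e2).
  rewrite !(parJhE n2 H _ _ _ _ dc).
  lm4 i j l q.
exists h => //; split=> p q a b da db; first by rewrite hJ; apply: fE.
by rewrite hM (parJhE n2 H _ _ _ _ dc); apply: gE.
Qed.

Lemma deltaJ_ex c : exists2 h : B -> J, linear h &
  (forall p q a b, deg p a -> deg q b -> h (bJ a b) = angJ T p q a b c) /\
  (forall i j m n, deg i m -> deg j n -> h (bM m n) = parJh T i j m n c).
Proof.
elim/hom_ind: c => [k c dc|x y [h lh [hJ hM]] [h' lh' [hJ' hM']]]; first exact: deltaJ_hom dc.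
exists (fun t => h t + h' t); first by move=> k u v; rewrite lh lh'; lm0.
split=> p q a b da db.
  by rewrite (hJ _ _ _ _ da db) (hJ' _ _ _ _ da db) (linD (angJ_linear n2 H _ _ _ _)).
rewrite (hM _ _ _ _ da db) (hM' _ _ _ _ da db).
by rewrite (linD (parJh_linear n2 H _ _ _ _)).
Qed.

Lemma deltaM_hom k r : deg k r -> exists2 h : B -> M, linear h &
  (forall p q a b, deg p a -> deg q b -> h (bJ a b) = angM T p q a b r) /\
  (forall m n, h (bM m n) = parM T m n r).
Proof.
move=> dc.
pose f := hext2 (fun p q a b => angM T p q a b r).
pose g := (fun m n => parM T m n r).
have fE p q a b : deg p a -> deg q b -> f a b = angM T p q a b r.
  by move=> da db; apply: hext2E => // *; apply: angM_bilin.
have [|||||||h lh [hJ hM]] := @B_lift M f g.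
- by apply: hext2_bilin => *; apply: angM_bilin.
- exact: parM_bilin.
- by move=> i j a b da db; rewrite (fE _ _ _ _ da db) (fE _ _ _ _ db da) (angM_anti n2).
- by move=> i j m n dm dn; rewrite /g (parM_sym n2 H dm dn dc).
- move=> p q l a b d da db dd; rewrite (fE _ _ _ _ (jE da db) dd) (fE _ _ _ _ (jE db dd) da).
  by rewrite (fE _ _ _ _ (jE dd da) db); apply: (angM_cyc n2 H r da db dd).
- move=> p i j a m n da dm dn; rewrite (fE _ _ _ _ (sE dm dn) da).
  by have := parM_ang n2 H da dm dn dc; sgn.
- move=> i j l q m n u t dm dn du dt; rewrite /g.
  have D := par_der n2 H dm dn; have D' := par_der n2 H du dt.
  apply: (lcstep (c := 1) (der_parM n2 H D du dt dc)).
  apply: (lcstep (c := s (i (+) j) (l (+) q)) (der_parM n2 H D' dm dn dc)).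
  lm4 i j l q.
exists h => //; split=> // p q a b da db; first by rewrite hJ; apply: fE.
Qed.

Lemma deltaM_ex r : exists2 h : B -> M, linear h &
  (forall p q a b, deg p a -> deg q b -> h (bJ a b) = angM T p q a b r) /\
  (forall m n, h (bM m n) = parM T m n r).
Proof.
elim/hom_ind: r => [k c dc|x y [h lh [hJ hM]] [h' lh' [hJ' hM']]]; first exact: deltaM_hom dc.
exists (fun t => h t + h' t); first by move=> k u v; rewrite lh lh'; lm0.
split=> [p q a b da db|m n].
  by rewrite (hJ _ _ _ _ da db) (hJ' _ _ _ _ da db) (linD (angM_linear n2 H _ _ _ _)).
by rewrite hM hM' (linD (parM_linear n2 H _ _)).
Qed.

Definition dlJ (t : B) (c : J) : J := projT1 (cid2 (deltaJ_ex c)) t.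
Definition dlM (t : B) (r : M) : M := projT1 (cid2 (deltaM_ex r)) t.

Lemma dlJ_bJ p q a b c : deg p a -> deg q b -> dlJ (bJ a b) c = angJ T p q a b c.
Proof. by rewrite /dlJ; case: cid2 => h /= _ [hJ _]; apply: hJ. Qed.
Lemma dlJ_bM i j m n c : deg i m -> deg j n -> dlJ (bM m n) c = parJh T i j m n c.
Proof. by rewrite /dlJ; case: cid2 => h /= _ [_ hM]; apply: hM. Qed.
Lemma dlM_bJ p q a b c : deg p a -> deg q b -> dlM (bJ a b) c = angM T p q a b c.
Proof. by rewrite /dlM; case: cid2 => h /= _ [hJ _]; apply: hJ. Qed.
Lemma dlM_bM m n c : dlM (bM m n) c = parM T m n c.
Proof. by rewrite /dlM; case: cid2 => h /= _ [_ hM]; apply: hM. Qed.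

Lemma dlJ_bilin : bilin dlJ.
Proof.
have l1 c : linear (dlJ^~ c) by rewrite /dlJ; case: cid2.
split=> // t k x y; move: t; apply: B_ext => //.
- by move=> l u v; rewrite !l1; lm0.
- by move=> p q a b da db; rewrite !(dlJ_bJ _ da db) (angJ_linear n2 H).
- by move=> p q a b da db; rewrite !(dlJ_bM _ da db) (parJh_linear n2 H _ _ _ _).
Qed.
Lemma dlM_bilin : bilin dlM.
Proof.
have l1 c : linear (dlM^~ c) by rewrite /dlM; case: cid2.
split=> // t k x y; move: t; apply: B_ext => //.
- by move=> l u v; rewrite !l1; lm0.
- by move=> p q a b da db; rewrite !(dlM_bJ _ da db) (angM_linear n2 H).
- by move=> p q a b da db; rewrite !dlM_bM (parM_linear n2 H).
Qed.
Let dJE := bilE dlJ_bilin.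
Let dME := bilE dlM_bilin.

Lemma dl_der i t : deg i t -> superder T i (dlJ t) (dlM t).
Proof.
elim/B_ind_deg => {t} [p q a b da db <-|p q m n da db <-||k x y hx hy].
- apply: (superder_ext _ _ (ang_der n2 H da db)) => x; first by rewrite (dlJ_bJ _ da db).
  by rewrite (dlM_bJ _ da db).
- apply: (superder_ext _ _ (par_der n2 H da db)) => x; first by rewrite (dlJ_bM _ da db).
  by rewrite dlM_bM.
- by apply: (superder_ext _ _ (superder0 H i)) => x; rewrite ?dJE ?dME.
by apply: (superder_ext _ _ (superder_lin n2 H k hx hy)) => z; rewrite ?dJE ?dME.
Qed.

(** ** The bracket of B^s

    A superderivation of the ternary structure acts on the tensors by the Leibniz
    rule. It maps each relation to a sum of relations of the same type, because
    the structure maps in the relations are equivariant; so it acts on B^s. *)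
Lemma der_lift d D E : superder T d D E -> exists2 h : B -> B, linear h &
  (forall p q a b, deg p a -> deg q b -> h (bJ a b) = bJ (D a) b + s d p *: bJ a (D b)) /\
  (forall i j m n, deg i m -> deg j n -> h (bM m n) = bM (E m) n + s d i *: bM m (E n)).
Proof.
move=> HD; have DE := linE (sd_linJ HD); have EE := linE (sd_linM HD).
have dJ := sd_degJ HD; have dM := sd_degM HD.
pose F p (q : bool) a b := bJ (D a) b + s d p *: bJ a (D b).
pose G p (q : bool) a b := bM (E a) b + s d p *: bM a (E b).
have FB p q : bilin (F p q) by split=> ? k x y; rewrite /F !DE !bJE; lm0.
have GB p q : bilin (G p q) by split=> ? k x y; rewrite /G !EE !bME; lm0.
pose f := hext2 F; pose g := hext2 G.
have fE p q a b : deg p a -> deg q b -> f a b = bJ (D a) b + s d p *: bJ a (D b).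
  by move=> da db; rewrite /f (hext2E FB da db).
have gE p q a b : deg p a -> deg q b -> g a b = bM (E a) b + s d p *: bM a (E b).
  by move=> da db; rewrite /g (hext2E GB da db).
have [|||||||h lh [hJ hM]] := @B_lift B f g.
- exact: hext2_bilin.
- exact: hext2_bilin.
- move=> p q a b da db; rewrite (fE _ _ _ _ da db) (fE _ _ _ _ db da).
  rewrite (bJ_anti (dJ _ _ da) db) (bJ_anti da (dJ _ _ db)); lm3 d p q.
- move=> p q a b da db; rewrite (gE _ _ _ _ da db) (gE _ _ _ _ db da).
  rewrite (bM_sym (dM _ _ da) db) (bM_sym da (dM _ _ db)); lm3 d p q.
- move=> p q k a b c da db dc; rewrite (fE _ _ _ _ (jE da db) dc).
  rewrite (fE _ _ _ _ (jE db dc) da) (fE _ _ _ _ (jE dc da) db).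
  rewrite (sd_jmul HD da db) (sd_jmul HD db dc) (sd_jmul HD dc da) !bJE.
  apply: (lcstep (c := - s d k) (bJ_cyc (dJ _ _ da) db dc)).
  apply: (lcstep (c := - s d p) (bJ_cyc da (dJ _ _ db) dc)).
  apply: (lcstep (c := - s d q) (bJ_cyc da db (dJ _ _ dc))).
  lm4 d p q k.
- move=> p i j a m n da dm dn; rewrite (gE _ _ _ _ (aE da dm) dn).
  rewrite (gE _ _ _ _ dm (aE da dn)) (fE _ _ _ _ (sE dm dn) da).
  rewrite (sd_jact HD da dm) (sd_jact HD da dn) (sd_star HD dm dn) !(bJE, bME).
  apply: (lcstep (c := - 1) (bM_act (dJ _ _ da) dm dn)).
  apply: (lcstep (c := - s d p) (bM_act da (dM _ _ dm) dn)).
  apply: (lcstep (c := - (s d p * s d i)) (bM_act da dm (dM _ _ dn))).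
  lm4 d p i j.
- move=> i j k l m n r t dm dn dr dt.
  have P := deg_parM H.
  rewrite (gE _ _ _ _ (P _ _ _ _ _ _ dm dn dr) dt) (gE _ _ _ _ dr (P _ _ _ _ _ _ dm dn dt)).
  rewrite (gE _ _ _ _ (P _ _ _ _ _ _ dr dt dm) dn) (gE _ _ _ _ dm (P _ _ _ _ _ _ dr dt dn)).
  rewrite (der_parM n2 H HD dm dn dr) (der_parM n2 H HD dm dn dt).
  rewrite (der_parM n2 H HD dr dt dm) (der_parM n2 H HD dr dt dn).
  apply: (lcstep (c := - 1) (bM_par (dM _ _ dm) dn dr dt)).
  apply: (lcstep (c := - s d i) (bM_par dm (dM _ _ dn) dr dt)).
  apply: (lcstep (c := - (s d i * s d j)) (bM_par dm dn (dM _ _ dr) dt)).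
  apply: (lcstep (c := - (s d i * s d j * s d k)) (bM_par dm dn dr (dM _ _ dt))).
  by move: (parM T) => parT; rewrite !bME; lm5 d i j k l.
exists h => //; split=> p q a b da db; first by rewrite hJ; apply: fE da db.
by rewrite hM; apply: gE da db.
Qed.

(** The bracket with [t] is the action on B^s of the derivation that [t] induces,
    taken separately on the even and the odd part of [t]. *)
Definition dlB_part i (t : B) : B -> B :=
  projT1 (cid2 (der_lift (dl_der (deg_prj i t)))).
Lemma dlB_part_linear i t : linear (dlB_part i t).
Proof. by rewrite /dlB_part; case: cid2. Qed.
Lemma dlB_part_bJ i t p q a b : deg p a -> deg q b ->
  dlB_part i t (bJ a b) = bJ (dlJ (prj i t) a) b + s i p *: bJ a (dlJ (prj i t) b).
Proof. by rewrite /dlB_part; case: cid2 => h /= _ [hJ _]; apply: hJ. Qed.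
Lemma dlB_part_bM i t p q a b : deg p a -> deg q b ->
  dlB_part i t (bM a b) = bM (dlM (prj i t) a) b + s i p *: bM a (dlM (prj i t) b).
Proof. by rewrite /dlB_part; case: cid2 => h /= _ [_ hM]; apply: hM. Qed.

Fact dlB_exists : { f : B -> B -> B | [/\ bilin f,
  forall i t p q a b, deg i t -> deg p a -> deg q b ->
    f t (bJ a b) = bJ (dlJ t a) b + s i p *: bJ a (dlJ t b)
  & forall i t p q a b, deg i t -> deg p a -> deg q b ->
    f t (bM a b) = bM (dlM t a) b + s i p *: bM a (dlM t b)] }.
Proof.
pose dlB (t u : B) : B := dlB_part false t u + dlB_part true t u.
exists dlB; split.
- have l2 t : linear (dlB t).
    by move=> k x y; rewrite /dlB !dlB_part_linear; lm0.
  split=> // u k x y; move: u; apply: B_ext => //.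
  + by move=> c u v; rewrite !l2; lm0.
  + move=> p q a b da db; rewrite /dlB !(dlB_part_bJ _ _ da db) !prj_linear !(dJE, bJE); lm0.
  + move=> p q a b da db; rewrite /dlB !(dlB_part_bM _ _ da db) !prj_linear !(dME, bME); lm0.
- move=> i t p q a b dt da db; rewrite /dlB !(dlB_part_bJ _ _ da db) !(prj_id _ dt).
  by case: i dt => _ /=; rewrite !(dJE, bJE) scaler0 ?addr0 ?add0r.
- move=> i t p q a b dt da db; rewrite /dlB !(dlB_part_bM _ _ da db) !(prj_id _ dt).
  by case: i dt => _ /=; rewrite !(dME, bME) scaler0 ?addr0 ?add0r.
Qed.
Definition dlB := sval dlB_exists.
Lemma dlB_bilin : bilin dlB. Proof. by rewrite /dlB; case: dlB_exists => f /= []. Qed.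
Lemma dlB_bJ i t p q a b : deg i t -> deg p a -> deg q b ->
  dlB t (bJ a b) = bJ (dlJ t a) b + s i p *: bJ a (dlJ t b).
Proof. by rewrite /dlB; case: dlB_exists => f /= [_ h _]; apply: h. Qed.
Lemma dlB_bM i t p q a b : deg i t -> deg p a -> deg q b ->
  dlB t (bM a b) = bM (dlM t a) b + s i p *: bM a (dlM t b).
Proof. by rewrite /dlB; case: dlB_exists => f /= [_ _ h]; apply: h. Qed.

Let dBE := bilE dlB_bilin.

Lemma deg_dlJ i k t a : deg i t -> deg k a -> deg (i (+) k) (dlJ t a).
Proof. by move=> /(dl_der)/sd_degJ; apply. Qed.
Lemma deg_dlM i k t a : deg i t -> deg k a -> deg (i (+) k) (dlM t a).
Proof. by move=> /(dl_der)/sd_degM; apply. Qed.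

Lemma deg_dlB : even_map2 dlB.
Proof.
move=> i k t u dt; elim/B_ind_deg => {u} [p q a b da db <-|p q a b da db <-||c x y dx dy].
- rewrite (dlB_bJ dt da db); apply: degD; last apply: degZ.
    by apply: degc (deg_bJ (deg_dlJ dt da) db); rewrite addbA.
  by apply: degc (deg_bJ da (deg_dlJ dt db)); rewrite addbCA.
- rewrite (dlB_bM dt da db); apply: degD; last apply: degZ.
    by apply: degc (deg_bM (deg_dlM dt da) db); rewrite addbA.
  by apply: degc (deg_bM da (deg_dlM dt db)); rewrite addbCA.
- by rewrite dBE; apply: deg0.
by rewrite !dBE; apply: deg_lin.
Qed.

Lemma dlJ_comm i j k t u a : deg i t -> deg j u -> deg k a ->
  dlJ t (dlJ u a) = dlJ (dlB t u) a + s i j *: dlJ u (dlJ t a).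
Proof.
move=> dt du da; have Dt := dl_der dt; have ta := sd_degJ Dt da.
elim/B_ind_deg: du => {u} [p q b c db dc <-|p q m n dm dn <-||l x y hx hy].
- rewrite (dlB_bJ dt db dc) !dJE !(dlJ_bJ _ db dc).
  rewrite (dlJ_bJ _ (sd_degJ Dt db) dc) (dlJ_bJ _ db (sd_degJ Dt dc)).
  rewrite (der_angJ n2 H Dt db dc da); lm4 i p q k.
- rewrite (dlB_bM dt dm dn) !dJE !(dlJ_bM _ dm dn).
  rewrite (dlJ_bM _ (sd_degM Dt dm) dn) (dlJ_bM _ dm (sd_degM Dt dn)).
  rewrite !(parJhE n2 H _ _ _ _ da) (parJhE n2 H _ _ _ _ ta).
  rewrite (der_parJ n2 H Dt dm dn da); lm4 i p q k.
- by rewrite !dBE !dJE scaler0 addr0.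
by rewrite !dBE !dJE hx hy; lm2 i j.
Qed.

Lemma dlM_comm i j k t u a : deg i t -> deg j u -> deg k a ->
  dlM t (dlM u a) = dlM (dlB t u) a + s i j *: dlM u (dlM t a).
Proof.
move=> dt du da; have Dt := dl_der dt.
elim/B_ind_deg: du => {u} [p q b c db dc <-|p q m n dm dn <-||l x y hx hy].
- rewrite (dlB_bJ dt db dc) !dME !(dlM_bJ _ db dc).
  rewrite (dlM_bJ _ (sd_degJ Dt db) dc) (dlM_bJ _ db (sd_degJ Dt dc)).
  rewrite (der_angM n2 H Dt db dc da); lm4 i p q k.
- rewrite (dlB_bM dt dm dn) !dME !dlM_bM.
  rewrite (der_parM n2 H Dt dm dn da); lm4 i p q k.
- by rewrite !dBE !dME scaler0 addr0.
by rewrite !dBE !dME hx hy; lm2 i j.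
Qed.

(** The Jacobi identity says that the derivation induced by [dlB t u] is the
    supercommutator of those induced by [t] and [u]. *)
Lemma dlB_comm i j k t u v : deg i t -> deg j u -> deg k v ->
  dlB t (dlB u v) = dlB (dlB t u) v + s i j *: dlB u (dlB t v).
Proof.
move=> dt du dv; have dtu := deg_dlB dt du.
elim/B_ind_deg: dv => {v} [p q a b da db _|p q a b da db _||l x y hx hy].
- rewrite (dlB_bJ du da db) (dlB_bJ dt da db) (dlB_bJ dtu da db) !dBE.
  rewrite (dlB_bJ dt (deg_dlJ du da) db) (dlB_bJ dt da (deg_dlJ du db)).
  rewrite (dlB_bJ du (deg_dlJ dt da) db) (dlB_bJ du da (deg_dlJ dt db)).
  rewrite (dlJ_comm dt du da) (dlJ_comm dt du db) !bJE; lm4 i j p q.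
- rewrite (dlB_bM du da db) (dlB_bM dt da db) (dlB_bM dtu da db) !dBE.
  rewrite (dlB_bM dt (deg_dlM du da) db) (dlB_bM dt da (deg_dlM du db)).
  rewrite (dlB_bM du (deg_dlM dt da) db) (dlB_bM du da (deg_dlM dt db)).
  rewrite (dlM_comm dt du da) (dlM_comm dt du db) !bME; lm4 i j p q.
- by rewrite !dBE scaler0 addr0.
by rewrite !dBE hx hy; lm2 i j.
Qed.

(** Four instances of the cyclic relation, with a product of two of the four
    elements in one slot, turn one side into the other. *)
Lemma dlB_antiJJ p q k l a b c d : deg p a -> deg q b -> deg k c -> deg l d ->
  dlB (bJ a b) (bJ c d) = - (s (p (+) q) (k (+) l) *: dlB (bJ c d) (bJ a b)).
Proof.
move=> da db dc dd.
rewrite (dlB_bJ (deg_bJ da db) dc dd) (dlB_bJ (deg_bJ dc dd) da db).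
rewrite !(dlJ_bJ _ da db) !(dlJ_bJ _ dc dd) /angJ.
apply: (lcstep (c := - s p l) (bJ_cyc da (jE db dc) dd)).
apply: (lcstep (c := s p q * s q l) (bJ_cyc db (jE da dc) dd)).
apply: (lcstep (c := s k l * s p k) (bJ_cyc da (jE db dd) dc)).
apply: (lcstep (c := - (s p q * s k l * s q k)) (bJ_cyc db (jE da dd) dc)).
rewrite (jC dc db) (jC dc da) (jC dd da) (jC dd db) !(jbE, bJE).
rewrite (jC (jE db dc) dd) (jC (jE da dc) dd) (jC (jE da dd) dc) (jC (jE db dd) dc) !bJE.
rewrite (bJ_anti (jE db dd) (jE da dc)) (bJ_anti (jE db dc) (jE da dd)).
rewrite (bJ_anti dc (jE da (jE db dd))) (bJ_anti dc (jE db (jE da dd))).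
rewrite (bJ_anti da (jE dc (jE db dd))) (bJ_anti da (jE dd (jE db dc))).
lm4 p q k l.
Qed.

(** Four instances of the relation between [bM] and [bJ], in which [a] and [b] act
    one after the other. *)
Lemma dlB_antiJM p q k l a b m n : deg p a -> deg q b -> deg k m -> deg l n ->
  dlB (bJ a b) (bM m n) = - (s (p (+) q) (k (+) l) *: dlB (bM m n) (bJ a b)).
Proof.
move=> da db dm dn.
rewrite (dlB_bM (deg_bJ da db) dm dn) (dlB_bJ (deg_bM dm dn) da db).
rewrite !(dlM_bJ _ da db) !(dlJ_bM _ dm dn).
rewrite (parJhE n2 H _ _ _ _ da) (parJhE n2 H _ _ _ _ db) /angM /parJ !(bJE, bME).
apply: (lcstep (c := 4%:R^-1 * s p q) (bM_act db (aE da dm) dn)).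
apply: (lcstep (c := - (4%:R^-1 * s p k * s p q)) (bM_act db dm (aE da dn))).
apply: (lcstep (c := - 4%:R^-1) (bM_act da (aE db dm) dn)).
apply: (lcstep (c := 4%:R^-1 * s q k) (bM_act da dm (aE db dn))).
rewrite (bJ_anti da (sE (aE db dm) dn)) (bJ_anti da (sE dm (aE db dn))).
lm4 p q k l.
Qed.

(** On two classes [bM] this is literally the fifth relation, which is why it has
    to be imposed on B^s. *)
Lemma dlB_anti i j t u : deg i t -> deg j u -> dlB t u = - (s i j *: dlB u t).
Proof.
move=> dt du; elim/B_ind_deg: dt => {t} [p q a b da db <-|p q m n dm dn <-||l x y hx hy].
- elim/B_ind_deg: du => {u} [k l c d dc dd <-|k l c d dc dd <-||e x y hx hy].
  + exact: dlB_antiJJ.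
  + exact: dlB_antiJM.
  + by rewrite !dBE scaler0 oppr0.
  by rewrite !dBE hx hy; lm3 p q j.
- elim/B_ind_deg: du => {u} [k l c d dc dd <-|k l c d dc dd <-||e x y hx hy].
  + by rewrite (dlB_antiJM dc dd dm dn); lm4 p q k l.
  + rewrite (dlB_bM (deg_bM dm dn) dc dd) (dlB_bM (deg_bM dc dd) dm dn) !dlM_bM.
    apply: (lcstep (c := - 1) (bM_par dm dn dc dd)).
    lm4 p q k l.
  + by rewrite !dBE scaler0 oppr0.
  by rewrite !dBE hx hy; lm3 p q j.
- by rewrite !dBE scaler0 oppr0.
by rewrite !dBE hx hy; lm2 i j.
Qed.

Lemma Bs_inner_algebra : inner_algebra T bJ bM dlJ dlM dlB.
Proof.
split.
- exact: bJ_bilin.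
- exact: bM_bilin.
- exact: dlJ_bilin.
- exact: dlM_bilin.
- exact: dlB_bilin.
- by move=> *; apply: deg_bJ.
- by move=> *; apply: deg_bM.
- exact: deg_dlB.
- exact: bJ_anti.
- exact: bM_sym.
- exact: bJ_cyc.
- exact: bM_act.
- exact: dlJ_bJ.
- exact: dlJ_bM.
- exact: dlM_bJ.
- exact: dlM_bM.
- by move=> *; apply: dl_der.
- exact: dlB_bJ.
- exact: dlB_bM.
- exact: dlJ_comm.
- exact: dlM_comm.
- exact: dlB_comm.
- exact: dlB_anti.
Qed.
End InnerSuperalgebra.

(** * Coordinates on sl2, on V and on short modules *)

Section SL2Coordinates.
Variable K : fieldType.
Implicit Types (x y : sl2 K) (v w : 'cV[K]_2).
Local Notation e := (sl2_e K).
Local Notation f := (sl2_f K).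
Local Notation h := (sl2_h K).

Definition e1 : 'cV[K]_2 := delta_mx 0 0.
Definition e2 : 'cV[K]_2 := delta_mx 1 0.

Lemma sum2 (F : 'I_2 -> K) : \sum_i F i = F 0 + F 1.
Proof. by rewrite !big_ord_recl big_ord0 addr0; congr (_ + F _); apply: val_inj. Qed.

Lemma sl2_11 x : x 1 1 = - x 0 0.
Proof.
have := sl2_traceless x; rewrite unfold_in /mxtrace sum2 addrC.
by move=> /eqP/eqP; rewrite addr_eq0 => /eqP.
Qed.

Lemma I2_cases (P : 'I_2 -> Prop) : P 0 -> P 1 -> forall i, P i.
Proof.
by move=> h0 h1 [[|[|i]] hi] //; [move: h0|move: h1]; congr P; apply: val_inj.
Qed.

Lemma sl2_eq x y : x 0 1 = y 0 1 -> x 1 0 = y 1 0 -> x 0 0 = y 0 0 -> x = y.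
Proof.
move=> h01 h10 h00; apply: val_inj; apply/matrixP.
by apply: I2_cases; apply: I2_cases => //; rewrite !sl2_11 h00.
Qed.

Lemma V_eq v w : v 0 0 = w 0 0 -> v 1 0 = w 1 0 -> v = w.
Proof. by move=> h0 h1; apply/matrixP => i j; rewrite (ord1 j); exact: (I2_cases (P := fun i => v i 0 = w i 0)). Qed.

Lemma sl2_lin k x y i j : (k *: x + y) i j = k * x i j + y i j.
Proof. by rewrite /= !mxE. Qed.
Lemma sl2D x y i j : (x + y) i j = x i j + y i j. Proof. by rewrite /= !mxE. Qed.
Lemma sl2Z k x i j : (k *: x) i j = k * x i j. Proof. by rewrite /= !mxE. Qed.
Lemma sl2N x i j : (- x) i j = - x i j. Proof. by rewrite /= !mxE. Qed.

Lemma e_E : (e 0 1 = 1) * (e 1 0 = 0) * (e 0 0 = 0).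
Proof. by rewrite /= !mxE. Qed.
Lemma f_E : (f 0 1 = 0) * (f 1 0 = 1) * (f 0 0 = 0).
Proof. by rewrite /= !mxE. Qed.
Lemma h_E : (h 0 1 = 0) * (h 1 0 = 0) * (h 0 0 = 1).
Proof. by rewrite /= !mxE /= !subr0. Qed.
Lemma e1_E : (e1 0 0 = 1) * (e1 1 0 = 0). Proof. by rewrite !mxE. Qed.
Lemma e2_E : (e2 0 0 = 0) * (e2 1 0 = 1). Proof. by rewrite !mxE. Qed.

Lemma sl2_br00 x y : sl2_br x y 0 0 = x 0 1 * y 1 0 - x 1 0 * y 0 1.
Proof. by rewrite /= !mxE !sum2; ring. Qed.
Lemma sl2_br01 x y : sl2_br x y 0 1 = 2%:R * (x 0 0 * y 0 1 - x 0 1 * y 0 0).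
Proof. by rewrite /= !mxE !sum2 !sl2_11; ring. Qed.
Lemma sl2_br10 x y : sl2_br x y 1 0 = 2%:R * (x 1 0 * y 0 0 - x 0 0 * y 1 0).
Proof. by rewrite /= !mxE !sum2 !sl2_11; ring. Qed.
Definition sl2_brE := (sl2_br00, sl2_br01, sl2_br10).

Lemma sl2_act0 x v : (x *m v) 0 0 = x 0 0 * v 0 0 + x 0 1 * v 1 0.
Proof. by rewrite !mxE !sum2. Qed.
Lemma sl2_act1 x v : (x *m v) 1 0 = x 1 0 * v 0 0 - x 0 0 * v 1 0.
Proof. by rewrite !mxE !sum2 !sl2_11; ring. Qed.
Definition sl2_actE := (sl2_act0, sl2_act1).

Lemma kappaE x y : kappa x y = 4%:R * (2%:R * (x 0 0 * y 0 0) + x 0 1 * y 1 0 + x 1 0 * y 0 1).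
Proof. by rewrite /kappa /mxtrace sum2 !mxE !sum2 !sl2_11; ring. Qed.

Lemma VdetE v w : Vdet v w = v 0 0 * w 1 0 - v 1 0 * w 0 0.
Proof.
rewrite /Vdet (expand_det_col _ 0) sum2 /cofactor !det_mx11 !mxE /=.
have l0 : lift (0 : 'I_2) (0 : 'I_1) = 1 by apply: val_inj.
have l1 : lift (1 : 'I_2) (0 : 'I_1) = 0 by apply: val_inj.
rewrite l0 l1.
have s0 : split (0 : 'I_(1 + 1)) = inl 0 by case: splitP => // j hj; congr inl; rewrite (ord1 j).
have s1 : split (1 : 'I_(1 + 1)) = inr 0 by case: splitP => [j hj|j hj]; [rewrite (ord1 j) in hj|rewrite (ord1 j)].
rewrite s0 s1 /=; ring.
Qed.

Lemma odot01 v w : odot v w 0 1 = v 0 0 * w 0 0.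
Proof. by rewrite /= !mxE /=; ring. Qed.
Lemma odot10 v w : odot v w 1 0 = - (v 1 0 * w 1 0).
Proof. by rewrite /= !mxE /=; ring. Qed.
Lemma odot00 v w : odot v w 0 0 = - (2%:R^-1 * (v 0 0 * w 1 0 + v 1 0 * w 0 0)).
Proof. by rewrite /= !mxE /=; ring. Qed.
Definition odotE := (odot00, odot01, odot10).
End SL2Coordinates.

Section ShortSpaceCoordinates.
Variable K : fieldType.
Variables J M D : superspace K.
Local Notation S := (short_space J M D).
Local Notation e := (sl2_e K).
Local Notation f := (sl2_f K).
Local Notation h := (sl2_h K).
Local Notation e1 := (e1 K).
Local Notation e2 := (e2 K).

(** The three injections, known only through their specification: bilinearity
    must be applied to them as to abstract maps, not to the pairs they are. *)
Fact iJ_exists : { i : sl2 K -> J -> S | i = @inJ K J M D }.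
Proof. by exists (@inJ K J M D). Qed.
Definition iJ := sval iJ_exists.
Lemma iJ_def : iJ = @inJ K J M D. Proof. exact: (svalP iJ_exists). Qed.
Fact iM_exists : { i : 'cV[K]_2 -> M -> S | i = @inM K J M D }.
Proof. by exists (@inM K J M D). Qed.
Definition iM := sval iM_exists.
Lemma iM_def : iM = @inM K J M D. Proof. exact: (svalP iM_exists). Qed.
Fact iD_exists : { i : D -> S | i = @inD K J M D }.
Proof. by exists (@inD K J M D). Qed.
Definition iD := sval iD_exists.
Lemma iD_def : iD = @inD K J M D. Proof. exact: (svalP iD_exists). Qed.
Lemma inJ_bilin : bilin iJ.
Proof.
rewrite iJ_def.
have [tl tr] := @tens_bilin K (sl2 K) J.
by split=> c k x y; congr ((_, _), _); rewrite /= ?tl ?tr ?scaler0 ?addr0.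
Qed.
Lemma inM_bilin : bilin iM.
Proof.
rewrite iM_def.
have [tl tr] := @tens_bilin K 'cV[K]_2 M.
by split=> c k x y; congr ((_, _), _); rewrite /= ?tl ?tr ?scaler0 ?addr0.
Qed.
Lemma inD_linear : linear iD.
Proof. rewrite iD_def. by move=> k x y; congr (_, _); rewrite /= ?scaler0 ?addr0. Qed.

Lemma deg_inJ i x a : deg i a -> deg i (iJ x a).
Proof.
rewrite iJ_def => da; split; last exact: deg0; split; last exact: deg0.
exact: (@deg_tens K (even_space (sl2 K)) J false i x a I da).
Qed.
Lemma deg_inM i v m : deg i m -> deg i (iM v m).
Proof.
rewrite iM_def => da; split; last exact: deg0; split; first exact: deg0.
exact: (@deg_tens K (even_space 'cV[K]_2) M false i v m I da).
Qed.
Lemma deg_inD i d : deg i d -> deg i (iD d).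
Proof. rewrite iD_def => da; split => //; exact: deg0. Qed.

Lemma S_ind_deg (P : S -> Prop) i :
  (forall x a, deg i a -> P (iJ x a)) ->
  (forall v m, deg i m -> P (iM v m)) ->
  (forall d, deg i d -> P (iD d)) ->
  (forall k u v, P u -> P v -> P (k *: u + v)) -> forall u, deg i u -> P u.
Proof.
rewrite iJ_def iM_def iD_def => hJ hM hD hL [[t w] d] [[/= dt dw] dd].
have P0 : P 0 by apply: (hD 0); exact: deg0.
have PA u v : P u -> P v -> P (u + v) by move=> Pu Pv; rewrite -[u]scale1r; apply: (hL).
have -> : ((t, w), d) = ((t, 0), 0) + ((0, w), 0) + (0, d) :> S.
  by congr ((_, _), _); rewrite /= ?addr0 ?add0r.
apply: (PA); last exact: hD; apply: (PA).
- elim: dt => [z [j [k [u [v [du dv eq ->]]]]]||k u v _ hu _ hv] //.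
    case: j du eq => /= [->|_] eq; last by apply: (hJ); rewrite eq.
    by rewrite (_ : tens 0 v = 0) //; apply: bil0l; apply: tens_bilin.
  have -> : ((k *: u + v, 0), 0) = k *: ((u, 0), 0) + ((v, 0), 0) :> S.
    by congr ((_, _), _); rewrite /= scaler0 addr0.
  exact: hL.
- elim: dw => [z [j [k [u [v [du dv eq ->]]]]]||k u v _ hu _ hv] //.
    case: j du eq => /= [->|_] eq; last by apply: (hM); rewrite eq.
    by rewrite (_ : tens 0 v = 0) //; apply: bil0l; apply: tens_bilin.
  have -> : ((0, k *: u + v), 0) = k *: ((0, u), 0) + ((0, v), 0) :> S.
    by congr ((_, _), _); rewrite /= scaler0 addr0.
  exact: hL.
Qed.

Lemma S_ind (P : S -> Prop) :
  (forall x a, P (iJ x a)) ->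
  (forall v m, P (iM v m)) ->
  (forall d, P (iD d)) ->
  (forall k u v, P u -> P v -> P (k *: u + v)) -> forall u, P u.
Proof.
move=> hJ hM hD hL; apply: hom_ind => [i u|u v Pu Pv].
  by apply: S_ind_deg => *; [apply: hJ|apply: hM|apply: hD|apply: hL].
by rewrite -[u]scale1r; apply: hL.
Qed.

(** A linear form [phi] on the first factor contracts a tensor product to its
    second factor. *)
Fact crd_exists (U W : lmodType K) (phi : U -> K) :
  (forall k x y, phi (k *: x + y) = k * phi x + phi y) ->
  exists2 g : tensor U W -> W, linear g & forall x a, g (tens x a) = phi x *: a.
Proof.
move=> lphi; apply: tensor_lift; split=> [a k x y|x k a b].
  by rewrite lphi scalerDl scalerA.
by rewrite scalerDr !scalerA mulrC.
Qed.

Fact crdJ_exists i j :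
  exists2 g : tensor (sl2 K) J -> J, linear g & forall x a, g (tens x a) = x i j *: a.
Proof. by apply: crd_exists => k x y; rewrite sl2_lin. Qed.
Fact crdM_exists i :
  exists2 g : tensor 'cV[K]_2 M -> M, linear g & forall x a, g (tens x a) = x i 0 *: a.
Proof. by apply: crd_exists => k x y; rewrite !mxE. Qed.

(** The tensor factors sl2 and V have the bases e, f, h and e1, e2, so an element
    of a short space is given by three elements of J, two of M and one of D:
    its contractions with the matrix entries (0 1), (1 0), (0 0) and the vector
    entries 0, 1. Identities between elements are checked on them. *)
Definition cJ i j (u : S) : J := projT1 (cid2 (crdJ_exists i j)) u.1.1.
Definition cM i (u : S) : M := projT1 (cid2 (crdM_exists i)) u.1.2.
Definition cD (u : S) : D := locked (snd u).

Lemma cJ_linear i j : linear (cJ i j).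
Proof. by rewrite /cJ; case: cid2 => g /= lg _ k x y; rewrite /= lg. Qed.
Lemma cM_linear i : linear (cM i).
Proof. by rewrite /cM; case: cid2 => g /= lg _ k x y; rewrite /= lg. Qed.
Lemma cD_linear : linear cD. Proof. by rewrite /cD; unlock. Qed.

Lemma cJ_inJ i j x a : cJ i j (iJ x a) = x i j *: a.
Proof. by rewrite iJ_def /cJ; case: cid2 => g /= _ ->. Qed.
Lemma cJ_inM i j v m : cJ i j (iM v m) = 0.
Proof. by rewrite iM_def /cJ; case: cid2 => g /= lg _; rewrite (lin0 lg). Qed.
Lemma cJ_inD i j d : cJ i j (iD d) = 0.
Proof. by rewrite iD_def /cJ; case: cid2 => g /= lg _; rewrite (lin0 lg). Qed.
Lemma cM_inJ i x a : cM i (iJ x a) = 0.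
Proof. by rewrite iJ_def /cM; case: cid2 => g /= lg _; rewrite (lin0 lg). Qed.
Lemma cM_inM i v m : cM i (iM v m) = v i 0 *: m.
Proof. by rewrite iM_def /cM; case: cid2 => g /= _ ->. Qed.
Lemma cM_inD i d : cM i (iD d) = 0.
Proof. by rewrite iD_def /cM; case: cid2 => g /= lg _; rewrite (lin0 lg). Qed.
Lemma cD_inJ x a : cD (iJ x a) = 0. Proof. by rewrite iJ_def /cD; unlock. Qed.
Lemma cD_inM v m : cD (iM v m) = 0. Proof. by rewrite iM_def /cD; unlock. Qed.
Lemma cD_inD d : cD (iD d) = d. Proof. by rewrite iD_def /cD; unlock. Qed.
Definition crdE := (cJ_inJ, cJ_inM, cJ_inD, cM_inJ, cM_inM, cM_inD, cD_inJ, cD_inM, cD_inD).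

Lemma cJE i j : (forall u v, cJ i j (u + v) = cJ i j u + cJ i j v) *
  (forall u, cJ i j (- u) = - cJ i j u) * (forall k u, cJ i j (k *: u) = k *: cJ i j u).
Proof. by split; [split|] => *; [apply: linD|apply: linN|apply: linZ]; apply: cJ_linear. Qed.
Lemma cME i : (forall u v, cM i (u + v) = cM i u + cM i v) *
  (forall u, cM i (- u) = - cM i u) * (forall k u, cM i (k *: u) = k *: cM i u).
Proof. by split; [split|] => *; [apply: linD|apply: linN|apply: linZ]; apply: cM_linear. Qed.
Lemma cDE : (forall u v, cD (u + v) = cD u + cD v) *
  (forall u, cD (- u) = - cD u) * (forall k u, cD (k *: u) = k *: cD u).
Proof. by rewrite /cD; unlock. Qed.
Definition crd_linE := (cJE, cME, cDE).

(** Locked, so that rewriting with bilinearity stops at the coordinates. *)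
Definition of_coords a b c m n d : S :=
  locked (iJ e a + iJ f b + iJ h c
  + iM e1 m + iM e2 n + iD d).
Lemma of_coordsE a b c m n d : of_coords a b c m n d =
  iJ e a + iJ f b + iJ h c
  + iM e1 m + iM e2 n + iD d.
Proof. by rewrite /of_coords -lock. Qed.

Let JE := bilE inJ_bilin.
Let ME := bilE inM_bilin.
Let DE := linE inD_linear.

Hypothesis n2 : 2%:R != 0 :> K.

Lemma of_coords_linear k a b c m n d a' b' c' m' n' d' :
  of_coords (k *: a + a') (k *: b + b') (k *: c + c') (k *: m + m') (k *: n + n') (k *: d + d')
  = k *: of_coords a b c m n d + of_coords a' b' c' m' n' d'.
Proof. rewrite !of_coordsE !JE !ME !DE; lm0. Qed.

Lemma crdK u : of_coords (cJ 0 1 u) (cJ 1 0 u) (cJ 0 0 u) (cM 0 u) (cM 1 u) (cD u) = u.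
Proof.
elim/S_ind: u => [x a|v m|d|k u v hu hv].
- rewrite !crdE !of_coordsE !JE !ME !DE !addr0 -!(bilZl inJ_bilin) -!(bilDl inJ_bilin).
  congr (iJ _ a).
  by apply: sl2_eq; rewrite !sl2D !sl2Z !(e_E, f_E, h_E); ring.
- rewrite !crdE !of_coordsE !JE !ME !DE !addr0 !add0r -!(bilZl inM_bilin) -!(bilDl inM_bilin).
  congr (iM _ m).
  by apply: V_eq; rewrite !mxE /=; ring.
- by rewrite !crdE !of_coordsE !JE !ME !add0r.
by rewrite !cJ_linear !cM_linear cD_linear of_coords_linear hu hv.
Qed.

Lemma S_eq u v : cJ 0 1 u = cJ 0 1 v -> cJ 1 0 u = cJ 1 0 v -> cJ 0 0 u = cJ 0 0 v ->
  cM 0 u = cM 0 v -> cM 1 u = cM 1 v -> cD u = cD v -> u = v.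
Proof.
by move=> h1 h2 h3 h4 h5 h6; rewrite -[u]crdK -[v]crdK h1 h2 h3 h4 h5 h6.
Qed.

Lemma crd_of_coords a b c m n d :
  (cJ 0 1 (of_coords a b c m n d) = a) * (cJ 1 0 (of_coords a b c m n d) = b) 
  * (cJ 0 0 (of_coords a b c m n d) = c)
  * (cM 0 (of_coords a b c m n d) = m) * (cM 1 (of_coords a b c m n d) = n)
  * (cD (of_coords a b c m n d) = d).
Proof.
by do !split; rewrite !of_coordsE !crd_linE !crdE ?(e_E, f_E, h_E, e1_E, e2_E)
  ?scaler0 ?scale0r ?scale1r ?addr0 ?add0r.
Qed.

(** The action of sl2 on the first tensor factors, in coordinates. *)
Definition tact (x : sl2 K) (u : S) : S :=
  of_coords (2%:R *: (x 0 0 *: cJ 0 1 u - x 0 1 *: cJ 0 0 u))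
     (2%:R *: (x 1 0 *: cJ 0 0 u - x 0 0 *: cJ 1 0 u))
     (x 0 1 *: cJ 1 0 u - x 1 0 *: cJ 0 1 u)
     (x 0 0 *: cM 0 u + x 0 1 *: cM 1 u)
     (x 1 0 *: cM 0 u - x 0 0 *: cM 1 u) 0.

Lemma tact_inJ x y a : tact x (iJ y a) = iJ (sl2_br x y) a.
Proof.
by apply: S_eq; rewrite /tact !crd_of_coords !crdE ?sl2_brE //; lm0.
Qed.
Lemma tact_inM x v m : tact x (iM v m) = iM (x *m v) m.
Proof.
by apply: S_eq; rewrite /tact !crd_of_coords !crdE ?sl2_actE //; lm0.
Qed.
Lemma tact_inD x d : tact x (iD d) = 0.
Proof.
by apply: S_eq; rewrite /tact !crd_of_coords ?crdE ?(lin0 (cJ_linear _ _)) ?(lin0 (cM_linear _))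
  ?(lin0 cD_linear) //; lm0.
Qed.
Lemma tact_bilin : bilin tact.
Proof.
by split=> [u k x y|x k u v]; apply: S_eq; rewrite /tact !crd_linE !crd_of_coords;
   rewrite ?cJ_linear ?cM_linear ?sl2_lin; lm0.
Qed.
Lemma tact_even x : even_map (tact x).
Proof.
move=> i u; elim/S_ind_deg => {u} [y a da|v m dm|d dd|k u v hu hv].
- by rewrite tact_inJ; apply: deg_inJ.
- by rewrite tact_inM; apply: deg_inM.
- by rewrite tact_inD; apply: deg0.
by rewrite tact_bilin.2; apply: deg_lin.
Qed.
Lemma tact_rep x y u : tact (sl2_br x y) u = tact x (tact y u) - tact y (tact x u).
Proof.
by apply: S_eq; rewrite /tact !(crd_of_coords, crd_linE) ?sl2_brE; lm0.
Qed.

Lemma tact_short : is_short_module tact.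
Proof.
exists J, M, D, id; split; split=> //; rewrite -?iJ_def -?iM_def -?iD_def; first by exists id.
- exact: tact_inJ.
- exact: tact_inM.
- exact: tact_inD.
Qed.
End ShortSpaceCoordinates.

(** * The short Lie superalgebra TAG *)

Section TagAlgebra.
Variable K : fieldType.
Hypothesis n2 : 2%:R != 0 :> K.

Variables (J M : superspace K) (T : ternary_ops J M) (H : is_ternary T).
Local Notation "a ** b" := (jmul T a b) (at level 40, left associativity).
Local Notation "a @@ m" := (jact T a m) (at level 38, right associativity).
Local Notation "m \star n" := (star T m n) (at level 40, left associativity).
Local Notation s := (sg K).
Let HJ := ternary_jordan H.
Let HS := ternary_special H.
Let jE := jmul_even HJ.
Let aE := jact_even HS.
Let sE := star_even H.

Let jbE := bilE (jmul_bilin HJ).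
Let abE := bilE (jact_bilin HS).
Let sbE := bilE (star_bilin H).
Variables (B : superspace K) (bJ : J -> J -> B) (bM : M -> M -> B).
Variables (dlJ : B -> J -> J) (dlM : B -> M -> M) (dlB : B -> B -> B).
Hypothesis IA : inner_algebra T bJ bM dlJ dlM dlB.
Let bJ_bilin := ia_bJ_bilin IA.
Let bM_bilin := ia_bM_bilin IA.
Let dlJ_bilin := ia_dlJ_bilin IA.
Let dlM_bilin := ia_dlM_bilin IA.
Let dlB_bilin := ia_dlB_bilin IA.
Let deg_bJ := ia_deg_bJ IA.
Let deg_bM := ia_deg_bM IA.
Let deg_dlB := ia_deg_dlB IA.
Let bJ_anti := ia_bJ_anti IA.
Let bM_sym := ia_bM_sym IA.
Let bJ_cyc := ia_bJ_cyc IA.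
Let bM_act := ia_bM_act IA.
Let dlJ_bJ := ia_dlJ_bJ IA.
Let dlJ_bM := ia_dlJ_bM IA.
Let dlM_bJ := ia_dlM_bJ IA.
Let dlM_bM := ia_dlM_bM IA.
Let dl_der := ia_dl_der IA.
Let dlB_bJ := ia_dlB_bJ IA.
Let dlB_bM := ia_dlB_bM IA.
Let dlJ_comm := ia_dlJ_comm IA.
Let dlM_comm := ia_dlM_comm IA.
Let dlB_comm := ia_dlB_comm IA.
Let dlB_anti := ia_dlB_anti IA.
Let deg_dlJ i k t a : deg i t -> deg k a -> deg (i (+) k) (dlJ t a).
Proof. by move=> /dl_der/sd_degJ; apply. Qed.
Let deg_dlM i k t a : deg i t -> deg k a -> deg (i (+) k) (dlM t a).
Proof. by move=> /dl_der/sd_degM; apply. Qed.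
Let bJE := bilE bJ_bilin.
Let bME := bilE bM_bilin.
Let dJE := bilE dlJ_bilin.
Let dME := bilE dlM_bilin.
Let dBE := bilE dlB_bilin.
Let jC i j (a b : J) : deg i a -> deg j b -> a ** b = s i j *: (b ** a).
Proof. exact: (jmul_comm HJ). Qed.
Local Notation S := (short_space J M B).
Local Notation inJ := (@iJ K J M B).
Local Notation inM := (@iM K J M B).
Local Notation inD := (@iD K J M B).
Let iJE := bilE (inJ_bilin J M B).
Let iME := bilE (inM_bilin J M B).
Let iDE := linE (@inD_linear K J M B).
Implicit Types (x y z : sl2 K) (v w : 'cV[K]_2).

(** The action of J on M and the actions of [B], written from the right; the
    Koszul sign makes the parities of both arguments part of the definition. *)
Definition ra := hext2 (fun p q (m : M) (a : J) => s p q *: (a @@ m)).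
Definition rJ := hext2 (fun p q (a : J) (t : B) => s p q *: dlJ t a).
Definition rM := hext2 (fun p q (m : M) (t : B) => s p q *: dlM t m).

Let ra_fb p q : bilin (fun (m : M) (a : J) => s p q *: (a @@ m)).
Proof. by split=> ? k u w; rewrite !abE; lm0. Qed.
Let rJ_fb p q : bilin (fun (a : J) (t : B) => s p q *: dlJ t a).
Proof. by split=> ? k u w; rewrite !dJE; lm0. Qed.
Let rM_fb p q : bilin (fun (a : M) (t : B) => s p q *: dlM t a).
Proof. by split=> ? k u w; rewrite !dME; lm0. Qed.
Let ra_b : bilin ra. Proof. exact: hext2_bilin ra_fb. Qed.
Let rJ_b : bilin rJ. Proof. exact: hext2_bilin rJ_fb. Qed.
Let rM_b : bilin rM. Proof. exact: hext2_bilin rM_fb. Qed.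
Let raE := bilE ra_b.
Let rJE := bilE rJ_b.
Let rME := bilE rM_b.
Let raH p q m a : deg p m -> deg q a -> ra m a = s p q *: (a @@ m).
Proof. exact: hext2E. Qed.
Let rJH p q a t : deg p a -> deg q t -> rJ a t = s p q *: dlJ t a.
Proof. exact: hext2E. Qed.
Let rMH p q m t : deg p m -> deg q t -> rM m t = s p q *: dlM t m.
Proof. exact: hext2E. Qed.

(** These values determine the bracket; the last three are forced by the others and
    superantisymmetry. *)
Record tag_bracket (br : S -> S -> S) : Prop := {
  tag_bilin : bilin br;
  tag_JJ : forall x y a b, br (inJ x a) (inJ y b)
    = inJ (sl2_br x y) (a ** b) + inD ((2%:R^-1 * kappa x y) *: bJ a b);
  tag_JM : forall x v a m, br (inJ x a) (inM v m) = inM (x *m v) (a @@ m);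
  tag_MM : forall v w m n, br (inM v m) (inM w n)
    = inJ (odot v w) (m \star n) + inD (Vdet v w *: bM m n);
  tag_DJ : forall t x a, br (inD t) (inJ x a) = inJ x (dlJ t a);
  tag_DM : forall t v m, br (inD t) (inM v m) = inM v (dlM t m);
  tag_DD : forall t u, br (inD t) (inD u) = inD (dlB t u);
  tag_MJ : forall p q v x m a, deg p m -> deg q a ->
    br (inM v m) (inJ x a) = - (s p q *: inM (x *m v) (a @@ m));
  tag_JD : forall p q t x a, deg p a -> deg q t ->
    br (inJ x a) (inD t) = - (s p q *: inJ x (dlJ t a));
  tag_MD : forall p q t v m, deg p m -> deg q t ->
    br (inM v m) (inD t) = - (s p q *: inM v (dlM t m))
}.

(** The bracket is given by its six coordinates, each a bilinear expression in the
    coordinates of the arguments; so bilinearity is immediate and the values on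
    generators are found by comparing coordinates. *)
Fact tbr_exists : { br : S -> S -> S | tag_bracket br }.
Proof.
pose bE (u v : S) := 2%:R *: (cJ 0 0 u ** cJ 0 1 v - cJ 0 1 u ** cJ 0 0 v)
   + cM 0 u \star cM 0 v + dlJ (cD u) (cJ 0 1 v) - rJ (cJ 0 1 u) (cD v).
pose bF (u v : S) := 2%:R *: (cJ 1 0 u ** cJ 0 0 v - cJ 0 0 u ** cJ 1 0 v)
   - cM 1 u \star cM 1 v + dlJ (cD u) (cJ 1 0 v) - rJ (cJ 1 0 u) (cD v).
pose bH (u v : S) := cJ 0 1 u ** cJ 1 0 v - cJ 1 0 u ** cJ 0 1 v
   - 2%:R^-1 *: (cM 0 u \star cM 1 v + cM 1 u \star cM 0 v)
   + dlJ (cD u) (cJ 0 0 v) - rJ (cJ 0 0 u) (cD v).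
pose b1 (u v : S) := cJ 0 0 u @@ cM 0 v + cJ 0 1 u @@ cM 1 v + dlM (cD u) (cM 0 v)
   - (ra (cM 0 u) (cJ 0 0 v) + ra (cM 1 u) (cJ 0 1 v)) - rM (cM 0 u) (cD v).
pose b2 (u v : S) := cJ 1 0 u @@ cM 0 v - cJ 0 0 u @@ cM 1 v + dlM (cD u) (cM 1 v)
   - (ra (cM 0 u) (cJ 1 0 v) - ra (cM 1 u) (cJ 0 0 v)) - rM (cM 1 u) (cD v).
pose bD (u v : S) := 2%:R *: bJ (cJ 0 1 u) (cJ 1 0 v) + 2%:R *: bJ (cJ 1 0 u) (cJ 0 1 v)
   + 4%:R *: bJ (cJ 0 0 u) (cJ 0 0 v)
   + bM (cM 0 u) (cM 1 v) - bM (cM 1 u) (cM 0 v) + dlB (cD u) (cD v).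
have bEb : bilin bE.
  by split=> u k v w; rewrite /bE !cJ_linear !cM_linear !cD_linear !jbE !sbE !dJE !rJE; lm0.
have bFb : bilin bF.
  by split=> u k v w; rewrite /bF !cJ_linear !cM_linear !cD_linear !jbE !sbE !dJE !rJE; lm0.
have bHb : bilin bH.
  by split=> u k v w; rewrite /bH !cJ_linear !cM_linear !cD_linear !jbE !sbE !dJE !rJE; lm0.
have b1b : bilin b1.
  by split=> u k v w; rewrite /b1 !cJ_linear !cM_linear !cD_linear !abE !dME !raE !rME; lm0.
have b2b : bilin b2.
  by split=> u k v w; rewrite /b2 !cJ_linear !cM_linear !cD_linear !abE !dME !raE !rME; lm0.
have bDb : bilin bD.
  by split=> u k v w; rewrite /bD !cJ_linear !cM_linear !cD_linear !bJE !bME !dBE; lm0.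
pose br (u v : S) := of_coords (bE u v) (bF u v) (bH u v) (b1 u v) (b2 u v) (bD u v).
exists br; split.
- split=> u k v w; first by rewrite /br bEb.1 bFb.1 bHb.1 b1b.1 b2b.1 bDb.1; exact: of_coords_linear.
  by rewrite /br bEb.2 bFb.2 bHb.2 b1b.2 b2b.2 bDb.2; exact: of_coords_linear.
- move=> x y a b; apply: S_eq => //; rewrite /br ?crd_linE !crd_of_coords
    /bE /bF /bH /b1 /b2 /bD !crdE
    ?jbE ?sbE ?abE ?dJE ?dME ?dBE ?raE ?rJE ?rME ?bJE ?bME ?sl2_brE ?kappaE; lm0.
- move=> x v a m; apply: S_eq => //; rewrite /br ?crd_linE !crd_of_coords
    /bE /bF /bH /b1 /b2 /bD !crdE
    ?jbE ?sbE ?abE ?dJE ?dME ?dBE ?raE ?rJE ?rME ?bJE ?bME ?sl2_actE; lm0.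
- move=> x v a m; apply: S_eq => //; rewrite /br ?crd_linE !crd_of_coords
    /bE /bF /bH /b1 /b2 /bD !crdE
    ?jbE ?sbE ?abE ?dJE ?dME ?dBE ?raE ?rJE ?rME ?bJE ?bME ?odotE ?VdetE; lm0.
- move=> t x a; apply: S_eq => //; rewrite /br ?crd_linE !crd_of_coords
    /bE /bF /bH /b1 /b2 /bD !crdE
    ?jbE ?sbE ?abE ?dJE ?dME ?dBE ?raE ?rJE ?rME ?bJE ?bME; lm0.
- move=> t v m; apply: S_eq => //; rewrite /br ?crd_linE !crd_of_coords
    /bE /bF /bH /b1 /b2 /bD !crdE
    ?jbE ?sbE ?abE ?dJE ?dME ?dBE ?raE ?rJE ?rME ?bJE ?bME; lm0.
- move=> t u; apply: S_eq => //; rewrite /br ?crd_linE !crd_of_coords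
    /bE /bF /bH /b1 /b2 /bD !crdE
    ?jbE ?sbE ?abE ?dJE ?dME ?dBE ?raE ?rJE ?rME ?bJE ?bME; lm0.
- move=> p q v x m a dm da; apply: S_eq => //; rewrite /br ?crd_linE !crd_of_coords
    /bE /bF /bH /b1 /b2 /bD !crdE
    ?jbE ?sbE ?abE ?dJE ?dME ?dBE ?raE ?rJE ?rME ?bJE ?bME
    ?(raH dm da) ?sl2_actE; lm0.
- move=> p q t x a da dt; apply: S_eq => //; rewrite /br ?crd_linE !crd_of_coords
    /bE /bF /bH /b1 /b2 /bD !crdE
    ?jbE ?sbE ?abE ?dJE ?dME ?dBE ?raE ?rJE ?rME ?bJE ?bME ?(rJH da dt); lm0.
- move=> p q t x a da dt; apply: S_eq => //; rewrite /br ?crd_linE !crd_of_coords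
    /bE /bF /bH /b1 /b2 /bD !crdE
    ?jbE ?sbE ?abE ?dJE ?dME ?dBE ?raE ?rJE ?rME ?bJE ?bME ?(rMH da dt); lm0.
Qed.
Definition tbr : S -> S -> S := sval tbr_exists.
Lemma tbrP : tag_bracket tbr.
Proof. exact: svalP. Qed.
Let P := tbrP.
Let tbr_bilin := tag_bilin P.
Let tbr_JJ := tag_JJ P.
Let tbr_JM := tag_JM P.
Let tbr_MM := tag_MM P.
Let tbr_DJ := tag_DJ P.
Let tbr_DM := tag_DM P.
Let tbr_DD := tag_DD P.
Let tbr_MJ := tag_MJ P.
Let tbr_JD := tag_JD P.
Let tbr_MD := tag_MD P.
Let tE := bilE tbr_bilin.

Lemma tbr_even : even_map2 tbr.
Proof.
move=> i j u v; elim/S_ind_deg => {u} [x a da|w m dm|t dt|k u u' hu hu'] dv; last first.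
- by rewrite tbr_bilin.1; apply: deg_lin; [apply: hu|apply: hu'].
- elim/S_ind_deg: dv => {v} [y b db|w n dn|t' dt'|k u u' hu hu']; last first.
  + by rewrite tbr_bilin.2; apply: deg_lin.
  + by rewrite tbr_DD; apply: deg_inD; apply: deg_dlB.
  + by rewrite tbr_DM; apply: deg_inM; apply: deg_dlM.
  + by rewrite tbr_DJ; apply: deg_inJ; apply: deg_dlJ.
- elim/S_ind_deg: dv => {v} [y b db|w' n dn|t' dt'|k u u' hu hu']; last first.
  + by rewrite tbr_bilin.2; apply: deg_lin.
  + rewrite (tbr_MD _ dm dt') addbC; apply: degN; apply: degZ.
    by apply: deg_inM; apply: deg_dlM.
  + rewrite tbr_MM; apply: degD; first by apply: deg_inJ; apply: sE.
    by apply: deg_inD; apply: degZ; apply: deg_bM.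
  + rewrite (tbr_MJ _ _ dm db) addbC; apply: degN; apply: degZ.
    by apply: deg_inM; apply: aE.
- elim/S_ind_deg: dv => {v} [y b db|w' n dn|t' dt'|k u u' hu hu']; last first.
  + by rewrite tbr_bilin.2; apply: deg_lin.
  + rewrite (tbr_JD _ da dt') addbC; apply: degN; apply: degZ.
    by apply: deg_inJ; apply: deg_dlJ.
  + by rewrite tbr_JM; apply: deg_inM; apply: aE.
  + rewrite tbr_JJ; apply: degD; first by apply: deg_inJ; apply: jE.
    by apply: deg_inD; apply: degZ; apply: deg_bJ.
Qed.

Lemma tbr_anti i j (u v : S) : deg i u -> deg j v -> tbr u v = - (s i j *: tbr v u).
Proof.
elim/S_ind_deg => {u} [x a da|w m dm|t dt|k u u' hu hu'] dv; last first.
- by rewrite !tE (hu dv) (hu' dv); lm2 i j.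
- elim/S_ind_deg: dv => {v} [y b db|w n dn|t' dt'|k u u' hu hu']; last first.
  + by rewrite !tE hu hu'; lm2 i j.
  + by rewrite !tbr_DD (dlB_anti dt dt') !iDE; lm2 i j.
  + by rewrite tbr_DM (tbr_MD _ dn dt); lm2 i j.
  + by rewrite tbr_DJ (tbr_JD _ db dt); lm2 i j.
- elim/S_ind_deg: dv => {v} [y b db|w' n dn|t' dt'|k u u' hu hu']; last first.
  + by rewrite !tE hu hu'; lm2 i j.
  + by rewrite tbr_DM (tbr_MD _ dm dt'); lm2 i j.
  + rewrite !tbr_MM (star_anti H dm dn) (bM_sym dm dn).
    by apply: (S_eq n2); rewrite ?crd_linE ?crdE ?odotE ?VdetE; lm2 i j.
  + by rewrite tbr_JM (tbr_MJ _ _ dm db); lm2 i j.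
- elim/S_ind_deg: dv => {v} [y b db|w' n dn|t' dt'|k u u' hu hu']; last first.
  + by rewrite !tE hu hu'; lm2 i j.
  + by rewrite tbr_DJ (tbr_JD _ da dt'); lm2 i j.
  + by rewrite tbr_JM (tbr_MJ _ _ dn da); lm2 i j.
  + rewrite !tbr_JJ (jC da db) (bJ_anti da db).
    by apply: (S_eq n2); rewrite ?crd_linE ?crdE ?sl2_brE ?kappaE; lm2 i j.
Qed.

(** The Jacobi identity is invariant under the permutations of its arguments, by
    superantisymmetry; so only ten of the twenty-seven cases on generators have to
    be computed. *)
Definition Jac i j (u v w : S) := tbr u (tbr v w) = tbr (tbr u v) w + s i j *: tbr v (tbr u w).

Lemma Jac12 i j (u v w : S) : deg i u -> deg j v -> Jac i j u v w -> Jac j i v u w.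
Proof.
move=> du dv; rewrite /Jac (tbr_anti du dv) !tE => ->.
lm2 i j.
Qed.
Lemma Jac23 i j k (u v w : S) : deg i u -> deg j v -> deg k w -> Jac i j u v w -> Jac i k u w v.
Proof.
move=> du dv dw; rewrite /Jac (tbr_anti dw dv) !tE => ->.
rewrite (tbr_anti (tbr_even du dw) dv) (tbr_anti dw (tbr_even du dv)).
lm3 i j k.
Qed.

(** With an inner derivation as first argument, the identity says that it acts on
    the rest of the algebra as a superderivation. *)
Lemma Jac_DJJ i j k t x y a b : deg i t -> deg j a -> deg k b ->
  Jac i j (inD t) (inJ x a) (inJ y b).
Proof.
move=> dt da db; rewrite /Jac !tbr_JJ !tE !tbr_DJ !tbr_DD !tbr_JJ.
rewrite (sd_jmul (dl_der dt) da db) !dBE (dlB_bJ dt da db).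
rewrite !(iJE, iDE); lm3 i j k.
Qed.
Lemma Jac_DJM i j k t x v a m : deg i t -> deg j a -> deg k m ->
  Jac i j (inD t) (inJ x a) (inM v m).
Proof.
move=> dt da dm; rewrite /Jac !tbr_JM tbr_DJ !tbr_DM !tbr_JM.
rewrite (sd_jact (dl_der dt) da dm) !iME; lm3 i j k.
Qed.
Lemma Jac_DMM i j k t v w m n : deg i t -> deg j m -> deg k n ->
  Jac i j (inD t) (inM v m) (inM w n).
Proof.
move=> dt dm dn; rewrite /Jac !tbr_MM !tE !tbr_DM tbr_DJ tbr_DD !tbr_MM.
rewrite (sd_star (dl_der dt) dm dn) !dBE (dlB_bM dt dm dn).
rewrite !(iJE, iDE); lm3 i j k.
Qed.
Lemma Jac_DDJ i j k t u x a : deg i t -> deg j u -> deg k a ->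
  Jac i j (inD t) (inD u) (inJ x a).
Proof.
move=> dt du da; rewrite /Jac !tbr_DJ tbr_DD !tbr_DJ (dlJ_comm dt du da) !iJE; lm3 i j k.
Qed.
Lemma Jac_DDM i j k t u v m : deg i t -> deg j u -> deg k m ->
  Jac i j (inD t) (inD u) (inM v m).
Proof.
move=> dt du da; rewrite /Jac !tbr_DM tbr_DD !tbr_DM (dlM_comm dt du da) !iME; lm3 i j k.
Qed.
Lemma Jac_DDD i j k (t u w : B) : deg i t -> deg j u -> deg k w ->
  Jac i j (inD t) (inD u) (inD w).
Proof.
move=> dt du dw; rewrite /Jac !tbr_DD (dlB_comm dt du dw) !iDE; lm3 i j k.
Qed.

(** The component in sl2 (x) J is the definition of <a,b>; the component in [B] is
    the cyclic relation, multiplied by the invariant trilinear form kappa(x, [y, z]). *)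
Lemma Jac_JJJ i j k x y z a b c : deg i a -> deg j b -> deg k c ->
  Jac i j (inJ x a) (inJ y b) (inJ z c).
Proof.
move=> da db dc; rewrite /Jac !tbr_JJ !tE !tbr_JJ !iDE !tE !tbr_DJ.
rewrite (tbr_JD _ da (deg_bJ db dc)) (tbr_JD _ db (deg_bJ da dc)).
rewrite (dlJ_bJ _ db dc) (dlJ_bJ _ da dc) (dlJ_bJ _ da db) /angJ.
rewrite (jC dc da) (jC dc db) (jC db da) !jbE (jC (jE da db) dc).
rewrite (bJ_anti da (jE db dc)) (bJ_anti db (jE da dc)).
apply: (S_eq n2); last first.
  rewrite !crd_linE !crdE.
  apply: (lcstep (c := 2%:R^-1 * kappa x (sl2_br y z) * s i k) (bJ_cyc da db dc)).
  rewrite (jC dc da) !bJE !kappaE !sl2_brE; lm3 i j k.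
all: rewrite !crd_linE !crdE !kappaE !sl2_brE; lm3 i j k.
Qed.

(** The supercommutator of [a @@ -] and [b @@ -] is 4 <a,b> and their
    anticommutator is twice the product: this is the decomposition of the product
    of two matrices of sl2 into commutator and trace. *)
Lemma Jac_JJM i j k x y v a b m : deg i a -> deg j b -> deg k m ->
  Jac i j (inJ x a) (inJ y b) (inM v m).
Proof.
move=> da db dm; rewrite /Jac !tbr_JM tbr_JJ !tE !tbr_JM !iDE !tE !tbr_DM.
rewrite (dlM_bJ _ da db) /angM (jact_special HS _ da db).
apply: (S_eq n2).
all: rewrite !crd_linE !crdE ?kappaE ?sl2_brE ?sl2_actE ?sl2_brE; lm3 i j k.
Qed.

(** The component in sl2 (x) J combines SJT1 and the definition of par_{m,n} on J;
    the component in [B] is the relation [ia_bM_act] with coefficient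
    [Vdet (x *m v) w]. *)
Lemma Jac_JMM i j k x v w a m n : deg i a -> deg j m -> deg k n ->
  Jac i j (inJ x a) (inM v m) (inM w n).
Proof.
move=> da dm dn; rewrite /Jac !tbr_JM !tbr_MM !tE tbr_JJ !iDE !tE.
rewrite (tbr_JD _ da (deg_bM dm dn)) (dlJ_bM _ dm dn) (parJhE n2 H _ _ _ _ da) /parJ.
rewrite (SJT1 H da dm dn) (bJ_anti da (sE dm dn)).
apply: (S_eq n2); last first.
  rewrite !crd_linE !crdE.
  apply: (lcstep (c := Vdet (x *m v) w) (bM_act da dm dn)).
  rewrite !kappaE !VdetE !odotE !sl2_actE; lmf3 i j k.
all: rewrite !crd_linE !crdE ?sl2_brE ?odotE ?VdetE ?sl2_actE; lmf3 i j k.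
Qed.

(** SJT3 and SJT4 reduce all products of [m], [n], [r] to a few triple products;
    their coefficients then agree by identities between [odot] and the determinant
    on V. *)
Lemma Jac_MMM i j k v w (z : 'cV[K]_2) m n r : deg i m -> deg j n -> deg k r ->
  Jac i j (inM v m) (inM w n) (inM z r).
Proof.
move=> dm dn dr; rewrite /Jac !tbr_MM !tE !iDE !tE tbr_JM tbr_DM.
rewrite (tbr_MJ _ _ dm (sE dn dr)) (tbr_MJ _ _ dn (sE dm dr)).
rewrite (tbr_MD _ dm (deg_bM dn dr)) (tbr_MD _ dn (deg_bM dm dr)) !dlM_bM /parM.
rewrite (star_act H dm dn dr) (star_act H dn dr dm) (star_act H dm dr dn).
rewrite (SJT3 H dm dn dr) (SJT3 H dn dm dr) (star_act H dm dr dn) (star_act H dn dr dm).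
apply: (S_eq n2).
all: rewrite !crd_linE !crdE ?sl2_actE ?odotE ?VdetE; lmf3 i j k.
Qed.

(** All orders of the generators are brought to those above. *)
Lemma Jac_hom i j k (u v w : S) : deg i u -> deg j v -> deg k w -> Jac i j u v w.
Proof.
have LJ1 c u1 u2 (v' w' : S) : Jac i j u1 v' w' -> Jac i j u2 v' w' -> Jac i j (c *: u1 + u2) v' w'.
  by rewrite /Jac !tE => -> ->; lm2 i j.
have LJ2 c u1 u2 (v' w' : S) : Jac i j v' u1 w' -> Jac i j v' u2 w' -> Jac i j v' (c *: u1 + u2) w'.
  by rewrite /Jac !tE => -> ->; lm2 i j.
have LJ3 c u1 u2 (v' w' : S) : Jac i j v' w' u1 -> Jac i j v' w' u2 -> Jac i j v' w' (c *: u1 + u2).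
  by rewrite /Jac !tE => -> ->; lm2 i j.
move=> du dv dw.
elim/S_ind_deg: du => {u} [x a da|x a da|a da|c u u']; [| | |exact: LJ1].
- elim/S_ind_deg: dv => {v} [y b db|y b db|b db|c u u']; [| | |exact: LJ2].
  + elim/S_ind_deg: dw => {w} [z c dc|z c dc|c dc|e u u']; [| | |exact: LJ3].
    * exact: Jac_JJJ da db dc.
    * exact: Jac_JJM da db dc.
    apply: (Jac23 (deg_inJ _ _ _ da) (deg_inD _ _ dc) (deg_inJ _ _ _ db)).
    apply: (Jac12 (deg_inD _ _ dc) (deg_inJ _ _ _ da)); exact: Jac_DJJ dc da db.
  + elim/S_ind_deg: dw => {w} [z c dc|z c dc|c dc|e u u']; [| | |exact: LJ3].
    * apply: (Jac23 (deg_inJ _ _ _ da) (deg_inJ _ _ _ dc) (deg_inM _ _ _ db)).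
      exact: Jac_JJM da dc db.
    * exact: Jac_JMM da db dc.
    apply: (Jac23 (deg_inJ _ _ _ da) (deg_inD _ _ dc) (deg_inM _ _ _ db)).
    apply: (Jac12 (deg_inD _ _ dc) (deg_inJ _ _ _ da)); exact: Jac_DJM dc da db.
  elim/S_ind_deg: dw => {w} [z c dc|z c dc|c dc|e u u']; [| | |exact: LJ3].
  + apply: (Jac12 (deg_inD _ _ db) (deg_inJ _ _ _ da)); exact: Jac_DJJ db da dc.
  + apply: (Jac12 (deg_inD _ _ db) (deg_inJ _ _ _ da)); exact: Jac_DJM db da dc.
  apply: (Jac12 (deg_inD _ _ db) (deg_inJ _ _ _ da)).
  apply: (Jac23 (deg_inD _ _ db) (deg_inD _ _ dc) (deg_inJ _ _ _ da)); exact: Jac_DDJ db dc da.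
- elim/S_ind_deg: dv => {v} [y b db|y b db|b db|c u u']; [| | |exact: LJ2].
  + apply: (Jac12 (deg_inJ _ _ _ db) (deg_inM _ _ _ da)).
    elim/S_ind_deg: dw => {w} [z c dc|z c dc|c dc|e u u']; last first.
    * by move=> h1 h2; apply: (Jac12 (deg_inM _ _ _ da) (deg_inJ _ _ _ db)); apply: LJ3;
        [apply: (Jac12 (deg_inJ _ _ _ db) (deg_inM _ _ _ da) h1)
        |apply: (Jac12 (deg_inJ _ _ _ db) (deg_inM _ _ _ da) h2)].
    * apply: (Jac23 (deg_inJ _ _ _ db) (deg_inD _ _ dc) (deg_inM _ _ _ da)).
      apply: (Jac12 (deg_inD _ _ dc) (deg_inJ _ _ _ db)); exact: Jac_DJM dc db da.
    * exact: Jac_JMM db da dc.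
    apply: (Jac23 (deg_inJ _ _ _ db) (deg_inJ _ _ _ dc) (deg_inM _ _ _ da)).
    exact: Jac_JJM db dc da.
  + elim/S_ind_deg: dw => {w} [z c dc|z c dc|c dc|e u u']; [| | |exact: LJ3].
    * apply: (Jac23 (deg_inM _ _ _ da) (deg_inJ _ _ _ dc) (deg_inM _ _ _ db)).
      apply: (Jac12 (deg_inJ _ _ _ dc) (deg_inM _ _ _ da)); exact: Jac_JMM dc da db.
    * exact: Jac_MMM da db dc.
    apply: (Jac23 (deg_inM _ _ _ da) (deg_inD _ _ dc) (deg_inM _ _ _ db)).
    apply: (Jac12 (deg_inD _ _ dc) (deg_inM _ _ _ da)); exact: Jac_DMM dc da db.
  apply: (Jac12 (deg_inD _ _ db) (deg_inM _ _ _ da)).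
  elim/S_ind_deg: dw => {w} [z c dc|z c dc|c dc|e u u']; last first.
  + by move=> h1 h2; apply: (Jac12 (deg_inM _ _ _ da) (deg_inD _ _ db)); apply: LJ3;
      [apply: (Jac12 (deg_inD _ _ db) (deg_inM _ _ _ da) h1)
      |apply: (Jac12 (deg_inD _ _ db) (deg_inM _ _ _ da) h2)].
  + apply: (Jac23 (deg_inD _ _ db) (deg_inD _ _ dc) (deg_inM _ _ _ da)); exact: Jac_DDM db dc da.
  + exact: Jac_DMM db da dc.
  apply: (Jac23 (deg_inD _ _ db) (deg_inJ _ _ _ dc) (deg_inM _ _ _ da)); exact: Jac_DJM db dc da.
elim/S_ind_deg: dv => {v} [y b db|y b db|b db|c u u']; [| | |exact: LJ2].
- elim/S_ind_deg: dw => {w} [z c dc|z c dc|c dc|e u u']; [| | |exact: LJ3].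
  + exact: Jac_DJJ da db dc.
  + exact: Jac_DJM da db dc.
  apply: (Jac23 (deg_inD _ _ da) (deg_inD _ _ dc) (deg_inJ _ _ _ db)); exact: Jac_DDJ da dc db.
- elim/S_ind_deg: dw => {w} [z c dc|z c dc|c dc|e u u']; [| | |exact: LJ3].
  + apply: (Jac23 (deg_inD _ _ da) (deg_inJ _ _ _ dc) (deg_inM _ _ _ db)); exact: Jac_DJM da dc db.
  + exact: Jac_DMM da db dc.
  apply: (Jac23 (deg_inD _ _ da) (deg_inD _ _ dc) (deg_inM _ _ _ db)); exact: Jac_DDM da dc db.
elim/S_ind_deg: dw => {w} [z c dc|z c dc|c dc|e u u']; [| | |exact: LJ3].
- exact: Jac_DDJ da db dc.
- exact: Jac_DDM da db dc.
exact: Jac_DDD da db dc.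
Qed.

Lemma tbr_lie : is_lie_superalgebra tbr.
Proof.
split; first exact: tbr_bilin.
- exact: tbr_even.
- exact: tbr_anti.
move=> i j u v w du dv; elim/hom_ind: w => [k w dw|w w' hw hw']; first exact: Jac_hom du dv dw.
by rewrite !tE hw hw'; lm2 i j.
Qed.

(** The bracket is built from sl2-equivariant maps: the commutator, kappa, the
    natural action, [odot] and the determinant. *)
Lemma tact_der z (u v : S) : tact z (tbr u v) = tbr (tact z u) v + tbr u (tact z v).
Proof.
have cE := bilE (tact_bilin J M B n2).
elim/hom_ind: u => [i u du|u u' hu hu']; last by rewrite !(tE, cE) hu hu'; lm0.
elim/hom_ind: v => [j v dv|v v' hv hv']; last by rewrite !(tE, cE) hv hv'; lm0.
elim/S_ind_deg: du => {u} [x a da|x a da|a da|c u u' hu hu']; last first.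
- by rewrite !(tE, cE) hu hu'; lm0.
- elim/S_ind_deg: dv => {v} [y b db|y b db|b db|c u u' hu hu']; last first.
  + by rewrite !(tE, cE) hu hu'; lm0.
  + by rewrite tbr_DD !tact_inD // !tE addr0.
  + by rewrite tbr_DM tact_inD // !tact_inM // tbr_DM !tE add0r.
  + by rewrite tbr_DJ tact_inD // !tact_inJ // tbr_DJ !tE add0r.
- elim/S_ind_deg: dv => {v} [y b db|y b db|b db|c u u' hu hu']; last first.
  + by rewrite !(tE, cE) hu hu'; lm0.
  + by rewrite tact_inD // !tact_inM // !(tbr_MD _ da db) !tE addr0 !cE !tact_inM.
  + rewrite !tact_inM // !tbr_MM !cE tact_inJ // tact_inD //.
    by apply: (S_eq n2); rewrite !crd_linE !crdE ?sl2_brE ?odotE ?VdetE ?sl2_actE ?(lin0 (cJ_linear _ _))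
     ?(lin0 (cM_linear _)) ?(lin0 (cD_linear (D:=_))); lmf3 i j i.
  + rewrite !tact_inM // tact_inJ // !(tbr_MJ _ _ da db) !cE tact_inM //.
    by apply: (S_eq n2); rewrite !crd_linE !crdE ?sl2_actE ?sl2_brE; lm2 i j.
- elim/S_ind_deg: dv => {v} [y b db|y b db|b db|c u u' hu hu']; last first.
  + by rewrite !(tE, cE) hu hu'; lm0.
  + by rewrite tact_inD // !tact_inJ // !(tbr_JD _ da db) !tE addr0 !cE !tact_inJ.
  + rewrite !tact_inM // !tact_inJ // !tbr_JM tact_inM //.
    by apply: (S_eq n2); rewrite !crd_linE !crdE ?sl2_actE ?sl2_brE; lm2 i j.
  + rewrite !tact_inJ // !tbr_JJ !cE tact_inJ // tact_inD //.
    by apply: (S_eq n2); rewrite !crd_linE !crdE ?sl2_brE ?kappaE ?sl2_brE ?(lin0 (cJ_linear _ _))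
     ?(lin0 (cM_linear _)) ?(lin0 (cD_linear (D:=_))); lm2 i j.
Qed.

Definition tag_ops : lie_ops S := LieOps tbr (@tact K J M B).

Lemma tag_short : is_short tag_ops.
Proof.
split; [exact: tbr_lie| |exact: tact_short].
split; [exact: tact_bilin|exact: tact_rep|exact: tact_even|exact: tact_der].
Qed.
End TagAlgebra.

Section TagObject.
Variable K : fieldType.
Hypothesis n2 : 2%:R != 0 :> K.
Variable X : ternary_superalgebra K.
Let H := tax X.
Let IA := Bs_inner_algebra n2 H.
Local Notation B := (Bs (tax X)).
Let L : lie_ops (TAG_space X) := tag_ops n2 H IA.
Let P := tbrP n2 H IA.
Let DE := linE (@inD_linear K (tJs X) (tMs X) B).
Let sJ x a : TAG_J x a = @iJ K (tJs X) (tMs X) B x a. Proof. by rewrite iJ_def. Qed.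
Let sM v m : TAG_M v m = @iM K (tJs X) (tMs X) B v m. Proof. by rewrite iM_def. Qed.
Let sBJ a b : TAG_B (@tJ K (tJs X) (tMs X) a b) = @iD K (tJs X) (tMs X) B (bJ H a b).
Proof. by rewrite iD_def. Qed.
Let sBM m n : TAG_B (@tM K (tJs X) (tMs X) m n) = @iD K (tJs X) (tMs X) B (bM H m n).
Proof. by rewrite iD_def. Qed.

Let LE : lbr L = tbr n2 H IA. Proof. by []. Qed.
Local Notation bJ := (bJ H).
Local Notation bM := (bM H).
Let bJE := bilE (bJ_bilin H).
Let bME := bilE (bM_bilin H).
Let dBE := bilE (dlB_bilin n2 H).

Let dlB_bJr t i p a b : deg i t -> deg p a ->
  dlB n2 t (bJ a b) = bJ (dlJ n2 t a) b + sg K i p *: bJ a (dlJ n2 t b).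
Proof.
move=> dt da; elim/hom_ind: b => [q b db|b b' hb hb']; first exact: (dlB_bJ n2 dt da db).
by rewrite !bJE !dBE hb hb' (linD ((dlJ_bilin n2 H).2 t)) !bJE scalerDr addrACA.
Qed.
Let dlB_bMr t i p a b : deg i t -> deg p a ->
  dlB n2 t (bM a b) = bM (dlM n2 t a) b + sg K i p *: bM a (dlM n2 t b).
Proof.
move=> dt da; elim/hom_ind: b => [q b db|b b' hb hb']; first exact: (dlB_bM n2 dt da db).
by rewrite !bME !dBE hb hb' (linD ((dlM_bilin n2 H).2 t)) !bME scalerDr addrACA.
Qed.
Let sgE (i j k : bool) : (-1) ^+ ((i + j) * k) = sg K (i (+) j) k.
Proof. by rewrite mulnDl exprD sgDl. Qed.

Definition tag_object : TAG_object X.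
Proof.
apply: (@TAGObject _ X L).
- exact: tag_short.
- by move=> x y a; rewrite !sJ; apply: tact_inJ.
- by move=> x v m; rewrite !sM; apply: tact_inM.
- by move=> x t; rewrite /TAG_B -/(@inD K (tJs X) (tMs X) B _) -iD_def; apply: tact_inD.
- by move=> x y a b; rewrite LE !sJ sBJ (tag_JJ P) !DE.
- by move=> x v a m; rewrite LE !sJ !sM (tag_JM P).
- by move=> v w m n; rewrite LE !sJ !sM sBM (tag_MM P) !DE.
- by move=> p q a b x c da db; rewrite LE !sJ !sBJ (tag_DJ P) (ia_dlJ_bJ IA _ da db).
- by move=> p q a b v c da db; rewrite LE !sM !sBJ (tag_DM P) (ia_dlM_bJ IA _ da db).
- move=> i j k m n x c dm dn dc; rewrite LE !sJ !sBM (tag_DJ P) (ia_dlJ_bM IA _ dm dn).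
  by rewrite (parJhE n2 H _ _ _ _ dc).
- by move=> m n v r; rewrite LE !sM !sBM (tag_DM P) (ia_dlM_bM IA).
- move=> p q i a b c d da db dc; rewrite LE !sBJ (tag_DD P) -!DE sgE.
  by rewrite (dlB_bJr _ (deg_bJ H da db) dc) !(dlJ_bJ n2 H _ da db).
- move=> p q i a b c d da db dc; rewrite LE !sBJ !sBM (tag_DD P) -!DE sgE.
  by rewrite (dlB_bMr _ (deg_bJ H da db) dc) !(dlM_bJ n2 H _ da db).
- move=> i j p q m n c d dm dn dc dd; rewrite LE !sBJ !sBM (tag_DD P) -!DE sgE.
  rewrite (dlB_bJr _ (deg_bM H dm dn) dc) !(dlJ_bM n2 H _ dm dn).
  by rewrite (parJhE n2 H _ _ _ _ dc) (parJhE n2 H _ _ _ _ dd).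
- move=> i j k m n r t dm dn dr; rewrite LE !sBM (tag_DD P) -!DE sgE.
  by rewrite (dlB_bMr _ (deg_bM H dm dn) dr) !dlM_bM.
Defined.
End TagObject.

(** * Weights in a short Lie superalgebra *)

Section ShortAlgebras.
Variable K : fieldType.
Hypothesis char0 : forall n : nat, n.+1%:R != 0 :> K.
Let n2 : 2%:R != 0 :> K := char0 1.
Variable g : short_lie_superalgebra K.
Local Notation s := (sg K).
Local Notation br := (lbr (sh_ops g)).
Local Notation act := (lact (sh_ops g)).
Local Notation E := (lact (sh_ops g) (sl2_e K)).
Local Notation F := (lact (sh_ops g) (sl2_f K)).
Local Notation Hh := (lact (sh_ops g) (sl2_h K)).

Let HL := short_lie (sh_ax g).
Let HA := short_act (sh_ax g).
Let bE := bilE (lie_bilin HL).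
Let AE := bilE (act_bilin HA).
Let br_even := lie_even HL.
Let FE := linE ((act_bilin HA).2 (sl2_f K)).
Let dF i x : deg i x -> deg i (F x). Proof. exact: act_even. Qed.
Let an i j x y : deg i x -> deg j y -> br x y = - (s i j *: br y x).
Proof. exact: (lie_anti HL). Qed.
Let jac i j x y z : deg i x -> deg j y ->
  br x (br y z) = br (br x y) z + s i j *: br y (br x z).
Proof. exact: (lie_jacobi HL). Qed.
Let jac' i j x y z : deg i x -> deg j y ->
  br (br x y) z = br x (br y z) - s i j *: br y (br x z).
Proof. by move=> dx dy; rewrite (jac z dx dy) addrK. Qed.

Definition wt (k : K) (x : g) := Hh x = k *: x.

(** The eigenvalues of h on sl2, V and the trivial module are 0, 1, -1, 2 and -2,
    so h is annihilated by t (t^2 - 1) (t^2 - 4) = t^5 - 5 t^3 + 4 t. *)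
Lemma h_minpoly (x : g) :
  Hh (Hh (Hh (Hh (Hh x)))) = 5%:R *: Hh (Hh (Hh x)) - 4%:R *: Hh x.
Proof.
have [J [M [D [phi [[lphi [psi _ psiK] _] [pJ pM pD]]]]]] := short_module (sh_ax g).
have hphi u : Hh (phi u) = phi (tact (sl2_h K) u).
  elim/S_ind: u => [y a|v m|d|k u v hu hv].
  - by rewrite tact_inJ // iJ_def pJ.
  - by rewrite tact_inM // iM_def pM.
  - by rewrite tact_inD // iD_def pD (lin0 lphi).
  by rewrite lphi !AE hu hv !(bilE (tact_bilin _ _ _ n2)) lphi.
rewrite -[x]psiK !hphi -!(linZ lphi) -(linN lphi) -(linD lphi); congr phi.
move: (psi x) => u.
have t01 w : cJ 0 1 (tact (sl2_h K) w) = 2%:R *: cJ 0 1 w :> J.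
  by rewrite /tact !crd_of_coords !h_E; lm0.
have t10 w : cJ 1 0 (tact (sl2_h K) w) = - (2%:R *: cJ 1 0 w) :> J.
  by rewrite /tact !crd_of_coords !h_E; lm0.
have t00 w : cJ 0 0 (tact (sl2_h K) w) = 0 :> J by rewrite /tact !crd_of_coords !h_E; lm0.
have t0 w : cM 0 (tact (sl2_h K) w) = cM 0 w :> M by rewrite /tact !crd_of_coords !h_E; lm0.
have t1 w : cM 1 (tact (sl2_h K) w) = - cM 1 w :> M by rewrite /tact !crd_of_coords !h_E; lm0.
have tD w : cD (tact (sl2_h K) w) = 0 :> D by rewrite /tact !crd_of_coords.
by apply: (S_eq n2); rewrite !crd_linE ?t01 ?t10 ?t00 ?t0 ?t1 ?tD; lm0.
Qed.

Lemma wt_out k x : k ^+ 5 - 5%:R * k ^+ 3 + 4%:R * k != 0 -> wt k x -> x = 0.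
Proof.
move=> nz hx; have := h_minpoly x; rewrite !(hx, AE) => e.
apply: (scalerI nz); rewrite scaler0.
apply: (lcstep (c := - 1) e); lm0.
Qed.

Lemma wt_cast k l x : k = l -> wt k x -> wt l x. Proof. by move->. Qed.
(** The weights that can be reached from 1 and 2 by brackets and by the actions
    of e and f, but do not occur. *)
Lemma wt3_eq0 x : wt 3%:R x -> x = 0.
Proof.
by apply: wt_out; rewrite (_ : _ + _ = 120%:R); [exact: char0|ring].
Qed.
Lemma wt4_eq0 x : wt 4%:R x -> x = 0.
Proof.
by apply: wt_out; rewrite (_ : _ + _ = 720%:R); [exact: char0|ring].
Qed.
Lemma wtN3_eq0 x : wt (- 3%:R) x -> x = 0.
Proof.
by apply: wt_out; rewrite (_ : _ + _ = - 120%:R); [rewrite oppr_eq0; exact: char0|ring].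
Qed.
Lemma wtN4_eq0 x : wt (- 4%:R) x -> x = 0.
Proof.
by apply: wt_out; rewrite (_ : _ + _ = - 720%:R); [rewrite oppr_eq0; exact: char0|ring].
Qed.

Lemma wtB k l x y : wt k x -> wt l y -> wt (k + l) (br x y).
Proof.
by rewrite /wt => hx hy; rewrite (act_der HA) hx hy !bE scalerDl.
Qed.
Lemma br_hf : sl2_br (sl2_h K) (sl2_f K) = - (2%:R) *: sl2_f K.
Proof. by apply: sl2_eq; rewrite ?sl2_brE !sl2Z !(h_E, f_E); ring. Qed.
Lemma br_he : sl2_br (sl2_h K) (sl2_e K) = 2%:R *: sl2_e K.
Proof. by apply: sl2_eq; rewrite ?sl2_brE !sl2Z !(h_E, e_E); ring. Qed.
Lemma br_ef : sl2_br (sl2_e K) (sl2_f K) = sl2_h K.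
Proof. by apply: sl2_eq; rewrite ?sl2_brE !(h_E, e_E, f_E); ring. Qed.

Lemma wtF k x : wt k x -> wt (k - 2%:R) (F x).
Proof.
rewrite /wt => hx; have := act_rep HA (sl2_h K) (sl2_f K) x.
by rewrite br_hf hx !AE => e; apply: (lcstep (c := 1) e); lm0.
Qed.
Lemma wtE k x : wt k x -> wt (k + 2%:R) (E x).
Proof.
rewrite /wt => hx; have := act_rep HA (sl2_h K) (sl2_e K) x.
by rewrite br_he hx !AE => e; apply: (lcstep (c := 1) e); lm0.
Qed.
Lemma EF x : E (F x) = Hh x + F (E x).
Proof. by rewrite -br_ef (act_rep HA) subrK. Qed.
Lemma Fbr x y : F (br x y) = br (F x) y + br x (F y). Proof. exact: act_der. Qed.
Lemma Ebr x y : E (br x y) = br (E x) y + br x (E y). Proof. exact: act_der. Qed.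

(** A vector of weight 0 killed by e is sl2-invariant: f x has weight -2, so
    f (f x) = 0, and e (f (f x)) = h (f x) is a nonzero multiple of f x. *)
Lemma inv_F x : Hh x = 0 -> E x = 0 -> F x = 0.
Proof.
move=> h0 e0; have w0 : wt 0 x by rewrite /wt scale0r.
have wF := wtF w0; have : F (F x) = 0.
  by apply: wtN4_eq0; apply: wt_cast (wtF wF); ring.
move=> FF0; have := EF (F x); rewrite FF0 EF h0 e0 !AE ?addr0 wF sub0r.
by move=> /esym/eqP; rewrite scaleNr oppr_eq0 scaler_eq0 (negbTE n2) => /eqP.
Qed.
(** ** Highest weight vectors

    In this part [a], [b], [c], [d] have weight 2 and [m], [n], [r], [t] weight 1.
    The vectors F a and F m stand for a tensored with -h and for m tensored with
    e2; the product of J is half of [a, F b]. *)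
Fact pJ_exists : { f : g -> g -> g | forall a b, f a b = 2%:R^-1 *: br a (F b) }.
Proof. by exists (fun a b => 2%:R^-1 *: br a (F b)). Qed.
Definition pJ := sval pJ_exists.
Lemma pJE a b : pJ a b = 2%:R^-1 *: br a (F b). Proof. exact: (svalP pJ_exists). Qed.

Section Wt.
Variables (a b c d m n r t : g).
Hypotheses (wa : wt 2%:R a) (wb : wt 2%:R b) (wc : wt 2%:R c) (wd : wt 2%:R d).
Hypotheses (wm : wt 1 m) (wn : wt 1 n) (wr : wt 1 r) (wtt : wt 1 t).

Lemma wt_pJ : wt 2%:R (pJ a b).
Proof.
have : wt 2%:R (br a (F b)) by apply: wt_cast (wtB wa (wtF wb)); ring.
by rewrite pJE /wt AE => ->; rewrite !scalerA mulrC.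
Qed.
Lemma wt_A : wt 1 (br a (F m)).
Proof. by apply: wt_cast (wtB wa (wtF wm)); ring. Qed.
Lemma wt_S : wt 2%:R (br m n).
Proof. by apply: wt_cast (wtB wm wn); ring. Qed.
Lemma wt_T : wt 1 (br (br m (F n)) r).
Proof. by apply: wt_cast (wtB (wtB wm (wtF wn)) wr); ring. Qed.

Lemma br_aa : br a b = 0.
Proof. by apply: wt4_eq0; apply: wt_cast (wtB wa wb); ring. Qed.
Lemma br_am : br a m = 0.
Proof. by apply: wt3_eq0; apply: wt_cast (wtB wa wm); ring. Qed.
Lemma br_ma : br m a = 0.
Proof. by apply: wt3_eq0; apply: wt_cast (wtB wm wa); ring. Qed.
Lemma E_a : E a = 0. Proof. by apply: wt4_eq0; apply: wt_cast (wtE wa); ring. Qed.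
Lemma E_m : E m = 0. Proof. by apply: wt3_eq0; apply: wt_cast (wtE wm); ring. Qed.
Lemma FFm : F (F m) = 0.
Proof. by apply: wtN3_eq0; apply: wt_cast (wtF (wtF wm)); ring. Qed.
Lemma FFFa : F (F (F a)) = 0.
Proof. by apply: wtN4_eq0; apply: wt_cast (wtF (wtF (wtF wa))); ring. Qed.
Lemma EFa : E (F a) = 2%:R *: a. Proof. by rewrite EF E_a FE addr0. Qed.
Lemma EFm : E (F m) = m. Proof. by rewrite EF E_m FE addr0 wm scale1r. Qed.

End Wt.

(** The next lemmas apply F once or twice to a bracket that vanishes for reasons
    of weight. *)
Lemma F_mFn m n : wt 1 n -> F (br m (F n)) = br (F m) (F n).
Proof. by move=> wn; rewrite Fbr (FFm wn) bE addr0. Qed.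
Lemma Fa_b a b : wt 2%:R a -> wt 2%:R b -> br (F a) b = - br a (F b).
Proof. by move=> wa wb; apply/eqP; rewrite -addr_eq0 -Fbr br_aa // FE. Qed.
Lemma Fa_m a m : wt 2%:R a -> wt 1 m -> br (F a) m = - br a (F m).
Proof. by move=> wa wm; apply/eqP; rewrite -addr_eq0 -Fbr br_am // FE. Qed.
Lemma F_aFm a m : wt 1 m -> F (br a (F m)) = br (F a) (F m).
Proof. by move=> wm; rewrite Fbr (FFm wm) bE addr0. Qed.
Lemma FF_ab a b : wt 2%:R a -> wt 2%:R b ->
  br (F (F a)) b = - (2%:R *: br (F a) (F b)) - br a (F (F b)).
Proof.
move=> wa wb; have /(congr1 F) := Fa_b wa wb; rewrite FE !Fbr => e.
by apply: (lcstep (c := -1) e); lm0.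
Qed.
Lemma FF_am a m : wt 2%:R a -> wt 1 m -> br (F (F a)) m = - (2%:R *: br (F a) (F m)).
Proof.
move=> wa wm; have /(congr1 F) := Fa_m wa wm; rewrite FE !Fbr (FFm wm) bE => e.
by apply: (lcstep (c := -1) e); lm0.
Qed.
(** The brackets [F a, F b] have weight 0 and are killed by E, hence invariant;
    they are 4 times the elements of g that represent the classes [bJ a b]. *)
Lemma F_q a b : wt 2%:R a -> wt 2%:R b -> F (br (F a) (F b)) = 0.
Proof.
move=> wa wb; apply: inv_F.
  have : wt 0 (br (F a) (F b)) by apply: wt_cast (wtB (wtF wa) (wtF wb)); ring.
  by rewrite /wt scale0r.
by rewrite Ebr !EFa // !bE Fa_b //; lm0.
Qed.
Lemma FFa_Fb a b : wt 2%:R a -> wt 2%:R b -> br (F (F a)) (F b) = - br (F a) (F (F b)).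
Proof. by move=> wa wb; apply/eqP; rewrite -addr_eq0 -Fbr F_q. Qed.

Lemma pJ_F a b : wt 2%:R a -> wt 2%:R b -> br (F a) b = - (2%:R *: pJ a b).
Proof. by move=> wa wb; rewrite Fa_b // pJE; lm0. Qed.
Lemma pJ_r a b : br a (F b) = 2%:R *: pJ a b.
Proof. by rewrite pJE; lm0. Qed.

Lemma pJ_bilin : bilin pJ.
Proof. by split=> u k v w; rewrite !pJE ?AE !bE; lm0. Qed.
Let pE := bilE pJ_bilin.

Lemma pJ_comm p q a b : deg p a -> deg q b -> wt 2%:R a -> wt 2%:R b ->
  pJ a b = s p q *: pJ b a.
Proof.
move=> da db wa wb; have := pJ_F wa wb; rewrite (an (dF da) db) (pJ_r b a) => e.
by apply: (lcstep (c := - 2%:R^-1) e); lm2 p q.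
Qed.

Lemma pJ_special p q a b m : deg p a -> deg q b -> wt 2%:R a -> wt 2%:R b -> wt 1 m ->
  br (pJ a b) (F m) = 2%:R^-1 *: (br a (F (br b (F m))) + s p q *: br b (F (br a (F m)))).
Proof.
move=> da db wa wb wm; rewrite !F_aFm // (jac _ da (dF db)) (pJ_r a b) !bE.
rewrite (Fa_m wb (wt_A wa wm)) F_aFm //; lm2 p q.
Qed.

(** Together with [F a, F b], the product determines all brackets between the
    two copies of sl2 spanned by [a], F a, F F a and by [b], F b, F F b. *)
Lemma br_aFFb a b : wt 2%:R a -> wt 2%:R b ->
  br a (F (F b)) = 2%:R *: F (pJ a b) - br (F a) (F b).
Proof. by move=> wa wb; rewrite -FE -pJ_r Fbr addrAC subrr add0r. Qed.
Lemma br_FFab a b : wt 2%:R a -> wt 2%:R b ->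
  br (F (F a)) b = - (2%:R *: F (pJ a b)) - br (F a) (F b).
Proof. by move=> wa wb; rewrite FF_ab // br_aFFb //; lm0. Qed.
Lemma br_FFaFb a b : wt 2%:R a -> wt 2%:R b ->
  br (F (F a)) (F b) = - (2%:R *: F (F (pJ a b))).
Proof.
move=> wa wb; have := pJ_r a b => /(congr1 F)/(congr1 F).
rewrite !FE !Fbr !FE !Fbr FFFa // bE addr0 (FFa_Fb wa wb) => e.
by apply: (lcstep (c := 1) e); lm0.
Qed.

Lemma q_adF a b c : wt 2%:R a -> wt 2%:R b ->
  br (br (F a) (F b)) (F c) = F (br (br (F a) (F b)) c).
Proof. by move=> wa wb; rewrite Fbr F_q // bE add0r. Qed.

(** The invariant [F a, F b] acts on weight 2 as 4 <a,b>. *)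
Lemma q_ad p q a b c : deg p a -> deg q b -> wt 2%:R a -> wt 2%:R b -> wt 2%:R c ->
  br (br (F a) (F b)) c = 4%:R *: (pJ a (pJ b c) - s p q *: pJ b (pJ a c)).
Proof.
move=> da db wa wb wc; rewrite (jac' _ (dF da) (dF db)) (pJ_F wb wc) (pJ_F wa wc) !bE.
by rewrite (pJ_F wa (wt_pJ wb wc)) (pJ_F wb (wt_pJ wa wc)); lm2 p q.
Qed.

Lemma q_mul p q k a b c : deg p a -> deg q b -> deg k c ->
  wt 2%:R a -> wt 2%:R b -> wt 2%:R c ->
  br (F (pJ a b)) (F c) = br (F a) (F (pJ b c)) + s p q *: br (F b) (F (pJ a c)).
Proof.
move=> da db dc wa wb wc.
have e1 : 2%:R *: F (pJ a b) = br (F a) (F b) + br a (F (F b)) by rewrite br_aFFb //; lm0.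
have : br (2%:R *: F (pJ a b)) (F c) = br (br (F a) (F b) + br a (F (F b))) (F c) by rewrite e1.
rewrite !bE q_adF // (q_ad da db) // (jac' _ da (dF (dF db))) br_FFaFb // (pJ_r a c) !(FE, bE).
rewrite (br_aFFb wa (wt_pJ wb wc)) (br_FFab wb (wt_pJ wa wc)) => e.
by apply: (lcstep (c := - 2%:R^-1) e); lm2 p q.
Qed.

Lemma deg_pJ p q a b : deg p a -> deg q b -> deg (p (+) q) (pJ a b).
Proof. move=> da db; rewrite pJE; apply: degZ; exact: br_even da (dF db). Qed.

(** The cyclic relation holds among the invariants of g: by the Jacobi identity
    and [br_aFFb] the invariant formed with a product is a sum of two others. *)
Lemma q_cyc p q k a b c : deg p a -> deg q b -> deg k c ->
  wt 2%:R a -> wt 2%:R b -> wt 2%:R c ->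
  s p k *: br (F (pJ a b)) (F c) + s p q *: br (F (pJ b c)) (F a)
  + s q k *: br (F (pJ c a)) (F b) = 0.
Proof.
move=> da db dc wa wb wc; rewrite (q_mul da db dc) //.
rewrite (an (dF da) (dF (deg_pJ db dc))) (an (dF db) (dF (deg_pJ da dc))) (pJ_comm dc da) //.
rewrite !(FE, bE); lm3 p q k.
Qed.

(** Apply the cyclic sum of invariants, which is zero, to [c] and expand with
    [q_ad]. *)
Lemma pJ_jordan p q k l a b c d : deg p a -> deg q b -> deg k c -> deg l d ->
  wt 2%:R a -> wt 2%:R b -> wt 2%:R c -> wt 2%:R d ->
  pJ (pJ a b) (pJ c d) + s q k *: pJ (pJ a c) (pJ b d)
    + s (q (+) k) l *: pJ (pJ a d) (pJ b c)
  = pJ (pJ (pJ a b) c) d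
    + (s q k * s q l * s k l) *: pJ (pJ (pJ a d) c) b
    + (s p q * s p k * s p l * s k l) *: pJ (pJ (pJ b d) c) a.
Proof.
move=> da db dc dd wa wb wc wd.
have wJ := wt_pJ; have dJ := deg_pJ.
have /(congr1 (fun x => br x c)) := q_cyc da db dd wa wb wd.
rewrite !bE.
rewrite (q_ad (dJ _ _ _ _ da db) dd (wJ _ _ wa wb) wd wc).
rewrite (q_ad (dJ _ _ _ _ db dd) da (wJ _ _ wb wd) wa wc).
rewrite (q_ad (dJ _ _ _ _ dd da) db (wJ _ _ wd wa) wb wc) => e.
apply: (lcstep (c := - (4%:R^-1 * s p l * s k l)) e).
rewrite (pJ_comm dd dc wd wc) (pJ_comm dd da wd wa) !pE.
rewrite (pJ_comm dd (dJ _ _ _ _ (dJ _ _ _ _ da db) dc) wd (wJ _ _ (wJ _ _ wa wb) wc)).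
rewrite (pJ_comm da (dJ _ _ _ _ (dJ _ _ _ _ db dd) dc) wa (wJ _ _ (wJ _ _ wb wd) wc)).
rewrite (pJ_comm db (dJ _ _ _ _ (dJ _ _ _ _ da dd) dc) wb (wJ _ _ (wJ _ _ wa wd) wc)).
rewrite (pJ_comm (dJ _ _ _ _ db dd) (dJ _ _ _ _ da dc) (wJ _ _ wb wd) (wJ _ _ wa wc)).
lm4 p q k l.
Qed.

Lemma pJ_act a x : wt 2%:R a -> wt 2%:R x -> pJ a x = - (2%:R^-1 *: br (F a) x).
Proof. by move=> wa wx; rewrite (pJ_F wa wx); lm0. Qed.

(** The axioms SJT1 to SJT6 are instances of the Jacobi identity, rewritten by
    moving F from one factor to another with [Fa_m]. *)
Lemma weight_SJT1 p i a m n : deg p a -> deg i m -> wt 2%:R a -> wt 1 m -> wt 1 n ->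
  pJ a (br m n) = 2%:R^-1 *: (br (br a (F m)) n + s p i *: br m (br a (F n))).
Proof.
move=> da dm wa wm wn; rewrite (pJ_act wa (wt_S wm wn)) (jac _ (dF da) dm).
rewrite (Fa_m wa wm) (Fa_m wa wn) !bE; lm2 p i.
Qed.

Lemma weight_SJT2 p i j a m n r : deg p a -> deg i m -> deg j n ->
  wt 2%:R a -> wt 1 m -> wt 1 n -> wt 1 r ->
  br a (F (br (br m (F n)) r)) = br (br (br a (F m)) (F n)) r
   - s p i *: br (br m (F (br a (F n)))) r + s p (i (+) j) *: br (br m (F n)) (br a (F r)).
Proof.
move=> da dm dn wa wm wn wr.
have := Fa_m wa (wt_T wm wn wr); rewrite (jac _ (dF da) (br_even dm (dF dn))).
rewrite (jac _ (dF da) dm) (Fa_m wa wm) (Fa_m wa wr) -(F_aFm a wn) !bE => e.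
by apply: (lcstep (c := - 1) e); lm3 p i j.
Qed.

Lemma weight_SJT3 i j k m n r : deg i m -> deg j n -> deg k r -> wt 1 m -> wt 1 n -> wt 1 r ->
  br (br m (F n)) r = (s i (j (+) k) * s j k) *: br (br r (F n)) m
   + s j k *: br (br m r) (F n).
Proof.
move=> dm dn dr wm wn wr; rewrite (jac' _ dm (dF dn)) (an (dF dn) dr).
rewrite (an (dF dn) (br_even dm dr)) !bE (an dm (br_even dr (dF dn))); lm3 i j k.
Qed.

Lemma weight_SJT4 i j m n r : deg i m -> deg j n -> wt 1 m -> wt 1 n -> wt 1 r ->
  br (br m (F n)) r = s i j *: br (br n (F m)) r - br (br m n) (F r).
Proof.
move=> dm dn wm wn wr; have := Fa_m (wt_S wm wn) wr.
rewrite Fbr (an (dF dm) dn) !bE => e.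
by apply: (lcstep (c := - 1) e); lm2 i j.
Qed.

Lemma weight_SJT5 i j k l m n r t : deg i m -> deg j n -> deg k r -> deg l t ->
  wt 1 m -> wt 1 n -> wt 1 r -> wt 1 t ->
  br (br (br m (F n)) r) t + s k (i (+) j) *: br r (br (br m (F n)) t)
  = - (s j (k (+) l) *: br m (br (br r t) (F n))).
Proof.
move=> dm dn dr dt wm wn wr wtt.
apply: (lcstep (c := 1) (jac t (br_even dm (dF dn)) dr)).
rewrite (jac' (br r t) dm (dF dn)) (br_ma (wt_S wr wtt) wm) !bE.
rewrite (an (dF dn) (br_even dr dt)) !bE; lm4 i j k l.
Qed.

(** Moving F across the triple product exchanges its first two arguments; this is
    the origin of the swapped term (n,m,s) in SJT6. *)
Lemma br_mFn_Fr i j m n r : deg i m -> deg j n -> wt 1 m -> wt 1 n -> wt 1 r ->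
  br (br m (F n)) (F r) = s i j *: F (br (br n (F m)) r).
Proof.
move=> dm dn wm wn wr; rewrite Fbr (F_mFn n wm).
have e1 := FF_am (wt_S wm wn) wr; rewrite !Fbr !FE !Fbr (FFm wm) (FFm wn) !bE in e1.
have e2 : br n (F m) = - (s i j *: br (F m) n) by rewrite (an dn (dF dm)) sgC.
rewrite e2 !bE (an (dF dn) (dF dm)) !bE.
apply: (lcstep (c := - 2%:R^-1) e1).
lm2 i j.
Qed.

Lemma weight_SJT6 i j k l m n r t u : deg i m -> deg j n -> deg k r -> deg l t ->
  wt 1 m -> wt 1 n -> wt 1 r -> wt 1 t -> wt 1 u ->
  br (br m (F n)) (br (br r (F t)) u)
  = br (br (br (br m (F n)) r) (F t)) u
    + (s k (i (+) j) * s i j) *: br (br r (F (br (br n (F m)) t))) u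
    + s (i (+) j) (k (+) l) *: br (br r (F t)) (br (br m (F n)) u).
Proof.
move=> dm dn dr dt wm wn wr wtt wu.
have dQ := br_even dm (dF dn).
rewrite (jac _ dQ (br_even dr (dF dt))) (jac _ dQ dr) (br_mFn_Fr dm dn wm wn wtt) !bE.
lm4 i j k l.
Qed.

Lemma act_coord x (y : g) : act x y = x 0 1 *: E y + x 1 0 *: F y + x 0 0 *: Hh y.
Proof.
rewrite -!AE; congr (act _ y).
by apply: sl2_eq; rewrite !sl2D !sl2Z !(e_E, f_E, h_E); ring.
Qed.

(** ** Invariants built from two weight-1 vectors

    The bracket [m, F n] has a component in the adjoint and one in the trivial
    part of g; antisymmetrizing in F keeps the latter. This is the element that
    represents the class [bM m n]. *)
Fact dM_exists : { d : g -> g -> g | forall m n, d m n = 2%:R^-1 *: (br m (F n) - br (F m) n) }.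
Proof. by exists (fun m n => 2%:R^-1 *: (br m (F n) - br (F m) n)). Qed.
Definition dM := sval dM_exists.
Lemma dME m n : dM m n = 2%:R^-1 *: (br m (F n) - br (F m) n).
Proof. exact: (svalP dM_exists). Qed.

Lemma dM_bilin : bilin dM.
Proof. by split=> ? k x y; rewrite !dME ?FE !bE; lm0. Qed.

Lemma wt_dM m n : wt 1 m -> wt 1 n -> wt 0 (dM m n).
Proof.
move=> wm wn; have w1 : wt 0 (br m (F n)) by apply: wt_cast (wtB wm (wtF wn)); ring.
have w2 : wt 0 (br (F m) n) by apply: wt_cast (wtB (wtF wm) wn); ring.
by rewrite /wt dME !AE w1 w2 !scale0r subr0 scaler0.
Qed.
Lemma E_dM m n : wt 1 m -> wt 1 n -> E (dM m n) = 0.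
Proof.
move=> wm wn; rewrite dME !AE !Ebr !(EFm) // !(E_m) // !bE; lm0.
Qed.
Lemma F_dM m n : wt 1 m -> wt 1 n -> F (dM m n) = 0.
Proof.
move=> wm wn; apply: (inv_F); last exact: E_dM.
by rewrite (wt_dM wm wn) scale0r.
Qed.
Lemma wt_q a b : wt 2%:R a -> wt 2%:R b -> wt 0 (br (F a) (F b)).
Proof. by move=> wa wb; apply: wt_cast (wtB (wtF wa) (wtF wb)); ring. Qed.
Lemma E_q a b : wt 2%:R a -> wt 2%:R b -> E (br (F a) (F b)) = 0.
Proof. by move=> wa wb; rewrite Ebr !(EFa) // !bE (Fa_b) //; lm0. Qed.

Lemma dM_sym i j m n : deg i m -> deg j n -> dM m n = s i j *: dM n m.
Proof.
by move=> dm dn; rewrite !dME (an dm (dF dn)) (an (dF dm) dn); lm2 i j.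
Qed.
Lemma deg_dM i j m n : deg i m -> deg j n -> deg (i (+) j) (dM m n).
Proof.
by move=> dm dn; rewrite dME; apply: degZ; apply: degB; apply: br_even => //; apply: dF.
Qed.

Lemma dM_act p i j a m n : deg p a -> deg i m -> deg j n -> wt 2%:R a -> wt 1 m -> wt 1 n ->
  dM (br a (F m)) n - s p i *: dM m (br a (F n))
  - (s p i * s p j) *: (2%:R *: (4%:R^-1 *: br (F (br m n)) (F a))) = 0.
Proof.
move=> da dm dn wa wm wn; rewrite !dME !(F_aFm) //.
rewrite (an (dF (br_even dm dn)) (dF da)) Fbr !bE.
rewrite (jac _ (dF da) (dF dm)) (jac _ (dF da) dm) (Fa_m wa wm) (Fa_m wa wn).
rewrite !bE (jac' (F n) da (dF dm)).
lm3 p i j.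
Qed.

(** Bracketing with [dM m n] gives par_{m,n} on both weight spaces. *)
Lemma dM_m i j m n r : deg i m -> deg j n -> wt 1 m -> wt 1 n -> wt 1 r ->
  br (dM m n) r = 2%:R^-1 *: br (br m n) (F r) + br (br m (F n)) r.
Proof.
move=> dm dn wm wn wr; have := Fa_m (wt_S wm wn) wr.
rewrite dME Fbr !bE => e; apply: (lcstep (c := 2%:R^-1) e); lm0.
Qed.
Lemma dM_a i j k m n a : deg i m -> deg j n -> deg k a -> wt 1 m -> wt 1 n -> wt 2%:R a ->
  br (dM m n) a = 2%:R^-1 *: ((s k i * s k j) *: br (br a (F m)) n - s k j *: br m (br a (F n))).
Proof.
move=> dm dn da wm wn wa; rewrite dME !bE (jac' _ dm (dF dn)) (jac' _ (dF dm) dn).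
rewrite (br_ma wa wm) (br_ma wa wn) !bE (an (dF dn) da) (an (dF dm) da).
rewrite !bE (an dn (br_even da (dF dm))); lm3 i j k.
Qed.
Lemma q_m p q a b m : deg p a -> deg q b -> wt 2%:R a -> wt 2%:R b -> wt 1 m ->
  br (br (F a) (F b)) m = br a (F (br b (F m))) - s p q *: br b (F (br a (F m))).
Proof.
move=> da db wa wb wm; rewrite (jac' _ (dF da) (dF db)) (Fa_m wa wm) (Fa_m wb wm) !bE.
by rewrite (Fa_m wa (wt_A wb wm)) (Fa_m wb (wt_A wa wm)); lm2 p q.
Qed.

(** Bracketing with an element killed by F commutes with F, so it acts on the
    invariants by the Leibniz rule. *)
Lemma inv_br x y : F x = 0 -> br x (F y) = F (br x y).
Proof. by move=> Fx; rewrite Fbr Fx bE add0r. Qed.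
Lemma inv_dM d i x m n : deg d x -> deg i m -> F x = 0 ->
  br x (dM m n) = dM (br x m) n + s d i *: dM m (br x n).
Proof.
move=> dx dm Fx; rewrite !dME !bE (jac _ dx dm) (jac _ dx (dF dm)) !(inv_br _ Fx).
lm2 d i.
Qed.
Lemma inv_q d i x a b : deg d x -> deg i a -> F x = 0 ->
  br x (br (F a) (F b)) = br (F (br x a)) (F b) + s d i *: br (F a) (F (br x b)).
Proof. by move=> dx da Fx; rewrite (jac _ dx (dF da)) !(inv_br _ Fx). Qed.

(** The fifth relation among the invariants of g is the superantisymmetry of the
    bracket of [dM m n] with [dM r t]. *)
Lemma dM_par i j k l m n r t : deg i m -> deg j n -> deg k r -> deg l t ->
  wt 1 m -> wt 1 n -> wt 1 r -> wt 1 t ->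
  dM (br (dM m n) r) t + s (i (+) j) k *: dM r (br (dM m n) t)
  + s (i (+) j) (k (+) l) *: dM (br (dM r t) m) n
  + s (k (+) l) j *: dM m (br (dM r t) n) = 0.
Proof.
move=> dm dn dr dt wm wn wr wtt.
apply: (lcstep (c := 1) (inv_dM t (deg_dM dm dn) dr (F_dM wm wn))).
apply: (lcstep (c := s (i (+) j) (k (+) l)) (inv_dM n (deg_dM dr dt) dm (F_dM wr wtt))).
rewrite (an (deg_dM dm dn) (deg_dM dr dt)); lm4 i j k l.
Qed.

(** ** The ternary superalgebra of highest weight vectors *)
Local Notation W2 := (weight g 2%:R).
Local Notation W1 := (weight g 1).

Fact mkW_subproof k x : wt k x -> x \in eigen_pred k (@hact_linear K g).
Proof. by move=> hx; apply/eqP. Qed.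
Definition mkW k x (hx : wt k x) : weight g k := Eigen (mkW_subproof hx).
Lemma wtV k (x : weight g k) : wt k (x : g).
Proof. exact/eqP/(eigenP x). Qed.

Definition that_ops : ternary_ops W2 W1 := TernaryOps
  (fun a b : W2 => mkW (wt_pJ (wtV a) (wtV b)))
  (fun (a : W2) (m : W1) => mkW (wt_A (wtV a) (wtV m)))
  (fun m n : W1 => mkW (wt_S (wtV m) (wtV n)) : W2)
  (fun m n r : W1 => - mkW (wt_T (wtV m) (wtV n) (wtV r))).

Lemma that_jordan : is_jordan that_ops.
Proof.
split.
- by split=> [b k a a'|a k b b']; apply: val_inj; [exact: pJ_bilin.1|exact: pJ_bilin.2].
- by move=> i j a b da db; apply: (deg_pJ da db).
- move=> i j a b da db; apply: val_inj; exact: (pJ_comm da db (wtV a) (wtV b)).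
move=> i j k l a b c d da db dc dd; apply: val_inj.
have := pJ_jordan da db dc dd (wtV a) (wtV b) (wtV c) (wtV d).
by sgn => e; sgn; exact: e.
Qed.

Lemma that_special : is_special_module that_ops.
Proof.
split.
- split=> [b k a a'|a k b b']; apply: val_inj; first exact: (lie_bilin HL).1.
  by rewrite /= ((act_bilin HA).2 (sl2_f K)); exact: (lie_bilin HL).2.
- by move=> i j a b da db; apply: br_even => //; apply: dF.
move=> i j a b m da db; apply: val_inj.
exact: (pJ_special da db (wtV a) (wtV b) (wtV m)).
Qed.

Lemma that_ternary : is_ternary that_ops.
Proof.
split.
- exact: that_jordan.
- exact: that_special.
- by split=> [b k a a'|a k b b']; apply: val_inj; [exact: (lie_bilin HL).1|exact: (lie_bilin HL).2].
- by move=> i j a b da db; apply: br_even.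
- by move=> i j m n dm dn; apply: val_inj; exact: (lie_anti HL dm dn).
- by move=> n r k x y; apply: val_inj; rewrite /= !bE; lm0.
- by move=> n r k x y; apply: val_inj; rewrite /= !FE !bE; lm0.
- by move=> n r k x y; apply: val_inj; rewrite /= !bE; lm0.
- move=> i j k m n r dm dn dr; apply: (@degN _ g).
  by apply: br_even => //; apply: br_even => //; apply: dF.
- move=> p i j a m n da dm dn; apply: val_inj.
  exact: (weight_SJT1 da dm (wtV a) (wtV m) (wtV n)).
- move=> p i j k a m n r da dm dn dr; apply: val_inj.
  have := weight_SJT2 da dm dn (wtV a) (wtV m) (wtV n) (wtV r).
  sgn => e; sgn; rewrite /= !FE !bE e; lm0.
- move=> i j k m n r dm dn dr; apply: val_inj.
  have := weight_SJT3 dm dn dr (wtV m) (wtV n) (wtV r).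
  sgn => e; sgn; rewrite /= e; lm0.
- move=> i j k m n r dm dn dr; apply: val_inj.
  have := weight_SJT4 dm dn (wtV m) (wtV n) (wtV r).
  sgn => e; sgn; rewrite /= e; lm0.
- move=> i j k l m n r t dm dn dr dt; apply: val_inj.
  have := weight_SJT5 dm dn dr dt (wtV m) (wtV n) (wtV r) (wtV t).
  sgn => e; sgn; rewrite /= !bE; apply: (lcstep (c := 1) e); lm0.
move=> i j k l q m n r t u dm dn dr dt du; apply: val_inj.
have := weight_SJT6 dm dn dr dt (wtV m) (wtV n) (wtV r) (wtV t) (wtV u).
sgn => e; sgn; rewrite /= !FE !bE e; lm0.
Qed.

Definition that_object : That_object g.
Proof.
apply: (ThatObject that_ternary).
- by move=> a b; rewrite /= pJE scalerA divff // scale1r.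
- by [].
- by [].
- by [].
Defined.

(** ** Extending a ternary morphism to TAG

    The maps [u] and [w] are the components of a morphism from [T] to the ternary
    superalgebra of g, seen as maps into g. *)

Section Universal.
Variables (J M : superspace K) (T : ternary_ops J M) (H : is_ternary T).
Local Notation "a ** b" := (jmul T a b) (at level 40, left associativity).
Local Notation "a @@ m" := (jact T a m) (at level 38, right associativity).
Local Notation "m \star n" := (star T m n) (at level 40, left associativity).
Variables (u : J -> g) (w : M -> g).
Hypotheses (lu : linear u) (lw : linear w) (eu : even_map u) (ew : even_map w).
Hypotheses (wu : forall a, wt 2%:R (u a)) (ww : forall m, wt 1 (w m)).
Hypothesis u_jmul : forall a b, u (a ** b) = pJ (u a) (u b).
Hypothesis w_jact : forall a m, w (a @@ m) = br (u a) (F (w m)).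
Hypothesis u_star : forall m n, u (m \star n) = br (w m) (w n).
Hypothesis w_tri : forall m n r, w (tri T m n r) = - br (br (w m) (F (w n))) (w r).
Let uE := linE lu.
Let wE := linE lw.

Let w_parM i j m n r : deg i m -> deg j n -> w (parM T m n r) = br (dM (w m) (w n)) (w r).
Proof.
move=> dm dn; rewrite (dM_m (ew dm) (ew dn)) // /parM !wE w_jact w_tri u_star; lm0.
Qed.
Let u_parJ i j k m n c : deg i m -> deg j n -> deg k c ->
  u (parJ T i j k m n c) = br (dM (w m) (w n)) (u c).
Proof.
move=> dm dn dc; rewrite (dM_a (ew dm) (ew dn) (eu dc)) // /parJ !uE !u_star !w_jact.
by lm3 i j k.
Qed.
Let u_angJ p q a b c : deg p a -> deg q b ->
  u (angJ T p q a b c) = 4%:R^-1 *: br (br (F (u a)) (F (u b))) (u c).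
Proof.
move=> da db; rewrite (q_ad (eu da) (eu db)) // /angJ !uE !u_jmul; lm2 p q.
Qed.
Let w_angM p q a b m : deg p a -> deg q b ->
  w (angM T p q a b m) = 4%:R^-1 *: br (br (F (u a)) (F (u b))) (w m).
Proof.
move=> da db; rewrite (q_m (eu da) (eu db)) // /angM !wE !w_jact; lm2 p q.
Qed.

(** The restriction to B^s of a morphism from TAG to g; its values are invariants
    because sl2 acts trivially on B^s. *)
Record inner_rep (B : superspace K) (bJ : J -> J -> B) (bM : M -> M -> B)
    (dlJ : B -> J -> J) (dlM : B -> M -> M) (dlB : B -> B -> B) (bt : B -> g) : Prop := {
  rep_lin : linear bt;
  rep_even : even_map bt;
  rep_E : forall t, E (bt t) = 0;
  rep_F : forall t, F (bt t) = 0;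
  rep_H : forall t, Hh (bt t) = 0;
  rep_bJ : forall a b, bt (bJ a b) = 4%:R^-1 *: br (F (u a)) (F (u b));
  rep_bM : forall m n, bt (bM m n) = dM (w m) (w n);
  rep_u : forall t c, br (bt t) (u c) = u (dlJ t c);
  rep_w : forall t r, br (bt t) (w r) = w (dlM t r);
  rep_br : forall t t', br (bt t) (bt t') = bt (dlB t t')
}.

(** The invariants of g formed with [u] and [w] satisfy the five relations, so the
    universal property of B^s gives [bt]; it is compatible with the brackets since
    both sides act by the Leibniz rule, on the classes and on the invariants. *)
Lemma inner_rep_exists : exists bt,
  inner_rep (bJ H) (bM H) (dlJ n2 (H:=H)) (dlM n2 (H:=H)) (dlB n2 (H:=H)) bt.
Proof.
have [|||||||bt lbt [btJ btM]] := @B_lift K J M T H g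
    (fun a b => 4%:R^-1 *: br (F (u a)) (F (u b))) (fun m n => dM (w m) (w n)).
- by split=> ? k x y; rewrite !uE !FE !bE; lm0.
- by split=> ? k x y; rewrite !wE !(bilE dM_bilin); lm0.
- by move=> i j a b da db; rewrite (an (dF (eu da)) (dF (eu db))); lm2 i j.
- by move=> i j m n dm dn; rewrite (dM_sym (ew dm) (ew dn)).
- move=> i j k a b c da db dc; rewrite !u_jmul.
  apply: (lcstep (c := - 4%:R^-1) (q_cyc (eu da) (eu db) (eu dc) (wu a) (wu b) (wu c))).
  lm3 i j k.
- move=> p i j a m n da dm dn; rewrite !w_jact u_star.
  exact: (dM_act (eu da) (ew dm) (ew dn) (wu a) (ww m) (ww n)).
- move=> i j k l m n r t dm dn dr dt; rewrite !(w_parM _ dm dn) !(w_parM _ dr dt).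
  exact: (dM_par (ew dm) (ew dn) (ew dr) (ew dt) (ww m) (ww n) (ww r) (ww t)).
have btE : forall t, E (bt t) = 0.
  apply: B_ind => [p q a b _ _|p q m n _ _||k x y hx hy].
  - by rewrite btJ !AE E_q // scaler0.
  - by rewrite btM E_dM.
  - by rewrite (lin0 lbt) !AE.
  by rewrite lbt !AE hx hy scaler0 addr0.
have btF : forall t, F (bt t) = 0.
  apply: B_ind => [p q a b _ _|p q m n _ _||k x y hx hy].
  - by rewrite btJ !AE F_q // scaler0.
  - by rewrite btM F_dM.
  - by rewrite (lin0 lbt) !AE.
  by rewrite lbt !AE hx hy scaler0 addr0.
have btH : forall t, Hh (bt t) = 0.
  apply: B_ind => [p q a b _ _|p q m n _ _||k x y hx hy].
  - by rewrite btJ !AE (wt_q (wu a) (wu b)) scale0r scaler0.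
  - by rewrite btM (wt_dM (ww m) (ww n)) scale0r.
  - by rewrite (lin0 lbt) !AE.
  by rewrite lbt !AE hx hy scaler0 addr0.
have bte : even_map bt.
  move=> i t; elim/B_ind_deg => {t} [p q a b da db <-|p q m n dm dn <-||k x y hx hy].
  - by rewrite btJ; apply: degZ; apply: br_even; apply: dF; apply: eu.
  - by rewrite btM; apply: deg_dM; apply: ew.
  - by rewrite (lin0 lbt); apply: deg0.
  by rewrite lbt; apply: deg_lin.
have btu t c : br (bt t) (u c) = u (dlJ n2 t c).
  elim/hom_ind: c => [k c dc|x y hx hy]; last first.
    by rewrite uE !bE hx hy (linD ((dlJ_bilin n2 H).2 t)) uE.
  move: t; apply: B_ind => [p q a b da db|p q m n dm dn||k' x y hx hy].
  - by rewrite btJ (dlJ_bJ n2 H _ da db) u_angJ // !bE.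
  - by rewrite btM (dlJ_bM n2 H _ dm dn) (parJhE n2 H _ _ _ _ dc) (u_parJ dm dn dc).
  - by rewrite (lin0 lbt) !bE (bil0l (dlJ_bilin n2 H)) uE.
  by rewrite lbt !bE hx hy (dlJ_bilin n2 H).1 lu.
have btw t c : br (bt t) (w c) = w (dlM n2 t c).
  move: t; apply: B_ind => [p q a b da db|p q m n dm dn||k' x y hx hy].
  - by rewrite btJ (dlM_bJ n2 H _ da db) w_angM // !bE.
  - by rewrite btM dlM_bM (w_parM _ dm dn).
  - by rewrite (lin0 lbt) !bE (bil0l (dlM_bilin n2 H)) wE.
  by rewrite lbt !bE hx hy (dlM_bilin n2 H).1 lw.
exists bt; split=> // t t'.
elim/hom_ind: t => [i t dt|x y hx hy]; last first.
  by rewrite (linD lbt) !bE hx hy (linD ((dlB_bilin n2 H).1 t')) (linD lbt).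
move: t'; apply: B_ind => [p q a b da db|p q m n dm dn||k' x y hx hy].
- rewrite (dlB_bJ n2 dt da db) btJ !bE (inv_q _ (bte _ _ dt) (eu da) (btF t)) !btu.
  by rewrite (linD lbt) (linZ lbt) !btJ; lm2 i p.
- rewrite (dlB_bM n2 dt dm dn) btM (inv_dM _ (bte _ _ dt) (ew dm) (btF t)) !btw.
  by rewrite (linD lbt) (linZ lbt) !btM.
- by rewrite (lin0 lbt) !bE (bil0r (dlB_bilin n2 H)) (lin0 lbt).
by rewrite lbt !bE hx hy (dlB_bilin n2 H).2 lbt.
Qed.

Variables (B : superspace K) (bJ : J -> J -> B) (bM : M -> M -> B).
Variables (dlJ : B -> J -> J) (dlM : B -> M -> M) (dlB : B -> B -> B).
Hypothesis IA : inner_algebra T bJ bM dlJ dlM dlB.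
Variable bt : B -> g.
Hypothesis R : inner_rep bJ bM dlJ dlM dlB bt.
Let lbt := rep_lin R.
Let btE' := linE lbt.
Local Notation S := (short_space J M B).
Local Notation iJ := (@iJ K J M B).
Local Notation iM := (@iM K J M B).
Local Notation iD := (@iD K J M B).
Local Notation tbr := (tbr n2 H IA).
Let P := tbrP n2 H IA.

(** The extension sends e (x) a to [u a], h (x) a to - F (u a), f (x) a to
    - F (F (u a)) / 2, e1 (x) m to [w m] and e2 (x) m to F (w m), as
    sl2-linearity forces. *)
Fact lift_exists : { k : S -> g | forall v, k v =
  u (cJ 0 1 v) - F (u (cJ 0 0 v)) - 2%:R^-1 *: F (F (u (cJ 1 0 v)))
  + w (cM 0 v) + F (w (cM 1 v)) + bt (cD v) }.
Proof.
by exists (fun v => u (cJ 0 1 v) - F (u (cJ 0 0 v)) - 2%:R^-1 *: F (F (u (cJ 1 0 v)))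
  + w (cM 0 v) + F (w (cM 1 v)) + bt (cD v)).
Qed.
Definition lift := sval lift_exists.
Lemma liftE v : lift v =
  u (cJ 0 1 v) - F (u (cJ 0 0 v)) - 2%:R^-1 *: F (F (u (cJ 1 0 v)))
  + w (cM 0 v) + F (w (cM 1 v)) + bt (cD v).
Proof. exact: (svalP lift_exists). Qed.

Lemma lift_linear : linear lift.
Proof.
move=> k x y; rewrite !liftE !cJ_linear !cM_linear !cD_linear !uE !wE !FE !btE'; lm0.
Qed.
Let lE := linE lift_linear.
Lemma lift_J x a : lift (iJ x a) =
  x 0 1 *: u a - x 0 0 *: F (u a) - 2%:R^-1 *: (x 1 0 *: F (F (u a))).
Proof. by rewrite liftE !crdE !uE !wE !btE' !FE; lm0. Qed.
Lemma lift_M (v : 'cV[K]_2) m : lift (iM v m) = v 0 0 *: w m + v 1 0 *: F (w m).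
Proof. by rewrite liftE !crdE !uE !wE !btE' !FE; lm0. Qed.
Lemma lift_D t : lift (iD t) = bt t.
Proof. by rewrite liftE !crdE !uE !wE !FE; lm0. Qed.

Lemma lift_even : even_map lift.
Proof.
move=> i x; elim/S_ind_deg => {x} [x a da|v m dm|t dt|k x y hx hy].
- rewrite lift_J; apply: degB; first apply: degB; do ?apply: degZ; do ?apply: dF; exact: eu.
- rewrite lift_M; apply: degD; apply: degZ; do ?apply: dF; exact: ew.
- by rewrite lift_D; apply: (rep_even R).
by rewrite lift_linear; apply: deg_lin.
Qed.

Let u0 a : E (u a) = 0. Proof. exact: (E_a). Qed.
Let w0 m : E (w m) = 0. Proof. exact: (E_m). Qed.
Let u3 a : F (F (F (u a))) = 0. Proof. exact: (FFFa). Qed.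
Let w2 m : F (F (w m)) = 0. Proof. exact: (FFm). Qed.
Let Hu a : Hh (u a) = 2%:R *: u a. Proof. exact: wu. Qed.
Let HFu a : Hh (F (u a)) = 0.
Proof. by rewrite (wtF (wu a)) subrr scale0r. Qed.
Let HFFu a : Hh (F (F (u a))) = - (2%:R *: F (F (u a))).
Proof. by rewrite (wtF (wtF (wu a))) subrr sub0r scaleNr. Qed.
Let Hw m : Hh (w m) = w m. Proof. by rewrite (ww m) scale1r. Qed.
Let HFw m : Hh (F (w m)) = - F (w m).
Proof. by rewrite (wtF (ww m)); lm0. Qed.

Let EFu a : E (F (u a)) = 2%:R *: u a. Proof. exact: (EFa). Qed.
Let EFFu a : E (F (F (u a))) = 2%:R *: F (u a).
Proof. by rewrite EF HFu EFu !FE add0r. Qed.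
Let EFw' m : E (F (w m)) = w m. Proof. exact: (EFm). Qed.

Lemma lift_act x v : lift (tact x v) = act x (lift v).
Proof.
have cE := bilE (tact_bilin J M B n2).
elim/S_ind: v => [y a|v m|t|k v v' hv hv'].
- rewrite tact_inJ // !lift_J (act_coord x) !AE u0 EFu EFFu u3 Hu HFu HFFu.
  by rewrite !sl2_brE; lm0.
- rewrite tact_inM // !lift_M (act_coord x) !AE w0 EFw' w2 Hw HFw.
  by rewrite !sl2_actE; lm0.
- by rewrite tact_inD // !lift_D lE (act_coord x) (rep_E R) (rep_F R) (rep_H R) !scaler0 !addr0.
by rewrite cE lE cE lE hv hv' !lE !AE.
Qed.

Let br_FFaFFb a b : br (F (F (u a))) (F (F (u b))) = 0.
Proof.
apply: (wtN4_eq0); apply: wt_cast (wtB (wtF (wtF (wu a))) (wtF (wtF (wu b)))); ring.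
Qed.
Let br_FFaFm a m : br (F (F (u a))) (F (w m)) = 0.
Proof.
apply: (wtN3_eq0); apply: wt_cast (wtB (wtF (wtF (wu a))) (wtF (ww m))); ring.
Qed.

Let lift_JJ x y a b : lift (tbr (iJ x a) (iJ y b)) = br (lift (iJ x a)) (lift (iJ y b)).
Proof.
rewrite (tag_JJ P) lE lift_D !lift_J btE' (rep_bJ R) !bE u_jmul.
rewrite (br_aa (wu a) (wu b)) (br_aFFb (wu a) (wu b)) (br_FFab (wu a) (wu b)).
rewrite br_FFaFFb (pJ_r (u a) (u b)) (pJ_F (wu a) (wu b)).
rewrite ?sl2_brE ?kappaE.
have := br_FFaFb (wu a) (wu b); rewrite (FFa_Fb (wu a) (wu b)) => /(congr1 -%R).
rewrite !opprK => ->.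
lm0.
Qed.

Let lift_JM x (v : 'cV[K]_2) a m :
  lift (tbr (iJ x a) (iM v m)) = br (lift (iJ x a)) (lift (iM v m)).
Proof.
rewrite (tag_JM P) lift_J !lift_M !bE w_jact.
rewrite (br_am (wu a) (ww m)) (Fa_m (wu a) (ww m)) (FF_am (wu a) (ww m)).
rewrite br_FFaFm (F_aFm (u a) (ww m)) ?sl2_actE; lm0.
Qed.

Let lift_MM (v v' : 'cV[K]_2) m n :
  lift (tbr (iM v m) (iM v' n)) = br (lift (iM v m)) (lift (iM v' n)).
Proof.
rewrite (tag_MM P) lE lift_D lift_J !lift_M btE' (rep_bM R) dME !bE u_star.
rewrite !Fbr !FE !Fbr !w2 !bE ?odotE ?VdetE; lmf0.
Qed.

Let lift_DJ t x a : lift (tbr (iD t) (iJ x a)) = br (lift (iD t)) (lift (iJ x a)).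
Proof.
by rewrite (tag_DJ P) lift_D !lift_J !bE !inv_br ?(rep_F R) // (rep_u R); lm0.
Qed.
Let lift_DM t v m : lift (tbr (iD t) (iM v m)) = br (lift (iD t)) (lift (iM v m)).
Proof. by rewrite (tag_DM P) lift_D !lift_M !bE !inv_br ?(rep_F R) // (rep_w R). Qed.
Let lift_DD t t' : lift (tbr (iD t) (iD t')) = br (lift (iD t)) (lift (iD t')).
Proof. by rewrite (tag_DD P) !lift_D (rep_br R). Qed.

Lemma lift_br x y : lift (tbr x y) = br (lift x) (lift y).
Proof.
have tE := bilE (tag_bilin P).
have sw i j x' y' : deg i x' -> deg j y' -> lift (tbr x' y') = br (lift x') (lift y') ->
    lift (tbr y' x') = br (lift y') (lift x').
  move=> dx dy e; rewrite (tbr_anti n2 H IA dy dx) !lE e (an (lift_even dy) (lift_even dx)).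
  by rewrite -?scaleNr.
(* Up to exchanging the arguments, generators are covered by the formulas above. *)
elim/hom_ind: x => [i x dx|x x' hx hx']; last by rewrite tE !lE bE hx hx'.
elim/hom_ind: y => [j y dy|y y' hy hy']; last by rewrite tE !lE bE hy hy'.
elim/S_ind_deg: dx => {x} [x a da|v m dm|t dt|k x x' hx hx']; last first.
- by rewrite !tE !lE !bE hx hx'.
- elim/S_ind_deg: dy => {y} [y b db|v' n dn|t' dt'|k y y' hy hy'] //.
  by rewrite !tE !lE !bE hy hy'.
- elim/S_ind_deg: dy => {y} [y b db|v' n dn|t' dt'|k y y' hy hy'] //.
  + by apply: (sw _ _ _ _ (deg_inJ _ _ _ db) (deg_inM _ _ _ dm)).
  + by apply: (sw _ _ _ _ (deg_inD _ _ dt') (deg_inM _ _ _ dm)).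
  by rewrite !tE !lE !bE hy hy'.
elim/S_ind_deg: dy => {y} [y b db|v' n dn|t' dt'|k y y' hy hy'] //.
- by apply: (sw _ _ _ _ (deg_inD _ _ dt') (deg_inJ _ _ _ da)).
by rewrite !tE !lE !bE hy hy'.
Qed.
End Universal.
End ShortAlgebras.

(** * The functors and the adjunction *)

Section Adjunction.
Variable K : fieldType.
Hypothesis char0 : forall n : nat, n.+1%:R != 0 :> K.
Let n2 : 2%:R != 0 :> K := char0 1.
Local Notation e := (sl2_e K).
Local Notation f := (sl2_f K).
Local Notation h := (sl2_h K).
Local Notation e1 := (e1 K).
Local Notation e2 := (e2 K).

Definition tagX (X : ternary_superalgebra K) := TAG_ob (tag_object n2 X).
Definition thatX (g : short_lie_superalgebra K) := That_ob (that_object char0 g).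

(** ** The unit

    The vectors e (x) a and e1 (x) m generate TAG under the bracket and the action
    of f; the formulas [TAG_J_gen], [TAG_M_gen], [TAG_BJ_gen] and [TAG_BM_gen]
    express everything else by them. *)

Section Generators.
Variable X : ternary_superalgebra K.
Let L := tag_object n2 X.
Local Notation br := (lbr (TAG_ops L)).
Local Notation F := (lact (TAG_ops L) f).

Lemma TAG_J_bilin : bilin (@TAG_J K X).
Proof. by have := inJ_bilin (tJs X) (tMs X) (TAG_Bs X); rewrite iJ_def. Qed.
Lemma TAG_M_bilin : bilin (@TAG_M K X).
Proof. by have := inM_bilin (tJs X) (tMs X) (TAG_Bs X); rewrite iM_def. Qed.
Let JE := bilE TAG_J_bilin.
Let ME := bilE TAG_M_bilin.

Lemma TAG_FJ a : F (TAG_J e a) = - TAG_J h a.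
Proof.
rewrite (TAG_actJ L) -JE; congr (TAG_J _ a).
by apply: sl2_eq; rewrite !sl2_brE !sl2N !(e_E, f_E, h_E); ring.
Qed.
Lemma TAG_FFJ a : F (F (TAG_J e a)) = - (2%:R *: TAG_J f a).
Proof.
rewrite TAG_FJ -JE (TAG_actJ L) -JE -JE; congr (TAG_J _ a).
by apply: sl2_eq; rewrite !sl2_brE !(sl2N, sl2Z) !(e_E, f_E, h_E); ring.
Qed.
Lemma TAG_FM m : F (TAG_M e1 m) = TAG_M e2 m.
Proof.
rewrite (TAG_actM L); congr (TAG_M _ m).
by apply: V_eq; rewrite sl2_actE !(f_E, e1_E, e2_E); ring.
Qed.
Lemma TAG_J_gen x a : TAG_J x a = x 0 1 *: TAG_J e a - x 0 0 *: F (TAG_J e a)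
  - 2%:R^-1 *: (x 1 0 *: F (F (TAG_J e a))).
Proof.
rewrite TAG_FFJ TAG_FJ.
have -> : TAG_J x a = TAG_J (x 0 1 *: e + x 1 0 *: f + x 0 0 *: h) a.
  congr (TAG_J _ a).
  by apply: sl2_eq; rewrite !sl2D !sl2Z !(e_E, f_E, h_E); ring.
by rewrite !JE; lm0.
Qed.
Lemma TAG_M_gen v m : TAG_M v m = v 0 0 *: TAG_M e1 m + v 1 0 *: F (TAG_M e1 m).
Proof.
rewrite TAG_FM -!ME; congr (TAG_M _ m).
by apply: V_eq; rewrite !mxE /=; ring.
Qed.
Lemma TAG_BJ_gen a b : TAG_B (tJ (tMs X) a b)
  = 4%:R^-1 *: br (F (TAG_J e a)) (F (TAG_J e b)).
Proof.
rewrite !TAG_FJ -!JE (TAG_brJJ L).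
have -> : sl2_br (- h) (- h) = 0.
  by apply: sl2_eq; rewrite !sl2_brE !sl2N !h_E /= !mxE; ring.
have -> : 2%:R^-1 * kappa (- h) (- h) = 4%:R :> K.
  by rewrite kappaE !sl2N !h_E; field.
by rewrite JE add0r scalerA mulVf ?scale1r.
Qed.
Lemma TAG_BM_gen m n : TAG_B (tM (tJs X) m n)
  = 2%:R^-1 *: (br (TAG_M e1 m) (F (TAG_M e1 n)) - br (F (TAG_M e1 m)) (TAG_M e1 n)).
Proof.
rewrite !TAG_FM !(TAG_brMM L).
have -> : odot e2 e1 = odot e1 e2.
  by apply: sl2_eq; rewrite !odotE !e1_E !e2_E; ring.
have -> : Vdet e1 e2 = 1 by rewrite VdetE !e1_E !e2_E; ring.
have -> : Vdet e2 e1 = -1 by rewrite VdetE !e1_E !e2_E; ring.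
lm0.
Qed.
Lemma TAG_wtJ a : wt (g := tagX X) 2%:R (TAG_J e a).
Proof.
rewrite /wt; apply: etrans (TAG_actJ L h e a) _.
by rewrite br_he (bilZl TAG_J_bilin).
Qed.
Lemma TAG_wtM m : wt (g := tagX X) 1 (TAG_M e1 m).
Proof.
rewrite /wt scale1r; apply: etrans (TAG_actM L h e1 m) _; congr (TAG_M _ m).
by apply: V_eq; rewrite sl2_actE !(h_E, e1_E); ring.
Qed.
Lemma TAG_e_jmul a b : 2%:R *: TAG_J e (jmul X a b) = br (TAG_J e a) (F (TAG_J e b)).
Proof.
rewrite TAG_FJ -(bilNl TAG_J_bilin) (TAG_brJJ L).
have -> : kappa e (- h) = 0 by rewrite kappaE !sl2N !(e_E, h_E); ring.
rewrite mulr0 scale0r addr0 -(bilZl TAG_J_bilin); congr (TAG_J _ _).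
by apply: sl2_eq; rewrite !(sl2Z, sl2_brE, sl2N) !(e_E, h_E); ring.
Qed.
Lemma TAG_e_jact a m : TAG_M e1 (jact X a m) = br (TAG_J e a) (F (TAG_M e1 m)).
Proof.
rewrite TAG_FM (TAG_brJM L); congr (TAG_M _ _).
by apply: V_eq; rewrite sl2_actE !(e_E, e1_E, e2_E); ring.
Qed.
Lemma TAG_e_star m n : TAG_J e (star X m n) = br (TAG_M e1 m) (TAG_M e1 n).
Proof.
rewrite (TAG_brMM L).
have -> : Vdet e1 e1 = 0 by rewrite VdetE; ring.
rewrite scale0r addr0; congr (TAG_J _ _).
by apply: sl2_eq; rewrite !odotE !(e_E, e1_E); ring.
Qed.
Lemma TAG_e_tri m n r :
  TAG_M e1 (tri X m n r) = - br (br (TAG_M e1 m) (F (TAG_M e1 n))) (TAG_M e1 r).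
Proof.
rewrite TAG_FM (TAG_brMM L) (bilDl (lie_bilin (short_lie (TAG_short L)))).
have -> : Vdet e1 e2 = 1 by rewrite VdetE !e1_E !e2_E; ring.
rewrite scale1r (TAG_brJM L) (TAG_par_M L) /parM.
have -> : odot e1 e2 *m e1 = - 2%:R^-1 *: e1.
  by apply: V_eq; rewrite sl2_actE !odotE ![in RHS]mxE !(e1_E, e2_E) /=; ring.
rewrite !ME; lm0.
Qed.
End Generators.

(** A morphism into the ternary superalgebra of g is a pair of maps into g with
    values of weight 2 and 1. *)
Section HomToThat.
Variables (X : ternary_superalgebra K) (g : short_lie_superalgebra K).
Variables (u : tJs X -> g) (w : tMs X -> g).
Local Notation br := (lbr (sh_ops g)).
Local Notation F := (lact (sh_ops g) f).
Hypotheses (lu : linear u) (lw : linear w) (eu : even_map u) (ew : even_map w).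
Hypotheses (wu : forall a, wt 2%:R (u a)) (ww : forall m, wt 1 (w m)).
Hypothesis u_jmul : forall a b, 2%:R *: u (jmul X a b) = br (u a) (F (u b)).
Hypothesis w_jact : forall a m, w (jact X a m) = br (u a) (F (w m)).
Hypothesis u_star : forall m n, u (star X m n) = br (w m) (w n).
Hypothesis w_tri : forall m n r, w (tri X m n r) = - br (br (w m) (F (w n))) (w r).

Definition that_map :
    (tJs X -> weight g 2%:R) * (tMs X -> weight g 1) :=
  (fun a => mkW (wu a), fun m => mkW (ww m)).

Lemma that_map_hom : is_ternary_hom (X := X) (Y := thatX g) that_map.
Proof.
split=> /=.
- by move=> c a b; apply: val_inj; exact: lu.
- by move=> c a b; apply: val_inj; exact: lw.
- by move=> i a da; exact: eu.
- by move=> i a da; exact: ew.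
- move=> a b; apply: val_inj; apply: (scalerI n2); apply: etrans (u_jmul a b) _.
  by rewrite /= pJE scalerA divff // scale1r.
- by move=> a m; apply: val_inj; exact: w_jact.
- by move=> m n; apply: val_inj; exact: u_star.
- by move=> m n r; apply: val_inj; exact: w_tri.
Qed.
Definition that_hom : ternary_hom X (thatX g) := exist _ _ that_map_hom.
End HomToThat.

Lemma deg_TAG_J X x : even_map (@TAG_J K X x).
Proof. by move=> i a; rewrite /TAG_J -/(@inJ K _ _ _ _ _) -iJ_def; apply: deg_inJ. Qed.
Lemma deg_TAG_M X v : even_map (@TAG_M K X v).
Proof. by move=> i a; rewrite /TAG_M -iM_def; apply: deg_inM. Qed.

Definition unitX X : ternary_hom X (thatX (tagX X)) :=
  @that_hom X (tagX X) (TAG_J e) (TAG_M e1) ((TAG_J_bilin X).2 e) ((TAG_M_bilin X).2 e1)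
    (@deg_TAG_J X e) (@deg_TAG_M X e1) (@TAG_wtJ X) (@TAG_wtM X)
    (@TAG_e_jmul X) (@TAG_e_jact X) (@TAG_e_star X) (@TAG_e_tri X).
(** ** Morphisms out of TAG *)

Section ShortHom.
Variables (g0 g : short_lie_superalgebra K) (k : g0 -> g) (hk : is_short_hom k).
Local Notation br0 := (lbr (sh_ops g0)).
Local Notation F0 := (lact (sh_ops g0) f).
Local Notation br := (lbr (sh_ops g)).
Local Notation F := (lact (sh_ops g) f).
Let kE := linE (shom_linear hk).
Let kbr := shom_br hk.
Let kact := shom_act hk.
Lemma hom_genJ A (x : sl2 K) : k (x 0 1 *: A - x 0 0 *: F0 A - 2%:R^-1 *: (x 1 0 *: F0 (F0 A)))
  = x 0 1 *: k A - x 0 0 *: F (k A) - 2%:R^-1 *: (x 1 0 *: F (F (k A))).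
Proof. by rewrite !kE !kact. Qed.
Lemma hom_genM A (v : 'cV[K]_2) : k (v 0 0 *: A + v 1 0 *: F0 A) = v 0 0 *: k A + v 1 0 *: F (k A).
Proof. by rewrite !kE !kact. Qed.
Lemma hom_genBJ A A' : k (4%:R^-1 *: br0 (F0 A) (F0 A')) = 4%:R^-1 *: br (F (k A)) (F (k A')).
Proof. by rewrite !kE kbr !kact. Qed.
Lemma hom_genBM A A' : k (2%:R^-1 *: (br0 A (F0 A') - br0 (F0 A) A'))
  = 2%:R^-1 *: (br (k A) (F (k A')) - br (F (k A)) (k A')).
Proof. by rewrite !kE !kbr !kact. Qed.
End ShortHom.

Section Homs.
Variables (X : ternary_superalgebra K) (g : short_lie_superalgebra K).
Local Notation br := (lbr (sh_ops g)).
Local Notation F := (lact (sh_ops g) f).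

Section Formulas.
Variable k : TAG_space X -> g.
Hypothesis hk : is_short_hom (g := tagX X) k.
Lemma hom_J x a : k (TAG_J x a) = x 0 1 *: k (TAG_J e a) - x 0 0 *: F (k (TAG_J e a))
  - 2%:R^-1 *: (x 1 0 *: F (F (k (TAG_J e a)))).
Proof. exact: etrans (congr1 k (TAG_J_gen x a)) (hom_genJ hk _ _). Qed.
Lemma hom_M v m : k (TAG_M v m) = v 0 0 *: k (TAG_M e1 m) + v 1 0 *: F (k (TAG_M e1 m)).
Proof. exact: etrans (congr1 k (TAG_M_gen v m)) (hom_genM hk _ _). Qed.
Lemma hom_BJ a b : k (TAG_B (tJ (tMs X) a b))
  = 4%:R^-1 *: br (F (k (TAG_J e a))) (F (k (TAG_J e b))).
Proof. exact: etrans (congr1 k (TAG_BJ_gen a b)) (hom_genBJ hk _ _). Qed.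
Lemma hom_BM m n : k (TAG_B (tM (tJs X) m n))
  = 2%:R^-1 *: (br (k (TAG_M e1 m)) (F (k (TAG_M e1 n)))
      - br (F (k (TAG_M e1 m))) (k (TAG_M e1 n))).
Proof. exact: etrans (congr1 k (TAG_BM_gen m n)) (hom_genBM hk _ _). Qed.
End Formulas.

(** A morphism is determined by its values on e (x) a and e1 (x) m, since these
    generate. *)
Lemma hom_ext (k k' : short_hom (tagX X) g) :
  (forall a, sval k (TAG_J e a) = sval k' (TAG_J e a)) ->
  (forall m, sval k (TAG_M e1 m) = sval k' (TAG_M e1 m)) -> k = k'.
Proof.
case: k k' => [k hk] [k' hk'] /= eJ eM; apply: sig_eq => /=; apply/funext.
apply: (@S_ind K (tJs X) (tMs X) (TAG_Bs X)).
- by move=> x a; rewrite iJ_def -/(TAG_J x a) (hom_J hk) (hom_J hk') eJ.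
- by move=> v m; rewrite iM_def -/(TAG_M v m) (hom_M hk) (hom_M hk') eM.
- rewrite iD_def; apply: B_ind => [p q a b _ _|p q m n _ _||c x y hx hy].
  + by rewrite -/(TAG_B (tJ _ a b)) (hom_BJ hk) (hom_BJ hk') !eJ.
  + by rewrite -/(TAG_B (tM _ m n)) (hom_BM hk) (hom_BM hk') !eM.
  + by rewrite -iD_def (lin0 (@inD_linear _ _ _ _)) (lin0 (shom_linear hk)) (lin0 (shom_linear hk')).
  by rewrite -iD_def inD_linear (shom_linear hk) (shom_linear hk') iD_def hx hy.
by move=> c u v hu hv; rewrite (shom_linear hk) (shom_linear hk') hu hv.
Qed.

Section LiftHom.
Variable eta : ternary_hom X (thatX g).
Let u (a : tJs X) : g := (sval eta).1 a.
Let w (m : tMs X) : g := (sval eta).2 m.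
Let he := svalP eta.
Let lu : linear u.
Proof. by move=> c a b; exact: (congr1 val (thom_linear1 he c a b)). Qed.
Let lw : linear w.
Proof. by move=> c a b; exact: (congr1 val (thom_linear2 he c a b)). Qed.
Let eu : even_map u. Proof. by move=> i a da; exact: (thom_even1 he da). Qed.
Let ew : even_map w. Proof. by move=> i a da; exact: (thom_even2 he da). Qed.
Let wu a : wt 2%:R (u a). Proof. exact: wtV. Qed.
Let ww m : wt 1 (w m). Proof. exact: wtV. Qed.
Let u_jmul a b : u (jmul X a b) = pJ (u a) (u b).
Proof. exact: (congr1 val (thom_jmul he a b)). Qed.
Let w_jact a m : w (jact X a m) = br (u a) (F (w m)).
Proof. exact: (congr1 val (thom_jact he a m)). Qed.
Let u_star m n : u (star X m n) = br (w m) (w n).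
Proof. exact: (congr1 val (thom_star he m n)). Qed.
Let w_tri m n r : w (tri X m n r) = - br (br (w m) (F (w n))) (w r).
Proof. exact: (congr1 val (thom_tri he m n r)). Qed.
Let R := inner_rep_exists char0 (tax X) lu lw eu ew wu ww u_jmul w_jact u_star w_tri.
Let bt := projT1 (cid R).
Let hR := projT2 (cid R).
Let IA := Bs_inner_algebra n2 (tax X).

Lemma lift_hom_subproof : is_short_hom (g := tagX X) (lift u w bt).
Proof.
split.
- exact: (lift_linear char0 lu lw hR).
- exact: (lift_even char0 lu lw eu ew hR).
- exact: (lift_br char0 (tax X) lu lw eu ew wu ww u_jmul w_jact u_star IA hR).
- move=> x v; exact: (lift_act char0 lu lw wu ww hR x v).
Qed.
Definition lift_hom : short_hom (tagX X) g := exist _ (lift u w bt) lift_hom_subproof.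
Lemma lift_homJ a : sval lift_hom (TAG_J e a) = u a.
Proof.
have := lift_J char0 lu lw hR e a; rewrite iJ_def !e_E => k_e.
by apply: etrans k_e _; lm0.
Qed.
Lemma lift_homM m : sval lift_hom (TAG_M e1 m) = w m.
Proof.
have := lift_M char0 lu lw hR e1 m; rewrite iM_def !e1_E => k_e.
by apply: etrans k_e _; lm0.
Qed.
End LiftHom.
End Homs.
(** ** The functor of highest weight vectors *)

Section ThatMap.
Variables (g g' : short_lie_superalgebra K) (phi : short_hom g g').
Let hp := svalP phi.
Let pE := linE (shom_linear hp).
Let p2 (a : weight g 2%:R) : g' := sval phi a.
Let p1 (m : weight g 1) : g' := sval phi m.
Let wt_phi k x : wt k x -> wt k (sval phi x).
Proof. by rewrite /wt => hx; rewrite -(shom_act hp) hx pE. Qed.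
Let L := that_object char0 g.
Let G := thatX g.

Let p2_linear : linear p2. Proof. by move=> c a b; exact: (shom_linear hp). Qed.
Let p1_linear : linear p1. Proof. by move=> c a b; exact: (shom_linear hp). Qed.
Let p2_even : even_map p2. Proof. by move=> i a da; exact: (shom_even hp). Qed.
Let p1_even : even_map p1. Proof. by move=> i a da; exact: (shom_even hp). Qed.
Let p2_wt a : wt 2%:R (p2 a). Proof. exact/wt_phi/wtV. Qed.
Let p1_wt a : wt 1 (p1 a). Proof. exact/wt_phi/wtV. Qed.
Let p2_jmul a b : 2%:R *: p2 (jmul G a b) = lbr (sh_ops g') (p2 a) (lact (sh_ops g') f (p2 b)).
Proof. by rewrite /p2 -!pE (That_jmul L) (shom_br hp) (shom_act hp). Qed.
Let p1_jact a m : p1 (jact G a m) = lbr (sh_ops g') (p2 a) (lact (sh_ops g') f (p1 m)).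
Proof. by rewrite /p1 (That_jact L) (shom_br hp) (shom_act hp). Qed.
Let p2_star m n : p2 (star G m n) = lbr (sh_ops g') (p1 m) (p1 n).
Proof. by rewrite /p2 (That_star L) (shom_br hp). Qed.
Let p1_tri m n r : p1 (tri G m n r)
  = - lbr (sh_ops g') (lbr (sh_ops g') (p1 m) (lact (sh_ops g') f (p1 n))) (p1 r).
Proof. by rewrite /p1 (That_tri L) pE !(shom_br hp) (shom_act hp). Qed.

Definition that_hom_map : ternary_hom (thatX g) (thatX g') :=
  @that_hom (thatX g) g' p2 p1 p2_linear p1_linear p2_even p1_even p2_wt p1_wt
    p2_jmul p1_jact p2_star p1_tri.
End ThatMap.

Lemma ternary_hom_eq (X : ternary_superalgebra K) (g : short_lie_superalgebra K)
    (p q : ternary_hom X (thatX g)) :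
  (forall a, ((sval p).1 a : g) = (sval q).1 a) ->
  (forall m, ((sval p).2 m : g) = (sval q).2 m) -> p = q.
Proof.
case: p q => [[p1 p2] hp] [[q1 q2] hq] /= e1 e2; apply: sig_eq => /=.
by congr (_, _); apply/funext => x; apply: val_inj; [exact: e1|exact: e2].
Qed.

Fact that_hom_map_id g : that_hom_map (@idc (short_cat K) g) = @idc (ternary_cat K) (thatX g).
Proof. exact: ternary_hom_eq. Qed.
Fact that_hom_map_comp (g1 g2 g3 : short_lie_superalgebra K) (v : short_hom g2 g3) (u : short_hom g1 g2) :
  that_hom_map (@compc (short_cat K) g1 g2 g3 v u)
  = @compc (ternary_cat K) (thatX g1) (thatX g2) (thatX g3) (that_hom_map v) (that_hom_map u).
Proof. exact: ternary_hom_eq. Qed.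

Definition that_functor_map : @functor (short_cat K) (ternary_cat K) thatX :=
  @Functor (short_cat K) (ternary_cat K) thatX that_hom_map that_hom_map_id that_hom_map_comp.

Fact that_functor_mapE g g' (phi : short_hom g g') :
  let eta := sval (fmap that_functor_map phi : ternary_hom _ _) in
  (forall a : weight g 2%:R, (eta.1 a : g') = sval phi a) /\
  (forall m : weight g 1, (eta.2 m : g') = sval phi m).
Proof. by []. Qed.

Definition that_functor : That_functor K :=
  @ThatFunctor K (that_object char0) that_functor_map that_functor_mapE.

(** ** The functor TAG *)

Section TagMap.
Variables (X Y : ternary_superalgebra K) (eta : ternary_hom X Y).
Definition tag_hom_map : short_hom (tagX X) (tagX Y) :=
  lift_hom (@compc (ternary_cat K) X Y (thatX (tagX Y)) (unitX Y) eta).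
Let k : TAG_space X -> TAG_space Y := sval tag_hom_map.
Let hk : is_short_hom (g := tagX X) (g' := tagX Y) k := svalP tag_hom_map.
Lemma tag_hom_map_e a : k (TAG_J e a) = TAG_J e ((sval eta).1 a).
Proof. exact: (lift_homJ (g := tagX Y)). Qed.
Lemma tag_hom_map_e1 m : k (TAG_M e1 m) = TAG_M e1 ((sval eta).2 m).
Proof. exact: (lift_homM (g := tagX Y)). Qed.
Lemma tag_hom_mapE :
  [/\ forall x a, k (TAG_J x a) = TAG_J x ((sval eta).1 a),
      forall v m, k (TAG_M v m) = TAG_M v ((sval eta).2 m),
      forall a b, k (TAG_B (tJ _ a b)) = TAG_B (tJ _ ((sval eta).1 a) ((sval eta).1 b))
    & forall m n, k (TAG_B (tM _ m n)) = TAG_B (tM _ ((sval eta).2 m) ((sval eta).2 n))].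
Proof.
split.
- move=> x a; apply: etrans (@hom_J X (tagX Y) k hk x a) _.
  by rewrite tag_hom_map_e; apply: esym; exact: TAG_J_gen.
- move=> v m; apply: etrans (@hom_M X (tagX Y) k hk v m) _.
  by rewrite tag_hom_map_e1; apply: esym; exact: TAG_M_gen.
- move=> a b; apply: etrans (@hom_BJ X (tagX Y) k hk a b) _.
  by rewrite !tag_hom_map_e; apply: esym; exact: TAG_BJ_gen.
- move=> m n; apply: etrans (@hom_BM X (tagX Y) k hk m n) _.
  by rewrite !tag_hom_map_e1; apply: esym; exact: TAG_BM_gen.
Qed.
End TagMap.

Fact tag_hom_map_id X : tag_hom_map (@idc (ternary_cat K) X) = @idc (short_cat K) (tagX X).
Proof.
apply: (@hom_ext X (tagX X)) => a; first exact: tag_hom_map_e.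
exact: tag_hom_map_e1.
Qed.
Fact tag_hom_map_comp (X Y Z : ternary_superalgebra K) (v : ternary_hom Y Z) (u : ternary_hom X Y) :
  tag_hom_map (@compc (ternary_cat K) X Y Z v u)
  = @compc (short_cat K) (tagX X) (tagX Y) (tagX Z) (tag_hom_map v) (tag_hom_map u).
Proof.
apply: (@hom_ext X (tagX Z)) => a; apply: esym.
- apply: etrans (congr1 (sval (tag_hom_map v)) (tag_hom_map_e u a)) _.
  by apply: etrans (tag_hom_map_e v _) _; apply: esym;
    exact: (tag_hom_map_e (@compc (ternary_cat K) X Y Z v u)).
- apply: etrans (congr1 (sval (tag_hom_map v)) (tag_hom_map_e1 u a)) _.
  by apply: etrans (tag_hom_map_e1 v _) _; apply: esym;
    exact: (tag_hom_map_e1 (@compc (ternary_cat K) X Y Z v u)).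
Qed.

Definition tag_functor_map : @functor (ternary_cat K) (short_cat K) tagX :=
  @Functor (ternary_cat K) (short_cat K) tagX tag_hom_map tag_hom_map_id tag_hom_map_comp.

Definition tag_functor : TAG_functor K :=
  @TAGFunctor K (tag_object n2) tag_functor_map tag_hom_mapE.

(** ** The adjunction

    The bijection restricts a morphism to highest weight vectors and composes it
    with the unit, that is, evaluates it on e (x) a and e1 (x) m. *)
Definition transpose (X : ternary_superalgebra K) (g : short_lie_superalgebra K)
    (k : short_hom (tagX X) g) : ternary_hom X (thatX g) :=
  @compc (ternary_cat K) X (thatX (tagX X)) (thatX g) (that_hom_map k) (unitX X).

Lemma transpose_bij X g : bijective (@transpose X g).
Proof.
exists (@lift_hom X g) => [k|eta].
  apply: (@hom_ext X g) => [a|m]; [exact: lift_homJ|exact: lift_homM].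
apply: ternary_hom_eq => [a|m]; [exact: lift_homJ|exact: lift_homM].
Qed.

Lemma TAG_That_adjoint : left_adjoint (TAG_map tag_functor) (That_map that_functor).
Proof.
exists transpose; split=> [X g|X X' g g' u k w]; first exact: transpose_bij.
apply: ternary_hom_eq => [a|m].
- exact: (congr1 (fun v => sval w (sval k v)) (tag_hom_map_e u a)).
- exact: (congr1 (fun v => sval w (sval k v)) (tag_hom_map_e1 u m)).
Qed.
End Adjunction.

Theorem theorem5p4 (R : realType) :
  exists (TAG : TAG_functor (complex R)) (That : That_functor (complex R)),
    left_adjoint (TAG_map TAG) (That_map That).
Proof.
have char0 n : n.+1%:R != 0 :> complex R by rewrite Num.Theory.pnatr_eq0.
by exists (tag_functor char0), (that_functor char0); exact: TAG_That_adjoint.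
Qed.
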